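(* Let $d\ge1$ be an integer, $s>0$, $1\le p<\infty$, $1\le q\le\infty$ with $s-d/p>0$. (i) For all functions $f\in B^s_{p,q}([0,1]^d)$ and all $h\in[s-d/p,s]$, $$\dim_{\mathcal P}\big(E_{\rm HR}(h,f)\big)\le d+(h-s)p .$$ (ii) There exists a function $f\in B^s_{p,q}([0,1]^d)$ such that, for all $h\in[s-d/p,s]$, $$\dim_{\mathcal P}\big(E_{\rm HR}(h,f)\big)=\dim_{\mathcal H}\big(E_{\rm HR}(h,f)\big)=d+(h-s)p .$$
   Context: Hölder exponents. Let $f:\mathbb R^d\to\mathbb R$ be locally bounded and $x_0\in\mathbb R^d$. For $\alpha>0$, $f\in\mathcal C^\alpha(x_0)$ if there exist $C,R>0$ and a polynomial $P$ of degree less than $\alpha$ such that $\|f-P\|_{L^\infty(B(x_0,r))}\le Cr^\alpha$ for all $r\in(0,R]$; the lower pointwise Hölder exponent $h^-(x_0)$ is the supremum of the $\alpha>0$ such that $f\in\mathcal C^\alpha(x_0)$. Finite differences are defined by $\Delta^1_uf(x)=f(x+u)-f(x)$ and $\Delta^{n+1}_uf(x)=\Delta^n_uf(x+u)-\Delta^n_uf(x)$. One says $f\in\mathcal I^\alpha(x_0)$ if there exist $C,R>0$ such that for all $r\in(0,R)$, $$\sup_{\|u\|\le r}\big\|\Delta_u^{[\alpha]+1}f\big\|_{L^\infty(B^\alpha_u(x_0,r))}\ge Cr^\alpha,\qquad B^\alpha_u(x_0,r)=\{x:\ [x,x+([\alpha]+1)u]\subset B(x_0,r)\},$$ where $[\alpha]$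 is the integer part of $\alpha$ and $[x,y]$ the segment. The upper pointwise Hölder exponent $h^+(x_0)$ is the infimum of the $\alpha$ such that $f\in\mathcal I^\alpha(x_0)$. Set $$E_{\rm HR}(h,f)=\{x\in[0,1]^d:\ h^-(x)=h^+(x)=h\}.$$ Besov space. $B^s_{p,q}([0,1]^d)$ is the usual Besov space, described by wavelets: fix an integer $N\ge s$ and compactly supported, sufficiently smooth functions $\varphi$ and $\psi^{(i)}$, $1\le i<2^d$, each $\psi^{(i)}$ having at least $N+1$ vanishing moments, such that $\{\varphi(x-k)\}_{k\in\mathbb Z^d}\cup\{\psi^{(i)}(2^jx-k)\}_{1\le i<2^d,\,k\in\mathbb Z^d,\,j\ge0}$ is an orthogonal basis of $L^2(\mathbb R^d)$. Then $B^s_{p,q}([0,1]^d)$ consists of the functions $$f(x)=c_0\varphi(x)+\sum_{j\ge0}\ \sum_{k\in\{0,\dots,2^j-1\}^d}\ \sum_{i=1}^{2^d-1}c^{(i)}_{j,k}\,\psi^{(i)}(2^jx-k)$$ such that $\Big(\sum_{j}\big(2^{(sp-d)j}\sum_{k}\sum_i|c^{(i)}_{j,k}|^p\big)^{q/p}\Big)^{1/q}<\infty$ (usual modification if $q=\infty$); since $s>d/p$ such functions are continuous. $\dim_{\mathcal H}$, $\dim_{\mathcal P}$ are Hausdorff and packing dimension (the empty set has dimension $0$). *)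

(* Defs.v *)
(* R^d is 'rV[R]_d with the library's max norm. Replacing it by an equivalent
   norm changes neither the pointwise exponents nor the dimensions below. *)
From HB Require Import structures.
From mathcomp Require Import all_boot all_order all_algebra.
From mathcomp Require Import all_classical all_reals all_analysis.
From mathcomp Require mpoly.
Import (canonicals, coercions) mpoly.
Set Implicit Arguments.
Unset Strict Implicit.
Unset Printing Implicit Defensive.
Import Order.TTheory GRing.Theory Num.Theory.
Import numFieldNormedType.Exports.
Local Open Scope classical_set_scope.
Local Open Scope ring_scope.

(* The library has the product sigma-algebra on n.-tuple but no product measure
   there: the Lebesgue measure on R^n.+1 is the image of
   lebesgue_measure \x (Lebesgue measure on R^n) by (x, t) |-> x :: t. *)
Section lebesgue_cons.
Context (R : realType) (n : nat).
Local Notation T := (measurableTypeR R).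
Variable m : {sigma_finite_measure set (n.-tuple T) -> \bar R}.

Let tcons (xt : T * n.-tuple T) : n.+1.-tuple T := [tuple of xt.1 :: xt.2].

Let measurable_tcons : measurable_fun [set: T * n.-tuple T] tcons.
Proof. by apply: measurable_cons. Qed.

Definition lebesgue_cons (A : set (n.+1.-tuple T)) : \bar R :=
  (lebesgue_measure \x m)%E (tcons @^-1` A).

Let lebesgue_cons0 : lebesgue_cons set0 = 0%E.
Proof. by rewrite /lebesgue_cons preimage_set0 measure0. Qed.

Let lebesgue_cons_ge0 A : (0 <= lebesgue_cons A)%E.
Proof. exact: measure_ge0. Qed.

Let lebesgue_cons_sigma_additive : semi_sigma_additive lebesgue_cons.
Proof.
exact: (@measure_semi_sigma_additive _ _ _
  (pushforward (lebesgue_measure \x m)%E tcons)).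
Qed.

HB.instance Definition _ := isMeasure.Build _ _ _ lebesgue_cons
  lebesgue_cons0 lebesgue_cons_ge0 lebesgue_cons_sigma_additive.

Let lebesgue_cons_sigma_finite : sigma_finite setT lebesgue_cons.
Proof.
have /sigma_finiteP[F [FT ndF Foo]] := sigma_finiteT (@lebesgue_measure R).
have /sigma_finiteP[G [GT ndG Goo]] := sigma_finiteT m.
pose H k : set (n.+1.-tuple T) :=
  [set t | F k (thead t) /\ G k [tuple of behead t]].
exists H.
  apply/seteqP; split => // t _.
  have [i _ Fi] : (\bigcup_i F i) (thead t) by rewrite -FT.
  have [j _ Gj] : (\bigcup_i G i) [tuple of behead t] by rewrite -GT.
  exists (maxn i j) => //; split.
  - by move: Fi; exact/subsetPset/ndF/leq_maxl.
  - by move: Gj; exact/subsetPset/ndG/leq_maxr.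
move=> k; have [mF Fk] := Foo k; have [mG Gk] := Goo k; split.
  rewrite (_ : H k = (@tnth n.+1 T ^~ ord0) @^-1` F k `&`
      (fun t : n.+1.-tuple T => [tuple of behead t]) @^-1` G k)//.
  apply: measurableI; rewrite -[X in measurable X]setTI.
  - exact: measurable_tnth.
  - exact: measurable_behead.
rewrite /lebesgue_cons (_ : _ @^-1` _ = F k `*` G k); last first.
  apply/seteqP; split => -[x t] /= [Fx Gt]; split => //=.
  - by rewrite (_ : t = [tuple of behead (tcons (x, t))])//; exact/val_inj.
  - by rewrite (_ : [tuple of _] = t)//; exact/val_inj.
by rewrite product_measure1E// lte_mul_pinfty// ge0_fin_numE.
Qed.

HB.instance Definition _ := Measure_isSigmaFinite.Build _ _ _ lebesgue_cons
  lebesgue_cons_sigma_finite.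

End lebesgue_cons.

Section lebesgue0.
Context (R : realType).

Definition lebesgue0 : set (0.-tuple (measurableTypeR R)) -> \bar R :=
  dirac [tuple].
HB.instance Definition _ := Measure.on lebesgue0.

Let lebesgue0_sigma_finite : sigma_finite setT lebesgue0.
Proof.
by apply: fin_num_fun_sigma_finite; rewrite ?measure0//; exact: fin_num_measure.
Qed.

HB.instance Definition _ := Measure_isSigmaFinite.Build _ _ _ lebesgue0
  lebesgue0_sigma_finite.

End lebesgue0.

Fixpoint lebesgue (R : realType) (n : nat) :
    {sigma_finite_measure set (n.-tuple (measurableTypeR R)) -> \bar R} :=
  match n with
  | 0 => @lebesgue0 R
  | n'.+1 => lebesgue_cons (lebesgue R n')
  end.

(* Functions on 'rV[R]_d are integrated after composition with [vec]. *)
Definition vec (R : realType) d (t : d.-tuple (measurableTypeR R)) : 'rV[R]_d :=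
  \row_i tnth t i.

Section pointwise_exponents.
Context (R : realType) (d : nat).
Implicit Types (f : 'rV[R]_d -> R) (x u : 'rV[R]_d) (a r h : R).

Definition Linf_norm (D : set 'rV[R]_d) f : \bar R :=
  'N[lebesgue R d]_+oo[(fun t => (f (vec t) * \1_D (vec t))%:E)]%E.

Definition peval (P : mpoly.mpoly d R) x : R := mpoly.meval (fun i => x 0 i) P.

(* [msize] is one plus the total degree. *)
Definition holder_space a x0 f : Prop :=
  exists C r0 : R, exists P : mpoly.mpoly d R,
    [/\ 0 < C, 0 < r0, (mpoly.msize P).-1%:R < a
      & forall r, 0 < r <= r0 ->
          (Linf_norm (ball x0 r) (fun x => f x - peval P x)%R
             <= (C * r `^ a)%:E)%E].

Definition lower_exponent f x0 : \bar R :=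
  ereal_sup [set a%:E | a in [set a | 0 < a /\ holder_space a x0 f]].

Fixpoint finite_diff (n : nat) u f x : R :=
  match n with
  | 0 => f x
  | n'.+1 => finite_diff n' u f (x + u) - finite_diff n' u f x
  end.

Definition diff_domain (n : nat) u x0 r : set 'rV[R]_d :=
  [set x | forall t : R, 0 <= t <= 1 -> ball x0 r (x + t *: (u *+ n))].

Definition irregular_space a x0 f : Prop :=
  let n := (Num.truncn a).+1 in
  exists C r0 : R,
    [/\ 0 < C, 0 < r0
      & forall r, 0 < r < r0 ->
          ((C * r `^ a)%:E <=
             ereal_sup [set Linf_norm (diff_domain n u x0 r) (finite_diff n u f)
                       | u in [set u : 'rV[R]_d | (`|u| <= r)%R]])%E].

Definition upper_exponent f x0 : \bar R :=
  ereal_inf [set a%:E | a in [set a | 0 < a /\ irregular_space a x0 f]].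

Definition E_HR h f : set 'rV[R]_d :=
  [set x : 'rV[R]_d | [/\ forall i, 0 <= x 0 i <= 1,
               lower_exponent f x = h%:E & upper_exponent f x = h%:E]].

End pointwise_exponents.

Section fractal_dimensions.
Context (R : realType) (V : normedModType R).
Implicit Types (A E : set V) (t e : R).
Local Open Scope ereal_scope.

Definition diam A : \bar R :=
  ereal_sup [set `|xy.1 - xy.2|%R%:E | xy in A `*` A].

(* The empty set contributes 0 also when t = 0. *)
Definition diam_pow t A : \bar R := if A == set0 then 0 else diam A `^ t.

Definition hausdorff_premeasure e t E : \bar R :=
  ereal_inf [set \sum_(0 <= n <oo) diam_pow t (U n)
            | U in [set U : nat -> set V |
                E `<=` \bigcup_n U n /\ forall n, diam (U n) <= e%:E]].

Definition hausdorff_measure t E : \bar R :=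
  ereal_sup [set hausdorff_premeasure e t E | e in [set e : R | (0 < e)%R]].

Definition hausdorff_dim E : \bar R :=
  ereal_inf [set t%:E | t in [set t : R |
    (0 <= t)%R /\ hausdorff_measure t E = 0]].

(* Packings: countable families of disjoint closed balls centred in E. *)
Definition packing_sums e t E : set (\bar R) :=
  [set v | exists (I : set nat) (x : nat -> V) (r : nat -> R),
    [/\ forall n, I n -> E (x n) /\ (0 < r n <= e)%R,
        trivIset I (fun n => closed_ball (x n) (r n))
      & v = \esum_(n in I) ((2 * r n) `^ t)%:E]].

Definition packing_premeasure t E : \bar R :=
  ereal_inf [set ereal_sup (packing_sums e t E) | e in [set e : R | (0 < e)%R]].

Definition packing_measure t E : \bar R :=
  ereal_inf [set \sum_(0 <= n <oo) packing_premeasure t (A n)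
            | A in [set A : nat -> set V | E `<=` \bigcup_n A n]].

Definition packing_dim E : \bar R :=
  ereal_inf [set t%:E | t in [set t : R |
    (0 <= t)%R /\ packing_measure t E = 0]].

End fractal_dimensions.

(* Hilbert-space sense: pairwise orthogonal nonzero vectors whose finite linear
   combinations are dense in L^2(mu). *)
Definition orthogonal_basis_L2 d (T : measurableType d) (R : realType)
    (mu : {measure set T -> \bar R}) (I : Type) (b : I -> T -> R) : Prop :=
  [/\ forall i, b i \in Lfun mu 2%:E /\ ('N[mu]_2%:E[EFin \o b i] != 0)%E,
      forall i j, i <> j -> (\int[mu]_t (b i t * b j t)%:E = 0)%E
    & forall g, g \in Lfun mu 2%:E -> forall e : R, 0 < e ->
        exists (s : seq I) (a : I -> R),
          ('N[mu]_2%:E[(fun t => (g t - \sum_(i <- s) a i * b i t)%:E)] < e%:E)%E].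

Section besov.
Context (R : realType) (d : nat).
Local Notation V := ('rV[R]_d).
Local Notation psi_index := 'I_(2 ^ d).-1.
Implicit Types (f phi : V -> R) (psi : psi_index -> V -> R) (s p : R).

Fixpoint class_C (n : nat) f : Prop :=
  match n with
  | 0 => continuous f
  | n'.+1 => (forall x, differentiable f x) /\
             forall i : 'I_d, class_C n' ('D_(delta_mx 0 i) f)
  end.

Definition compactly_supported f : Prop := compact (closure [set x | f x != 0]).

(* All moments of total degree at most N vanish. *)
Definition vanishing_moments (N : nat) f : Prop :=
  forall m : 'I_d -> nat, (\sum_i m i <= N)%N ->
    (\int[lebesgue R d]_t
       ((\prod_i vec t 0 i ^+ m i) * f (vec t))%:E = 0)%E.

Definition wavelet_family phi psi
    (k : 'rV[int]_d + psi_index * nat * 'rV[int]_d) : V -> R :=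
  match k with
  | inl k => fun x => phi (x - map_mx intr k)
  | inr (i, j, k) => fun x => psi i (2 ^+ j *: x - map_mx intr k)
  end.

(* "Sufficiently smooth" is read as class C^(N+1), which matches the N+1
   vanishing moments. *)
Record wavelet_system (N : nat) phi psi : Prop := WaveletSystem {
  phi_compact : compactly_supported phi ;
  psi_compact : forall i, compactly_supported (psi i) ;
  phi_smooth : class_C N.+1 phi ;
  psi_smooth : forall i, class_C N.+1 (psi i) ;
  psi_moments : forall i, vanishing_moments N (psi i) ;
  wavelet_basis : orthogonal_basis_L2 (lebesgue R d)
    (fun k t => wavelet_family phi psi k (vec t)) }.

Definition besov_coefs := forall j : nat, 'rV['I_(2 ^ j)]_d -> psi_index -> R.
Implicit Types c : besov_coefs.

Definition wavelet_layer psi c (j : nat) (x : V) : R :=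
  \sum_(k : 'rV['I_(2 ^ j)]_d) \sum_(i < (2 ^ d).-1)
    c j k i * psi i (2 ^+ j *: x - map_mx (fun m : 'I_(2 ^ j) => m%:R) k).

Definition besov_layer s p c (j : nat) : R :=
  2 `^ ((s * p - d%:R) * j%:R) *
  \sum_(k : 'rV['I_(2 ^ j)]_d) \sum_(i < (2 ^ d).-1) `|c j k i| `^ p.

Definition besov_norm s p (q : \bar R) c : \bar R :=
  match q with
  | q%:E => ((\sum_(0 <= j <oo) (besov_layer s p c j `^ (q / p))%:E) `^ q^-1)%E
  | _ => ereal_sup (range (fun j => (besov_layer s p c j `^ p^-1)%:E))
  end.

Definition besov phi psi s p (q : \bar R) : set (V -> R) :=
  [set f | exists (c0 : R) (c : besov_coefs),
    (besov_norm s p q c < +oo)%E /\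
    forall x, (fun n => c0 * phi x + \sum_(0 <= j < n) wavelet_layer psi c j x)
                @ \oo --> f x].

End besov.

(* Main.v *)
Require Import Defs.
From HB Require Import structures.
From mathcomp Require Import all_boot all_order all_algebra finmap.
From mathcomp Require Import all_classical all_reals all_analysis.
From mathcomp Require Import ring lra zify.
From mathcomp Require mpoly.
Import (canonicals, coercions) mpoly.
Set Implicit Arguments.
Unset Strict Implicit.
Unset Printing Implicit Defensive.
Import Order.TTheory GRing.Theory Num.Theory.
Import numFieldNormedType.Exports.
Local Open Scope classical_set_scope.
Local Open Scope ring_scope.

(* Upper bound. If h^-(x) = h^+(x) = h then, at every small scale 2 ^ -j, f is
   within 2 ^ (-(h - e) j) of a polynomial of degree < n near x while some n-th
   difference of f with step at most 2 ^ -j is at least 2 ^ (-(h + e) j). If the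
   wavelet coefficients seen from the ball of radius 2 ^ -j around x were all too
   small for the second property ("tame" below), then f would be close to a
   polynomial of degree at most N on a segment 2 ^ (del j) times longer than the
   step, and so its n-th difference would be too small. Hence x sees an atypically
   large coefficient at every small scale, and the l^p bound on the coefficients
   allows this for at most about 2 ^ ((d + (h - s) p) j) separated points. As this
   holds at every scale, and not only along a sequence of scales, it bounds the
   packing dimension.

   Saturation. Fix sparse generations j_m, with j_{m+1} = j_m + m + 4, and a
   product-like probability weight on the dyadic cells of generation m which
   gives weight 2 ^ (-beta j_m) to a set of about 2 ^ (beta j_m) cells,
   simultaneously for all beta in [0, d]. One wavelet per cell, well inside it,
   has coefficient 2 ^ (-(s - d/p) j_m) weight ^ (1/p), up to a factor (j + 1) ^
   -2 which makes the Besov norm finite for every q. Points whose digits follow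
   the pattern of exponent beta = d + (h - s) p stay away from the supports of
   the wavelets of all the other cells except finer ones of comparable or
   smaller weight, so that f is about r ^ h at most on the ball of radius r
   there, while the wavelet of the own cell gives differences of order r ^ h at
   all scales since j_{m+1} / j_m tends to 1. The inverse of the coding map is
   almost Hoelder of exponent beta / d and its range is a cube, which gives the
   lower bound on the Hausdorff dimension. *)

(** * Lebesgue measure and supremum norms *)

(** In the upper bound two polynomials compete. The one read off the wavelets has degree up to N, so
    the n-th difference with n = [h] + 1 need not kill it; the one given by h^- is killed, but is
    accurate only to order h - e. Their difference has bounded degree and size about 2 ^ (-(h - e)
    j) on the long segment, so its n-th difference with a step 2 ^ (del j) times shorter gains 2 ^
    (-n del j). As n > h, this beats the lower bound 2 ^ (-(h + e) (1 + del) j) once e is small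
    against del (n - h); del tends to 0 at the end. In the saturation one weight has to serve every
    exponent. Mixing m + 5 uniform weights costs only a factor 1 / (m + 5) per block, and the
    product of these factors is 2 ^ (-o(j_m)) because j_m grows quadratically. As the weights of a
    generation add up to 1, their p-th roots fit the l^p budget of that generation. In each
    coordinate the coded points stay in the part [1/2, 3/4] of their cells while the wavelets sit
    near 1/4: this gap makes all coarser layers vanish near the points, so that the zero polynomial
    already shows the regularity. *)

Section max_norm.
Context (R : realType).

Lemma rV_norm_le d (x : 'rV[R]_d) e :
  0 <= e -> (forall i, `|x 0 i| <= e) -> `|x| <= e.
Proof.
move=> e0 xe; change (mx_norm x <= e).
have [->//|/mx_norm_neq0[[i j]] ->/=] := eqVneq (mx_norm x) 0.
by rewrite (ord1 i).
Qed.

Lemma rV_norm_ge d (x : 'rV[R]_d) i : `|x 0 i| <= `|x|.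
Proof.
change (`|x 0 i| <= mx_norm x); rewrite mx_normrE.
by apply: (@le_bigmax _ _ _ _ (fun ij => `|x ij.1 ij.2|) (0, i)).
Qed.

Lemma rV_norm_lt d (x : 'rV[R]_d) e :
  0 < e -> (forall i, `|x 0 i| < e) -> `|x| < e.
Proof.
move=> e0 xe; change (mx_norm x < e).
have [->//|/mx_norm_neq0[[i j]] ->/=] := eqVneq (mx_norm x) 0.
by rewrite (ord1 i).
Qed.

End max_norm.

Section lebesgue_box.
Context (R : realType).
Local Notation T := (measurableTypeR R).

(** A closed ball of the maximum norm, written on tuples because that is where the Lebesgue measure
    lives. *)
Definition box n (c : 'I_n -> R) (e : R) : set (n.-tuple T) :=
  [set t | forall i, `|tnth t i - c i| <= e].

Lemma measurable_box n (c : 'I_n -> R) e : measurable (box c e).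
Proof.
have -> : box c e = \bigcap_(i in [set: 'I_n])
    (@tnth n T ^~ i) @^-1` `[c i - e, c i + e]%classic.
  apply/seteqP; split => t /= tc i.
    by move=> _; rewrite /= in_itv/= -ler_distl.
  by have := tc i I; rewrite /= in_itv/= -ler_distl.
apply: fin_bigcap_measurable => // i _; rewrite -[X in measurable X]setTI.
by apply: measurable_tnth => //; exact: measurable_itv.
Qed.

Lemma lebesgue_box n (c : 'I_n -> R) e : 0 <= e ->
  lebesgue R n (box c e) = ((2 * e) ^+ n)%:E.
Proof.
move=> e0; elim: n c => [|n IH] c.
  rewrite expr0 /= /lebesgue0 diracE mem_set//.
  by move=> [].
rewrite /= /lebesgue_cons.
rewrite (_ : _ @^-1` _ = `[c ord0 - e, c ord0 + e]%classic `*`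
    box (fun i => c (lift ord0 i)) e); last first.
  apply/seteqP; split => -[x t] /=.
    move=> xt; split.
      by have := xt ord0; rewrite in_itv/= -ler_distl.
    by move=> i; have := xt (lift ord0 i); rewrite tnthS.
  move=> [xc tc] i; case: (unliftP ord0 i) => [j|] ->.
    by rewrite tnthS.
  by rewrite tnth0; move: xc; rewrite in_itv/= -ler_distl.
rewrite product_measure1E//; last exact: measurable_box.
rewrite [X in (_ * X)%E]IH.
rewrite [X in (X * _)%E](_ : _ = (2 * e)%:E); last first.
  rewrite [LHS]lebesgue_measure_itv/= lte_fin; case: ltP => [_|ee].
    by rewrite -EFinB; congr EFin; lra.
  by congr EFin; lra.
by rewrite -EFinM exprS.
Qed.

End lebesgue_box.

Section Linf.
Context (R : realType) (d : nat).
Implicit Types (f : 'rV[R]_d -> R) (D : set 'rV[R]_d).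

(** The L^oo norm unfolds to an essential supremum only on a space of positive measure. *)
Lemma lebesgueT_gt0 : (0 < lebesgue R d [set: _])%E.
Proof.
have : (0 < lebesgue R d (box (fun=> 0%R) 1%R))%E.
  by rewrite lebesgue_box// lte_fin; apply: exprn_gt0; lra.
by move=> /lt_le_trans; apply; apply: le_measure => //;
  rewrite inE//; exact: measurable_box.
Qed.

Lemma Linf_norm_le D f b : 0 <= b -> (forall x, D x -> `|f x| <= b) ->
  (Linf_norm D f <= b%:E)%E.
Proof.
move=> b0 fb; rewrite /Linf_norm unlock lebesgueT_gt0.
apply: ereal_inf_lbound => /=; apply/nearW => t /=.
rewrite lee_fin indicE; have [tD|_] := boolP (vec t \in D).
  by rewrite mulr1; apply: fb; move: tD; rewrite inE.
by rewrite mulr0 normr0.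
Qed.

(** An essential bound below |f y| would fail, by continuity, on a whole cube around y inside D, and
    cubes have positive measure. *)
Lemma Linf_norm_ge D f y : open D -> continuous f -> D y ->
  (`|f y|%:E <= Linf_norm D f)%E.
Proof.
move=> oD cf Dy; rewrite /Linf_norm unlock lebesgueT_gt0.
apply: le_ereal_inf_tmp => /= z /= [N [mN N0 subN]].
rewrite leNgt; apply/negP => zf.
have [e e0 eP] : exists2 e : R, 0 < e &
    forall x, `|x - y| <= e -> D x /\ (z < `|f x|%:E)%E.
  have nD : \forall x \near y, D x by exact: open_nbhs_nbhs.
  have nf : \forall x \near y, (z < `|f x|%:E)%E.
    case: z zf {subN} => [z|//|] zf.
    + have cn : {for y, continuous (fun x => `|f x|)}.
        by apply: continuous_comp; [exact: cf|exact: norm_continuous].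
      move: zf; rewrite lte_fin => /(cvgr_gt _ cn) zf.
      by near=> x; rewrite lte_fin; near: x.
    + by near=> x; rewrite ltNyr.
  have : \forall x \near y, D x /\ (z < `|f x|%:E)%E by apply: filterI.
  move=> /nbhs_ballP[e /= e0 eP].
  exists (e / 2); first by rewrite divr_gt0.
  move=> x xy; apply: eP; rewrite -ball_normE/= distrC.
  by rewrite (le_lt_trans xy)// ltr_pdivrMr//; lra.
have bN : box (fun i => y 0 i) e `<=` N.
  move=> t tb; apply: subN => /=; apply/negP; rewrite -ltNge.
  have [] := eP (vec t).
    apply: rV_norm_le; first exact: ltW.
    by move=> i; rewrite !mxE; exact: tb.
  move=> Dt; rewrite indicE mem_set// mulr1 => ->//.
have : (lebesgue R d (box (fun i => y ord0 i) e) <= lebesgue R d N)%E.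
  by apply: le_measure => //; rewrite inE//; exact: measurable_box.
rewrite [X in (_ <= X)%E]N0 lebesgue_box; last exact: ltW.
by apply/negP; rewrite -ltNge lte_fin exprn_gt0// mulr_gt0.
Unshelve. all: by end_near. Qed.

End Linf.

(** * Finite differences of polynomials *)

Section finite_differences.
Context (R : realType).
Implicit Types (g : R -> R) (q : {poly R}).

Fixpoint fdiff (n : nat) g (t : R) : R :=
  match n with
  | 0 => g t
  | n'.+1 => fdiff n' g (t + 1) - fdiff n' g t
  end.

Lemma finite_diff_line d n (u y : 'rV[R]_d) f t :
  finite_diff n u f (y + t *: u) = fdiff n (fun t => f (y + t *: u)) t.
Proof.
elim: n t => [//|n IH] t /=.
by rewrite -IH -IH scalerDl scale1r addrA.
Qed.

Lemma fdiff_le n g t b : (forall i, (i <= n)%N -> `|g (t + i%:R)| <= b) ->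
  `|fdiff n g t| <= 2 ^+ n * b.
Proof.
elim: n t => [|n IH] t gb /=.
  by have := gb 0 isT; rewrite addr0 expr0 mul1r.
rewrite (le_trans (ler_normB _ _))// exprS -mulrA.
have -> : forall x : R, 2 * x = x + x by move=> x; lra.
apply: lerD; apply: IH => i ni.
  by rewrite -addrA nat1r; exact: (gb i.+1 ni).
by apply: gb; rewrite leqW.
Qed.

Lemma fdiffB n g1 g2 t :
  fdiff n (fun x => g1 x - g2 x) t = fdiff n g1 t - fdiff n g2 t.
Proof. by elim: n t => [//|n IH] t /=; rewrite !IH; ring. Qed.

Lemma fdiff_sum n (I : Type) (r : seq I) (c : I -> R) (g : I -> R -> R) t :
  fdiff n (fun x => \sum_(i <- r) c i * g i x) t
  = \sum_(i <- r) c i * fdiff n (g i) t.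
Proof.
elim: n t => [//|n IH] t /=; rewrite !IH -sumrB.
by apply: eq_bigr => i _; rewrite mulrBr.
Qed.

Lemma eq_fdiff n g1 g2 t : g1 =1 g2 -> fdiff n g1 t = fdiff n g2 t.
Proof. by move=> /funext ->. Qed.

(** By the binomial formula the first difference of x ^ k is a combination of lower powers, which
    the remaining differences kill. *)
Lemma fdiff_expr n k t : (k < n)%N -> fdiff n (fun x => x ^+ k) t = 0.
Proof.
elim: n k t => [//|n IH] k t kn /=.
pose b (i : 'I_k) : R := 'C(k, i)%:R.
have E : fdiff n (fun x : R => \sum_(i < k) b i * x ^+ i) t = 0.
  rewrite (fdiff_sum _ _ b (fun i x => x ^+ i)) big1// => i _.
  by rewrite IH ?mulr0// (leq_trans (ltn_ord i)).
rewrite -{}E.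
have S m g s : fdiff m g (s + 1) = fdiff m (fun x => g (x + 1)) s.
  by elim: m s => [//|m IHm] s /=; rewrite !IHm.
rewrite S -fdiffB; apply: eq_fdiff => x.
rewrite [x + 1]addrC exprDn big_ord_recr/= subnn binn.
rewrite expr0 mul1r mulr1n addrK; apply: eq_bigr => i _.
by rewrite expr1n mul1r /b mulr_natl.
Qed.

Lemma fdiff_poly n q t : fdiff n (horner q) t =
  \sum_(i < size q) q`_i * fdiff n (fun x => x ^+ i) t.
Proof.
rewrite -(fdiff_sum n _ (fun i : 'I_(size q) => q`_i) (fun i x => x ^+ i)).
by apply: eq_fdiff => x; rewrite horner_coef.
Qed.

Lemma fdiff_poly0 n q t : (size q <= n)%N -> fdiff n (horner q) t = 0.
Proof.
move=> qn; rewrite fdiff_poly big1// => i _.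
by rewrite fdiff_expr ?mulr0// (leq_trans (ltn_ord i)).
Qed.

(** Interpolation at the nodes i / K: the coefficients are the values there times the inverse
    Vandermonde matrix, and C is one plus the sum of the absolute values of its entries. *)
Lemma coef_bound (K : nat) : exists2 C : R, 0 < C &
  forall q, (size q <= K)%N -> forall M, (forall x, 0 <= x <= 1 -> `|q.[x]| <= M) ->
  forall k, `|q`_k| <= C * M.
Proof.
pose a : 'rV[R]_K := \row_i (i%:R / K%:R).
pose V := Vandermonde K a.
have uV : V \in unitmx.
  rewrite unitmxE det_Vandermonde unitfE.
  apply/prodf_neq0 => i _; apply/prodf_neq0 => j ij; rewrite !mxE -mulrBl.
  rewrite mulf_neq0//.
    by rewrite subr_eq0 eqr_nat gtn_eqF.
  by rewrite invr_neq0// pnatr_eq0 -lt0n (leq_ltn_trans _ (ltn_ord i)).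
pose C := 1 + \sum_(k < K) \sum_(i < K) `|invmx V i k|.
have C1 : 1 <= C by rewrite lerDl sumr_ge0// => k _; apply: sumr_ge0.
exists C => [|q qK M qM k]; first by rewrite (lt_le_trans _ C1).
have M0 : 0 <= M by rewrite (le_trans _ (qM 0 _))// lexx ler01.
have [kK|Kk] := ltnP k K; last first.
  by rewrite nth_default ?normr0 ?mulr_ge0 ?(le_trans _ C1)// (leq_trans qK).
pose c : 'rV[R]_K := \row_i q`_i.
have cV : c = (\row_i q.[i%:R / K%:R]) *m invmx V.
  rewrite -[LHS](mulmxK uV); congr (_ *m _); apply/rowP => j; rewrite !mxE.
  rewrite (horner_coef_wide _ qK); apply: eq_bigr => i _; by rewrite !mxE.
have -> : q`_k = c 0 (Ordinal kK) by rewrite mxE.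
rewrite cV mxE (le_trans (ler_norm_sum _ _ _))//.
apply: (@le_trans _ _ (\sum_(i < K) `|invmx V i (Ordinal kK)| * M)).
  apply: ler_sum => i _; rewrite normrM mulrC ler_wpM2l// mxE; apply: qM.
  rewrite divr_ge0//= ler_pdivrMr ?mul1r ?ler_nat ?ltr0n.
    exact: ltnW.
  exact: leq_ltn_trans kK.
rewrite -mulr_suml ler_wpM2r// /C [X in 1 + X](bigD1 (Ordinal kK))//= addrCA.
by rewrite lerDl addr_ge0// sumr_ge0// => j _; apply: sumr_ge0.
Qed.

(* A polynomial bounded by M on [0, T] is a bounded polynomial of t / T, hence
   its n-th difference with step 1 is of order M / T ^ n. *)
Lemma fdiff_poly_le (K n : nat) : exists2 C : R, 0 < C &
  forall q, (size q <= K)%N -> forall T M, 1 <= T ->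
    (forall x, 0 <= x <= T -> `|q.[x]| <= M) ->
  `|fdiff n (horner q) 0| <= C * (M / T ^+ n).
Proof.
have [C0 C00 HC] := coef_bound K.
pose S := 1 + \sum_(i < K) `|fdiff n (fun x : R => x ^+ i) 0|.
have S1 : 1 <= S by rewrite lerDl sumr_ge0.
exists (C0 * S); first by rewrite mulr_gt0// (lt_le_trans _ S1).
move=> q qK T M T1 qM.
have T0 : 0 < T by rewrite (lt_le_trans _ T1).
have M0 : 0 <= M by rewrite (le_trans _ (qM 0 _))// lexx ltW.
have Hk k : `|q`_k| * T ^+ k <= C0 * M.
  pose q' := \poly_(i < size q) (q`_i * T ^+ i).
  have sq' : (size q' <= K)%N by rewrite (leq_trans (size_poly _ _)).
  have := HC q' sq' M _ k; rewrite coef_poly; case: ltnP => [_|qk _].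
    rewrite normrM [X in _ * X]ger0_norm ?exprn_ge0 ?(ltW T0)//; apply.
    move=> x /andP[x0 x1]; rewrite horner_poly.
    have -> : \sum_(i < size q) q`_i * T ^+ i * x ^+ i = q.[T * x].
      rewrite horner_coef; apply: eq_bigr => i _.
      by rewrite exprMn mulrA.
    by apply: qM; rewrite mulr_ge0 ?(ltW T0)//= ler_piMr// ltW.
  by rewrite nth_default// normr0 mul0r mulr_ge0// ltW.
rewrite fdiff_poly (le_trans (ler_norm_sum _ _ _))//.
apply: (@le_trans _ _ (\sum_(i < K)
    C0 * (M / T ^+ n) * `|fdiff n (fun x : R => x ^+ i) 0|)); last first.
  rewrite -mulr_sumr mulrAC ler_wpM2r ?divr_ge0 ?exprn_ge0 ?(ltW T0)//.
  by rewrite ler_wpM2l ?(ltW C00)// lerDr.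
rewrite (big_ord_widen K (fun i => `|q`_i * fdiff n (fun x => x ^+ i) 0|))//.
rewrite big_mkcond/=; apply: ler_sum => i _; case: ifP => [_|_]; last first.
  by rewrite mulr_ge0// mulr_ge0 ?(ltW C00)// divr_ge0// exprn_ge0// ltW.
(* Degrees below n are killed; for i >= n the coefficient gains T ^ -i, which is at most T ^ -n. *)
rewrite normrM; have [ni|/fdiff_expr->] := leqP n i; last by rewrite normr0 !mulr0.
rewrite ler_wpM2r// mulrA ler_pdivlMr ?exprn_gt0//.
by rewrite (le_trans _ (Hk i))// ler_wpM2l// ler_weXn2l.
Qed.

End finite_differences.

Section polynomial_on_line.
Context (R : realType) (d : nat).

(** Differences with step u see P only along a line, where its degree is at most the total
    degree. *)
Lemma peval_line (P : mpoly.mpoly d R) (y u : 'rV[R]_d) : exists2 q : {poly R},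
  (size q <= mpoly.msize P)%N & forall t, q.[t] = peval P (y + t *: u).
Proof.
exists (\sum_(m <- mpoly.msupp P) (mpoly.mcoeff m P) *:
    \prod_i ((y 0 i)%:P + (u 0 i) *: 'X) ^+ (m i)).
  apply: (leq_trans (size_sum _ _ _)); apply/bigmax_leqP_seq => m mP _.
  apply: (leq_trans (size_scale_leq _ _)).
  apply: leq_trans (mpoly.msize_mdeg_lt mP).
  rewrite mpoly.mdegE.
  elim/big_ind2 : _ => [|p1 n1 p2 n2 s1 s2|i _].
  - by rewrite size_poly1.
  - apply: (leq_trans (size_polyMleq _ _)); lia.
  - apply: (leq_trans (size_poly_exp_leq _ _)).
    have : (size ((y 0 i)%:P + u 0 i *: 'X)%R <= 2)%N.
      rewrite (leq_trans (size_polyD _ _))// geq_max.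
      rewrite (leq_trans (size_polyC_leq1 _))//.
      by rewrite (leq_trans (size_scale_leq _ _))// size_polyX.
    set s := size _; nia.
move=> t; rewrite /peval mpoly.mevalE horner_sum; apply: eq_bigr => m _.
rewrite hornerZ horner_prod; congr (_ * _); apply: eq_bigr => i _.
by rewrite horner_exp hornerD hornerC hornerZ hornerX !mxE [t * _]mulrC.
Qed.

Lemma continuous_sumr (T : topologicalType) (I : Type) (r : seq I) (F : I -> T -> R) :
  (forall i, continuous (F i)) -> continuous (fun y => \sum_(i <- r) F i y).
Proof.
move=> cF; elim: r => [|i r IH] x.
  by under eq_fun do rewrite big_nil; exact: cst_continuous.
by under eq_fun do rewrite big_cons; apply: continuousD; [exact: cF|exact: IH].
Qed.

Lemma continuous_prodr (T : topologicalType) (I : Type) (r : seq I) (F : I -> T -> R) :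
  (forall i, continuous (F i)) -> continuous (fun y => \prod_(i <- r) F i y).
Proof.
move=> cF; elim: r => [|i r IH] x.
  by under eq_fun do rewrite big_nil; exact: cst_continuous.
by under eq_fun do rewrite big_cons; apply: continuousM; [exact: cF|exact: IH].
Qed.

Lemma peval_continuous (P : mpoly.mpoly d R) : continuous (peval P).
Proof.
have -> : peval P = (fun x : 'rV[R]_d => \sum_(m <- mpoly.msupp P)
     (mpoly.mcoeff m P) * \prod_i (x 0 i) ^+ m i).
  by apply/funext => y; rewrite /peval mpoly.mevalE.
apply: continuous_sumr => m x; apply: continuousM; first exact: cst_continuous.
apply: continuous_prodr => i {}x.
apply: (@continuous_comp _ _ _ (fun x : 'rV[R]_d => x 0 i) (fun y => y ^+ m i)).
  exact: coord_continuous.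
exact: exprn_continuous.
Qed.

End polynomial_on_line.

(** * Powers of two with real exponents *)

Section powers_of_two.
Context (R : realType).
Implicit Types x y a : R.

(** All sizes are written as powers of 2, so that through [ler_e2] comparisons become linear
    arithmetic on exponents. *)
Definition e2 x : R := 2 `^ x.

Lemma e2_gt0 x : 0 < e2 x. Proof. by rewrite powR_gt0. Qed.

Lemma e2_ge0 x : 0 <= e2 x. Proof. exact: ltW (e2_gt0 x). Qed.

Lemma e2D x y : e2 (x + y) = e2 x * e2 y.
Proof. by rewrite /e2 powRD// pnatr_eq0 implybT. Qed.

Lemma e2_0 : e2 0 = 1. Proof. exact: powRr0. Qed.

Lemma e2N x : e2 (- x) = (e2 x)^-1. Proof. exact: powRN. Qed.

Lemma e2B x y : e2 (x - y) = e2 x / e2 y. Proof. by rewrite e2D e2N. Qed.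

Lemma e2_nat n : e2 n%:R = 2 ^+ n. Proof. exact: powR_mulrn. Qed.

Lemma e2M x y : e2 (x * y) = e2 x `^ y. Proof. exact: powRrM. Qed.

Lemma e2_exp x n : e2 x ^+ n = e2 (x * n%:R).
Proof. by rewrite e2M powR_mulrn ?e2_ge0. Qed.

Lemma ler_e2 x y : (e2 x <= e2 y) = (x <= y).
Proof.
by rewrite /e2 /powR pnatr_eq0/= ler_expR ler_pM2r// ln_gt0// ltr1n.
Qed.

Lemma ltr_e2 x y : (e2 x < e2 y) = (x < y).
Proof. by rewrite !ltNge ler_e2. Qed.

Lemma e2_ge1 x : (1 <= e2 x) = (0 <= x). Proof. by rewrite -e2_0 ler_e2. Qed.

Lemma e2_gt1 x : (1 < e2 x) = (0 < x). Proof. by rewrite -e2_0 ltr_e2. Qed.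

Lemma e2_le1 x : (e2 x <= 1) = (x <= 0). Proof. by rewrite -e2_0 ler_e2. Qed.

Lemma e2_lt1 x : (e2 x < 1) = (x < 0). Proof. by rewrite -e2_0 ltr_e2. Qed.

Lemma e2_log x : 0 < x -> exists a, x = e2 a.
Proof.
move=> x0; exists (ln x / ln 2).
rewrite /e2 /powR pnatr_eq0/= mulfVK ?lnK//.
by rewrite gt_eqF// ln_gt0// ltr1n.
Qed.

Lemma geometric_sum_le a i0 n : 0 < a ->
  \sum_(i0 <= i < n) e2 (- a * i%:R) <= (1 - e2 (- a))^-1 * e2 (- a * i0%:R).
Proof.
move=> a0; have q1 : 0 < 1 - e2 (- a) by rewrite subr_gt0 e2_lt1 oppr_lt0.
have [ni|i0n] := leqP n i0.
  by rewrite big_geq// mulr_ge0 ?e2_ge0// invr_ge0 ltW.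
rewrite -{1}[i0]add0n big_addn; move: (n - i0)%N => {i0n}n.
rewrite (eq_bigr (fun i => e2 (- a) ^+ i * e2 (- a * i0%:R))); last first.
  by move=> i _; rewrite e2_exp -e2D natrD mulrDr.
rewrite -mulr_suml ler_wpM2r ?e2_ge0// -[leRHS]mul1r ler_pdivlMr//.
rewrite mulrC big_mkord.
have := subrX1 (e2 (- a)) n; have := exprn_ge0 n (e2_ge0 (- a)).
set X := e2 _ ^+ n; set S := \sum_(i < n) _; lra.
Qed.

(** Bernoulli's inequality for (2 ^ a) ^ n. This is how polynomial factors are absorbed into
    exponentials. *)
Lemma succn_le_e2 a : 0 < a -> exists2 C : R, 0 < C &
  forall n : nat, n.+1%:R <= C * e2 (a * n%:R).
Proof.
move=> a0; have b0 : 0 < e2 a - 1 by rewrite subr_gt0 e2_gt1.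
exists (1 + (e2 a - 1)^-1); first by rewrite addr_gt0 ?invr_gt0.
move=> n; have H : 1 + n%:R * (e2 a - 1) <= e2 (a * n%:R).
  rewrite -e2_exp; elim: n => [|n IH]; first by rewrite mul0r addr0 expr0.
  rewrite exprS; have : 0 <= e2 a * (e2 a ^+ n - (1 + n%:R * (e2 a - 1))).
    by rewrite mulr_ge0 ?e2_ge0// subr_ge0.
  have : 0 <= n%:R * (e2 a - 1) ^+ 2 by rewrite mulr_ge0 ?sqr_ge0.
  rewrite -natr1; move: (e2 a ^+ n) (e2 a) (n%:R : R) => E q m; lra.
rewrite (le_trans _ (ler_wpM2l _ H)) ?addr_ge0 ?invr_ge0 ?(ltW b0)//.
have cb : (e2 a - 1)^-1 * (e2 a - 1) = 1 by rewrite mulVf ?gt_eqF.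
have c0 : 0 < (e2 a - 1)^-1 by rewrite invr_gt0.
have nb : 0 <= n%:R * (e2 a - 1) by rewrite mulr_ge0// ltW.
have -> : (1 + (e2 a - 1)^-1) * (1 + n%:R * (e2 a - 1)) =
   1 + n%:R * (e2 a - 1) + (e2 a - 1)^-1 + n%:R * ((e2 a - 1)^-1 * (e2 a - 1)).
  by ring.
by rewrite cb -natr1; lra.
Qed.

End powers_of_two.

(** * Hausdorff and packing dimensions *)

Section dimension_comparison.
Context (R : realType) (V : normedModType R).
Implicit Types (A E : set V) (t e : R).
Local Open Scope ereal_scope.

Lemma nneseries_le (F : nat -> \bar R) M : (forall n, 0 <= F n) ->
  (forall n, \sum_(0 <= k < n) F k <= M) -> \sum_(0 <= k <oo) F k <= M.
Proof.
move=> F0 FM; apply: lime_le; first by apply: is_cvg_nneseries => n _ _.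
by apply: nearW => n.
Qed.

Lemma nneseries_ge_term (F : nat -> \bar R) n : (forall n, 0 <= F n) ->
  F n <= \sum_(0 <= k <oo) F k.
Proof.
move=> F0; apply: le_trans (nneseries_lim_ge n.+1 _) => //.
by rewrite big_nat_recr//= leeDr// sume_ge0.
Qed.

Lemma diam_pow_ge0 t A : 0 <= diam_pow t A.
Proof. by rewrite /diam_pow; case: ifP => // _; exact: poweR_ge0. Qed.

Lemma diam_ge0 A : A !=set0 -> 0 <= diam A.
Proof.
move=> [x Ax]; apply: ereal_sup_ubound => /=.
by exists (x, x) => //=; rewrite subrr normr0.
Qed.

Lemma diam_le A e : (forall x y, A x -> A y -> `|x - y| <= e)%R ->
  diam A <= e%:E.
Proof.
move=> Ae; apply: ge_ereal_sup => _ [[x y] [/= Ax Ay] <-].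
by rewrite lee_fin Ae.
Qed.

Lemma diam_ge A x y : A x -> A y -> `|x - y|%:E <= diam A.
Proof. by move=> Ax Ay; apply: ereal_sup_ubound; exists (x, y). Qed.

Lemma diam_pow_le t A e : (0 <= t)%R -> (0 <= e)%R ->
  diam A <= e%:E -> diam_pow t A <= (e `^ t)%:E.
Proof.
move=> t0 e0 Ae; rewrite /diam_pow; case: ifPn => [_|/set0P A0].
  by rewrite lee_fin powR_ge0.
rewrite -poweR_EFin; apply: gt0_ler_poweR => //.
- by rewrite in_itv/= leey diam_ge0.
- by rewrite in_itv/= leey lee_fin e0.
Qed.

(** The covers of the pieces are merged into one sequence through a bijection between [nat] and
    [nat * nat]. *)
Lemma hausdorff_premeasure_sigma e t E (A : nat -> set V) (b : nat -> \bar R) :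
  E `<=` \bigcup_n A n ->
  (forall n, exists U : nat -> set V, [/\ A n `<=` \bigcup_k U k,
     forall k, diam (U k) <= e%:E & \sum_(0 <= k <oo) diam_pow t (U k) <= b n]) ->
  hausdorff_premeasure e t E <= \sum_(0 <= n <oo) b n.
Proof.
move=> EA /choice[U HU].
have /card_esym/ppcard_eqP[f] := card_nat2.
apply: (@le_trans _ _ (\sum_(0 <= n <oo) \sum_(0 <= k <oo) diam_pow t (U n k))).
  apply: ereal_inf_lbound; exists (fun k => U (f k).1 (f k).2); first split.
  - move=> x /EA [n _ Anx]; have [AU _ _] := HU n.
    have [k _ Ux] := AU _ Anx.
    exists ((f^-1)%FUN (n, k)) => //.
    by rewrite invK ?inE.
  - by move=> k; have [_ + _] := HU (f k).1; exact.
  - rewrite nneseries_esumT; last by move=> n; exact: diam_pow_ge0.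
    rewrite -(@reindex_esum _ _ _ setT setT f (fun k => diam_pow t (U k.1 k.2))).
      rewrite (_ : [set: nat * nat] = [set: nat] `*`` (fun=> setT)); last first.
        by apply/seteqP; split.
      rewrite -(@esum_esum _ _ _ setT (fun=> setT) (fun i j => diam_pow t (U i j))).
        rewrite nneseries_esumT.
          by apply: eq_esum => i _; rewrite nneseries_esumT// => n; exact: diam_pow_ge0.
        by move=> n; apply: nneseries_ge0 => k _ _; exact: diam_pow_ge0.
      by move=> *; exact: diam_pow_ge0.
    exact: 'bij_f.
apply: lee_nneseries => n; first by move=> _ _; apply: nneseries_ge0 => k _ _; exact: diam_pow_ge0.
by move=> _; have [] := HU n.
Qed.

Definition finite_packing e A (s : seq V) :=
  (forall x, x \in s -> A x) /\
  pairwise (fun x y => `[< closed_ball x e `&` closed_ball y e = set0 >]) s.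

Lemma finite_packing_sums e d t A s : (0 < d <= e)%R -> finite_packing d A s ->
  packing_sums e t A ((size s)%:R * (2 * d) `^ t)%:E.
Proof.
move=> de [sA sp]; pose x0 : V := 0%R.
exists (`I_(size s)), (nth x0 s), (fun=> d); split.
- by move=> n /= ns; split => //; apply/sA/mem_nth.
- apply/trivIsetP => i j /= si sj ij.
  have H a b : (a < size s)%N -> (b < size s)%N -> (a < b)%N ->
     closed_ball (nth x0 s a) d `&` closed_ball (nth x0 s b) d = set0.
    by move=> sa sb ab; apply/asboolP; move/(pairwiseP x0): sp; apply.
  have [|ji] := ltnP i j; first exact: H.
  by rewrite setIC; apply: H => //; rewrite ltn_neqAle eq_sym ij.
- rewrite esum_fset//; last by move=> i _; rewrite lee_fin powR_ge0.
  rewrite -fsbig_ord sumEFin sumr_const card_ord.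
  by rewrite mulr_natl.
Qed.

Lemma closed_ball_diam (x : V) r : (0 < r)%R -> diam (closed_ball x r) <= (2 * r)%:E.
Proof.
move=> r0; apply: diam_le => y z; rewrite closed_ballE// /closed_ball_/= => xy xz.
rewrite (_ : y - z = (x - z) - (x - y))%R; last by rewrite opprB [RHS]addrC addrA subrK.
by rewrite (le_trans (ler_normB _ _))//; lra.
Qed.

(** To a packing by balls of radius d of maximal cardinality no ball can be added, so the concentric
    balls of radius 2 d cover A. The factor 2 ^ t is the price of doubling the radius. *)
Lemma packing_cover d t A M : (0 < d)%R -> (0 <= t)%R ->
  (forall s, finite_packing d A s -> ((size s)%:R * (2 * d) `^ t <= M)%R) ->
  exists U : nat -> set V, [/\ A `<=` \bigcup_k U k,
     forall k, diam (U k) <= (4 * d)%:E &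
     \sum_(0 <= k <oo) diam_pow t (U k) <= (2 `^ t * M)%:E].
Proof.
move=> d0 t0 HM.
have dt0 : (0 < (2 * d) `^ t)%R by rewrite powR_gt0// mulr_gt0.
pose P k := `[< exists2 s, finite_packing d A s & size s = k >].
have [k0 k0P] : exists k, P k.
  by exists 0%N; apply/asboolP; exists [::] => //; split.
have Pub k : P k -> (k <= Num.truncn (M / (2 * d) `^ t))%N.
  move=> /asboolP[s sA <-]; rewrite -ltnS -(ltr_nat R).
  apply: le_lt_trans (truncnS_gt _).
  by rewrite ler_pdivlMr//; exact: HM.
have exP : exists k, P k by exists k0.
have [K /asboolP[s sA sK] Kmax] := ex_maxnP exP Pub.
pose x0 : V := 0%R.
pose U k := if (k < K)%N then closed_ball (nth x0 s k) (2 * d)%R else set0.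
have dU k : diam (U k) <= (4 * d)%:E.
  rewrite /U; case: ifP => _.
    rewrite (_ : (4 * d = 2 * (2 * d))%R); last by lra.
    by apply: closed_ball_diam; rewrite mulr_gt0.
  apply: diam_le => x y; by case.
exists U; split => //.
- move=> x Ax; have : ~ finite_packing d A (x :: s).
    move=> xs; have /Kmax : P K.+1 by apply/asboolP; exists (x :: s); rewrite //= sK.
    by rewrite ltnn.
  move=> nxs; have [y ys yx] : exists2 y, y \in s &
      closed_ball x d `&` closed_ball y d !=set0.
    apply: contrapT => H; apply: nxs; have [sA1 sA2] := sA; split.
      by move=> y; rewrite inE => /orP[/eqP->//|]; exact: sA1.
    rewrite /= sA2 andbT; apply/allP => y ys; apply/asboolP.
    apply/eqP/negPn/negP => /set0P xy0; apply: H; exists y => //.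
  exists (index y s); first by [].
  rewrite /U -sK index_mem ys nth_index//.
  case: yx => z []; rewrite !closed_ballE ?mulr_gt0// /closed_ball_/= => xz yz.
  rewrite (_ : y - x = (y - z) - (x - z))%R; last by rewrite opprB addrA subrK.
  by rewrite (le_trans (ler_normB _ _))//; lra.
- apply: nneseries_le => [k|n]; first exact: diam_pow_ge0.
  apply: (@le_trans _ _ (\sum_(0 <= k < n) (if (k < K)%N then ((4 * d) `^ t)%:E else 0))).
    apply: lee_sum => k _; case: ifP => kK.
      by apply: diam_pow_le => //; lra.
    by rewrite /U kK /diam_pow eqxx.
  have -> : \sum_(0 <= k < n) (if (k < K)%N then ((4 * d) `^ t)%:E else 0) =
      ((minn n K)%:R * (4 * d) `^ t)%:E.
    move: ((4 * d) `^ t)%R => c.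
    elim: n => [|n IH]; first by rewrite big_geq// min0n mul0r.
    rewrite big_nat_recr//= IH; case: ltnP => nK.
      by rewrite -EFinD (minn_idPl nK) -[n.+1%:R]natr1 mulrDl mul1r.
    by rewrite addr0 (minn_idPr (leqW nK)).
  rewrite (_ : (4 * d = 2 * (2 * d))%R); last by lra.
  rewrite lee_fin powRM//; last by lra.
  rewrite mulrCA ler_wpM2l ?powR_ge0// (le_trans _ (HM _ sA))// sK.
  by rewrite ler_wpM2r ?powR_ge0// ler_nat geq_minr.
Qed.

Lemma packing_premeasure_ge0 t A : 0 <= packing_premeasure t A.
Proof.
apply: le_ereal_inf_tmp => _ [e /= e0 <-]; apply: ereal_sup_ubound.
exists set0, (fun=> 0%R), (fun=> 0%R); split => //.
by rewrite esum_set0.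
Qed.

Lemma hausdorff_premeasure_ge0 e t E : 0 <= hausdorff_premeasure e t E.
Proof.
apply: le_ereal_inf_tmp => _ [U _ <-]; apply: nneseries_ge0 => n _ _.
exact: diam_pow_ge0.
Qed.

(** Each piece of an almost optimal decomposition for the packing measure is covered by doubling the
    balls of a maximal packing of a single small radius. *)
Lemma hausdorff_measure_eq0 t E : (0 <= t)%R ->
  packing_measure t E = 0 -> hausdorff_measure t E = 0.
Proof.
move=> t0 PE; apply/eqP; rewrite eq_le; apply/andP; split; last first.
  apply: (@le_trans _ _ (hausdorff_premeasure 1%R t E)).
    exact: hausdorff_premeasure_ge0.
  by apply: ereal_sup_ubound; exists 1%R => //=; exact: ltr01.
apply: ge_ereal_sup => _ [e /= e0 <-]; apply/lee_addgt0Pr => z z0; rewrite add0e.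
have p2 : (0 < 2 `^ t :> R)%R by rewrite powR_gt0.
(* Here 2 ^ t is the loss in [packing_cover], and the other factor 2 pays for the errors z' / 2 ^ (n
   + 1) allowed for the pieces. *)
pose z' := (z / (2 * 2 `^ t))%R.
have z'0 : (0 < z')%R by rewrite divr_gt0// mulr_gt0.
have [_ [A EA <-] Az] : exists2 y, [set \sum_(0 <= n <oo) packing_premeasure t (A n)
            | A in [set A : nat -> set V | E `<=` \bigcup_n A n]] y & y < z'%:E.
  by apply: ereal_inf_lt; rewrite -/(packing_measure t E) PE lte_fin.
pose b n := (2 `^ t)%:E * (packing_premeasure t (A n) + (z' / (2 ^ n.+1)%:R)%:E).
apply: (@le_trans _ _ (\sum_(0 <= n <oo) b n)).
  apply: (hausdorff_premeasure_sigma EA) => n.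
  have pfin : packing_premeasure t (A n) \is a fin_num.
    rewrite ge0_fin_numE ?packing_premeasure_ge0//.
    apply: le_lt_trans (lt_trans Az (ltry _)).
    apply: (@nneseries_ge_term (fun k => packing_premeasure t (A k))) => k.
    exact: packing_premeasure_ge0.
  have zn : (0 < z' / (2 ^ n.+1)%:R)%R by rewrite divr_gt0// ltr0n expn_gt0.
  have [_ [d /= d0 <-] dlt] := lb_ereal_inf_adherent zn pfin.
  (* The covering sets have diameter up to 4 d', whence e / 4. *)
  pose d' := Num.min d (e / 4)%R.
  have d'0 : (0 < d')%R by rewrite lt_min d0 divr_gt0.
  pose M : R := (fine (packing_premeasure t (A n)) + (z' / (2 ^ n.+1)%:R))%R.
  have [s sA|U [AU dU sU]] := packing_cover d'0 t0 (M := M) (A := A n).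
    rewrite -lee_fin EFinD fineK//; apply: le_trans (ltW dlt).
    apply: ereal_sup_ubound; apply: finite_packing_sums => //.
    by rewrite d'0 ge_min lexx.
  exists U; split => //.
    move=> k; apply: (le_trans (dU k)); rewrite lee_fin.
    have : (d' <= e / 4)%R by rewrite ge_min lexx orbT.
    lra.
  by apply: (le_trans sU); rewrite EFinM EFinD fineK.
rewrite nneseriesZl; last first.
  move=> n _; rewrite adde_ge0 ?packing_premeasure_ge0//.
  by rewrite lee_fin divr_ge0 ?ler0n ?ltW.
apply: (@le_trans _ _ ((2 `^ t)%:E * (z'%:E + z'%:E))).
  rewrite lee_pmul2l//.
  apply: le_trans (epsilon_trick _ _ (ltW z'0)) _.
    by move=> n; exact: packing_premeasure_ge0.
  by rewrite leeD2r// ltW.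
by rewrite -EFinD -EFinM lee_fin /z' le_eqVlt; apply/orP; left; apply/eqP; field; rewrite gt_eqF.
Qed.

Lemma hausdorff_dim_le_packing_dim E : hausdorff_dim E <= packing_dim E.
Proof.
apply: ereal_inf_le_tmp => _ [t [/= t0 PE] <-]; exists t => //; split => //.
exact: hausdorff_measure_eq0.
Qed.

End dimension_comparison.

(** * Packing dimension from the number of separated points *)

Section packing_dimension_upper_bound.
Context (R : realType).

Lemma e2_small (a z : R) : 0 < a -> 0 < z ->
  exists n0, forall n, (n0 <= n)%N -> e2 (- a * n%:R) <= z.
Proof.
move=> a0 /e2_log[x ->]; exists (Num.truncn (`|x| / a)).+1 => n n0n.
have n0n' : (Num.truncn (`|x| / a)).+1%:R <= n%:R :> R by rewrite ler_nat.
rewrite ler_e2.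
have := lt_le_trans (truncnS_gt (`|x| / a)) n0n'.
rewrite ltr_pdivrMr// => H; have := ler_norm (- x); rewrite normrN; nra.
Qed.

Lemma dyadic_bracket (r : R) (i0 : nat) : 0 < r <= e2 (- i0%:R) ->
  exists i, [/\ (i0 <= i)%N, e2 (- i.+1%:R) < r & r <= e2 (- i%:R)].
Proof.
move=> /andP[/e2_log[x ->]]; rewrite ler_e2 => xi0.
have x0 : 0 <= - x by rewrite (le_trans (ler0n _ i0))// lerNr.
exists (Num.truncn (- x)); rewrite ltr_e2 ler_e2; split.
- by rewrite truncn_ge_nat// lerNr.
- by rewrite ltrNl; exact: truncnS_gt.
- by rewrite lerNr; case/andP: (truncn_itv x0).
Qed.

Context (V : normedModType R).

Definition separated (e : R) (s : seq V) := pairwise (fun x y => e <= `|x - y|) s.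

(** The balls of a packing are sorted by dyadic size. Centres of disjoint balls of radius more than
    2 ^ -(i + 1) are 2 ^ -(i + 1)-separated, so there are at most C 2 ^ (t0 (i + 1)) of them, and
    their contributions form a geometric series because t0 < t. *)
Lemma packing_premeasure_eq0 (F : set V) (t0 t C : R) (j0 : nat) :
  0 <= t -> t0 < t -> 0 < C ->
  (forall j s, (j0 <= j)%N -> (forall x, x \in s -> F x) ->
    separated (e2 (- j%:R)) s -> (size s)%:R <= C * e2 (t0 * j%:R)) ->
  packing_premeasure t F = 0%E.
Proof.
move=> t_ge0 t0t C0 HF; apply/eqP; rewrite eq_le packing_premeasure_ge0 andbT.
apply/lee_addgt0Pr => z z0; rewrite add0e.
pose a := t - t0; have a0 : 0 < a by rewrite subr_gt0.
pose G := (1 - e2 (- a))^-1.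
have G0 : 0 < G by rewrite invr_gt0 subr_gt0 e2_lt1 oppr_lt0.
(* 2 ^ t0 comes from counting at scale i + 1 instead of i, 2 ^ t from the diameter 2 r, G from the
   geometric series. *)
pose C' := C * e2 (t0 + t) * G.
have C'0 : 0 < C' by rewrite !mulr_gt0 ?e2_gt0.
have [n0 Hn0] := e2_small a0 (divr_gt0 z0 C'0).
pose i0 := maxn j0 n0.
apply: (@le_trans _ _ (ereal_sup (packing_sums (e2 (- i0%:R)) t F))).
  by apply: ereal_inf_lbound; exists (e2 (- i0%:R)) => //=; exact: e2_gt0.
apply: ge_ereal_sup => _ [I [x [r [Ir triv ->]]]].
apply: ge_ereal_sup => _ [X [Xfin XI] <-].
rewrite fsbig_finite//= sumEFin lee_fin.
have HX n : n \in enum_fset (fset_set X) -> I n.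
  by move=> nX; have : n \in fset_set X by []; rewrite in_fset_set// => /set_mem/XI.
have uX : uniq (enum_fset (fset_set X)) by exact: fset_uniq.
move: (enum_fset (fset_set X)) HX uX => s HX us {X Xfin XI}.
have /choice[lev Hlev] : forall n, exists i, I n ->
    [/\ (i0 <= i)%N, e2 (- i.+1%:R) < r n & r n <= e2 (- i%:R)].
  move=> n.
  have [In|nIn] := pselect (I n); last by exists 0%N.
  by have [i Hi] := dyadic_bracket (Ir n In).2; exists i.
pose B := (\max_(n <- s) lev n).+1.
have card_lev i : (i0 <= i)%N -> (count (fun n => lev n == i) s)%:R <= C * e2 (t0 * i.+1%:R).
  move=> i0i; rewrite -size_filter -(size_map x); apply: HF.
  - by rewrite leqW// (leq_trans _ i0i)// leq_maxl.
  - move=> y /mapP[n]; rewrite mem_filter => /andP[_ ns] ->.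
    by have [] := Ir n (HX n ns).
  - rewrite /separated pairwise_map.
    apply: (@sub_in_pairwise _ (fun n => (lev n == i) && (n \in s)) [rel n m | n != m]).
    2: by apply/allP => n; rewrite mem_filter.
    2: by rewrite -uniq_pairwise; exact: filter_uniq.
    move=> n m /andP[/eqP ni ns] /andP[/eqP mi ms] nm /=.
      have [_ rn _] := Hlev n (HX n ns); have [_ rm _] := Hlev m (HX m ms).
      rewrite ni in rn; rewrite mi in rm.
      (* Were the two centres closer than this, the centre [x m] would lie in both balls. *)
      rewrite leNgt; apply/negP => xnm.
      have rn0 : 0 < r n by exact: lt_trans (e2_gt0 _) rn.
      have rm0 : 0 < r m by exact: lt_trans (e2_gt0 _) rm.
      have : n = m; last by move/eqP; rewrite (negbTE nm).
      apply: triv; [exact: HX|exact: HX|exists (x m)].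
      split; rewrite closed_ballE// /closed_ball_/= ?subrr ?normr0 ?ltW//.
      exact: lt_trans xnm rn.
have HsB n : n \in s -> (lev n < B)%N.
  by move=> ns; rewrite ltnS; exact: (@leq_bigmax_seq _ s xpredT lev n ns isT).
apply: (@le_trans _ _ (\sum_(i0 <= i < B) C' / G * e2 (- a * i%:R))).
  rewrite (eq_big_seq (fun n => \sum_(i0 <= i < B)
      if lev n == i then (2 * r n) `^ t else 0)); last first.
    move=> n ns; rewrite (bigD1_seq (lev n)) ?iota_uniq//=; last first.
      by rewrite mem_index_iota HsB// andbT; have [] := Hlev n (HX n ns).
    rewrite eqxx big1 ?addr0// => i; rewrite eq_sym; by case: ifP.
  rewrite exchange_big/=; apply: ler_sum_nat => i /andP[i0i _].
  apply: (@le_trans _ _ (\sum_(n <- s) if lev n == i then e2 ((1 - i%:R) * t) else 0)).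
    rewrite big_seq [leRHS]big_seq; apply: ler_sum => n ns; case: ifP => // /eqP ni.
    have [_ rn0 rn] := Hlev n (HX n ns); rewrite ni in rn.
    have rp : 0 < r n by exact: lt_trans (e2_gt0 _) rn0.
    rewrite e2M; apply: ge0_ler_powR => //; rewrite ?nnegrE ?e2_ge0//.
      by rewrite mulr_ge0// ltW.
    by rewrite e2D -[X in X * _](powRr1 (ltW _)) ?ltr0n// ler_wpM2l// e2_ge0.
  rewrite -big_mkcond/= big_const_seq iter_addr_0.
  apply: (@le_trans _ _ (C * e2 (t0 * i.+1%:R) * e2 ((1 - i%:R) * t))).
    by rewrite -[leLHS]mulr_natl ler_wpM2r ?e2_ge0// card_lev.
  rewrite /C' mulfK ?gt_eqF// -!mulrA ler_wpM2l ?(ltW C0)// -!e2D ler_e2 /a.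
  by rewrite -natr1; lra.
rewrite -mulr_sumr (le_trans (ler_wpM2l _ (geometric_sum_le _ _ a0)))//.
  by rewrite divr_ge0// ltW.
rewrite -/G mulrA divfK ?gt_eqF//.
by rewrite mulrC -ler_pdivlMr//; apply: Hn0; rewrite leq_maxr.
Qed.

Lemma packing_dim_le (E : set V) (F : nat -> set V) (t : R) : 0 <= t ->
  E `<=` \bigcup_m F m -> (forall m, packing_premeasure t (F m) = 0%E) ->
  (packing_dim E <= t%:E)%E.
Proof.
move=> t0 EF F0; apply: ereal_inf_lbound; exists t => //; split => //.
apply/eqP; rewrite eq_le; apply/andP; split.
  by apply: ereal_inf_lbound; exists F => //; apply: eseries0 => n _ _.
apply: le_ereal_inf_tmp => _ [A _ <-]; apply: nneseries_ge0 => n _ _.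
exact: packing_premeasure_ge0.
Qed.

End packing_dimension_upper_bound.

(** * Wavelets and their coefficients *)

Section separated_sets.
Context (R : realType) (d : nat).

(** Pigeonhole: two points in the same cell of a grid of mesh e are closer than e in the maximum
    norm. *)
Lemma size_separated_le (z : 'rV[R]_d) (e r : R) (s : seq 'rV[R]_d) :
  0 < e -> separated e s -> (forall x, x \in s -> `|x - z| <= r) ->
  (size s <= (Num.truncn (2 * r / e)).+1 ^ d)%N.
Proof.
move=> e0 ss sr; pose M := Num.truncn (2 * r / e).
pose cell (x : 'rV[R]_d) i := Num.truncn ((x 0 i - z 0 i + r) / e).
pose f x : {ffun 'I_d -> 'I_M.+1} := [ffun i => inord (cell x i)].
have cell_itv x i : x \in s -> 0 <= (x 0 i - z 0 i + r) / e <= 2 * r / e.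
  move=> /sr xr; have := le_trans (rV_norm_ge (x - z) i) xr.
  rewrite !mxE ler_norml => /andP[H1 H2].
  by rewrite divr_ge0 ?(ltW e0)//= ?ler_pM2r ?invr_gt0//; lra.
have fneq : pairwise [rel x y | f x != f y] s.
  apply: (@sub_in_pairwise _ (mem s) (fun x y => e <= `|x - y|)) ss; last exact/allP.
  move=> x y xs ys /=; apply: contraTN => /eqP /ffunP fxy; rewrite -ltNge.
  apply: rV_norm_lt => // i; have := fxy i; rewrite !ffunE => /(congr1 val) /=.
  have /andP[x0 x1] := cell_itv x i xs; have /andP[y0 y1] := cell_itv y i ys.
  rewrite !inordK ?ltnS ?le_truncn// /cell => cxy.
  have /andP[] := truncn_itv x0; have /andP[] := truncn_itv y0.
  rewrite cxy; set k := Num.truncn _; rewrite -[k.+1%:R]natr1.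
  rewrite ler_pdivlMr// ler_pdivlMr// ltr_pdivrMr// ltr_pdivrMr//.
  rewrite !mxE ltr_norml; lra.
have : uniq (map f s) by rewrite uniq_pairwise pairwise_map.
move=> /card_uniqP; rewrite size_map => <-.
by rewrite (leq_trans (max_card _))// card_ffun !card_ord.
Qed.

End separated_sets.

(** * Taylor polynomials along segments *)

Section taylor_on_lines.
Context (R : realType) (d : nat).
Implicit Types (f : 'rV[R]_d -> R) (q : {poly R}).

Lemma poly_primitive q : exists Q : {poly R},
  [/\ Q^`() = q, Q.[0] = 0 & (size Q <= (size q).+1)%N].
Proof.
exists (\sum_(k < size q) (q`_k / k.+1%:R) *: 'X^(k.+1)); split.
- rewrite linear_sum -[RHS]coefK poly_def; apply: eq_bigr => k _ /=.
  by rewrite derivZ derivXn /= -scalerMnr scalerMnl -[X in X *: _]mulr_natr divfK.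
- by rewrite horner_sum big1// => k _; rewrite hornerZ hornerXn expr0n mulr0.
- apply: (leq_trans (size_sum _ _ _)); apply/bigmax_leqP => k _.
  by rewrite (leq_trans (size_scale_leq _ _))// size_polyXn ltnS.
Qed.

(** A form of compact support that passes to directional derivatives with the same K. *)
Definition zero_off_compact f := exists2 K, compact K & forall x, ~ K x -> f x = 0.

Lemma zero_off_compact_bounded f : continuous f -> zero_off_compact f ->
  exists2 B : R, 0 < B & forall x, `|f x| <= B.
Proof.
move=> cf [K cK fK].
have /compact_bounded[M [_ HM]] : compact (f @` K).
  by apply: continuous_compact => //; exact: continuous_subspaceT.
exists (`|M| + 1); first by rewrite ltr_wpDl.
move=> x; have [Kx|nKx] := pselect (K x); last by rewrite fK// normr0 addr_ge0.
by apply: HM; [rewrite (le_lt_trans (ler_norm M))// ltrDl|exists x].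
Qed.

Lemma zero_off_compact_derive f v : zero_off_compact f -> zero_off_compact ('D_v f).
Proof.
move=> [K cK fK]; exists K => // x nKx.
have cKo : open (~` K) by rewrite openC; apply: compact_closed cK; exact: norm_hausdorff.
have nK : \forall y \near x, ~ K y by exact: open_nbhs_nbhs.
have -> : 'D_v f x = 'D_v (cst 0 : 'rV[R]_d -> R) x.
  by apply: near_eq_derive; near=> y; apply: fK; near: y.
exact: derive_cst.
Unshelve. all: by end_near. Qed.

Lemma is_derive_line f (w v : 'rV[R]_d) (t : R) : (forall x, differentiable f x) ->
  is_derive t 1 (fun t : R => f (w + t *: v))
    (\sum_i v 0 i * 'D_(delta_mx 0 i) f (w + t *: v)).
Proof.
move=> df.
have -> : \sum_i v 0 i * 'D_(delta_mx 0 i) f (w + t *: v) = 'd f (w + t *: v) v.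
  move: (w + t *: v) => x; rewrite [in RHS](row_sum_delta v) linear_sum.
  apply: eq_bigr => i _.
  by rewrite linearZ/= deriveE.
have E : (fun h : R => h^-1 *: (((fun t : R => f (w + t *: v)) \o shift t) (h *: 1)
     - f (w + t *: v))) =
  (fun h : R => h^-1 *: ((f \o shift (w + t *: v)) (h *: v) - f (w + t *: v))).
  apply/funext => h /=; congr (_ *: (f _ - _)).
  by rewrite [h *: 1]mulr1 scalerDl addrCA.
split; first by rewrite /derivable E; exact: diff_derivable.
by rewrite /derive E -deriveE.
Qed.

(** By induction the partial derivatives are close to polynomials in t on the segment; a primitive
    of their combination serves for f, and the mean value theorem controls the error. A polynomial
    depending on the segment is enough, since differences only see lines. *)
Lemma class_C_taylor n f : class_C n f -> zero_off_compact f ->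
  exists2 B : R, 0 < B & forall w v : 'rV[R]_d, exists2 q : {poly R}, (size q <= n)%N &
    forall t : R, 0 <= t <= 1 -> `|f (w + t *: v) - q.[t]| <= B * `|v| ^+ n.
Proof.
elim: n f => [|n IH] f /= Cf fK.
  have [B B0 fB] := zero_off_compact_bounded Cf fK.
  exists B => // w v; exists 0 => [|t _]; first by rewrite size_poly0.
  by rewrite horner0 subr0 expr0 mulr1.
have [df Cdf] := Cf.
have /choice[B HB] : forall i, exists B : R, 0 < B /\ forall w v : 'rV[R]_d, exists2 q : {poly R}, (size q <= n)%N &
    forall t : R, 0 <= t <= 1 ->
      `|'D_(delta_mx 0 i) f (w + t *: v) - q.[t]| <= B * `|v| ^+ n.
  move=> i; have [B B0 HB] := IH _ (Cdf i) (zero_off_compact_derive _ fK).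
  by exists B.
have B0 i : 0 <= B i by rewrite ltW//; have [] := HB i.
exists (1 + \sum_i B i) => [|w v]; first by rewrite ltr_pwDl// sumr_ge0.
have /choice[q Hq] : forall i, exists q : {poly R}, (size q <= n)%N /\ forall t : R, 0 <= t <= 1 ->
      `|'D_(delta_mx 0 i) f (w + t *: v) - q.[t]| <= B i * `|v| ^+ n.
  by move=> i; have [_ /(_ w v)[q qn Hq]] := HB i; exists q.
have /choice[Q HQ] := poly_primitive.
(* The constant term is f w and the derivative is the chain rule applied to the approximants, so
   that the error vanishes at t = 0. *)
pose P : {poly R} := (f w)%:P + \sum_i v 0 i *: Q (q i).
exists P.
  rewrite (leq_trans (size_polyD _ _))// geq_max (leq_trans (size_polyC_leq1 _))//=.
  apply: (leq_trans (size_sum _ _ _)); apply/bigmax_leqP => i _.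
  rewrite (leq_trans (size_scale_leq _ _))//; have [_ _ /leq_trans] := HQ (q i); apply.
  by rewrite ltnS; have [] := Hq i.
move=> t /andP[t0 t1].
pose e t := f (w + t *: v) - P.[t].
pose de t := \sum_i v 0 i * ('D_(delta_mx 0 i) f (w + t *: v) - (q i).[t]).
have e_de (x : R) : is_derive x 1 e (de x).
  rewrite /de; under eq_bigr do rewrite mulrBr; rewrite sumrB.
  apply: is_deriveB; first exact: is_derive_line.
  have -> : \sum_i v 0 i * (q i).[x] = P^`().[x].
    rewrite derivD derivC add0r linear_sum horner_sum; apply: eq_bigr => i _.
    by rewrite /= derivZ hornerZ; have [-> _ _] := HQ (q i).
  exact: is_derive_poly.
have e0 : e 0 = 0.
  rewrite /e scale0r addr0 hornerD hornerC horner_sum big1 ?addr0 ?subrr// => i _.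
  by rewrite hornerZ; have [_ -> _] := HQ (q i); rewrite mulr0.
have de_le x : 0 <= x <= 1 -> `|de x| <= (1 + \sum_i B i) * `|v| ^+ n.+1.
  move=> x01; rewrite (le_trans (ler_norm_sum _ _ _))//.
  apply: (@le_trans _ _ (\sum_i B i * `|v| ^+ n.+1)).
    apply: ler_sum => i _; rewrite normrM exprS mulrCA.
    by rewrite ler_pM ?rV_norm_ge//; have [_] := Hq i; exact.
  by rewrite -mulr_suml ler_wpM2r ?exprn_ge0// lerDr.
rewrite -/(e t); move: t0; rewrite le_eqVlt => /predU1P[t00|t0].
  by rewrite -t00 e0 normr0 mulr_ge0 ?exprn_ge0// addr_ge0// sumr_ge0.
have ce : {within `[0, t], continuous e}.
  by apply: derivable_within_continuous => y yt; exact: ex_derive.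
have [c] := MVT t0 (fun y _ => e_de y) ce; rewrite in_itv/= => /andP[c0 ct].
rewrite e0 !subr0 => ->; rewrite normrM (ger0_norm (ltW t0)).
rewrite (le_trans (ler_piMr _ t1))// de_le// (ltW c0)/=.
by rewrite (le_trans (ltW ct)).
Qed.

End taylor_on_lines.

Section wavelet_layers.
Context (R : realType) (d : nat).
Local Notation V := ('rV[R]_d).
Implicit Types (c : besov_coefs R d) (p a b : R) (x y z : V).

(** Positions are taken after the rescaling x |-> 2 ^ j x, where they are integer points and hence
    1-separated. *)
Definition pos j (k : 'rV['I_(2 ^ j)]_d) : V :=
  map_mx (fun m : 'I_(2 ^ j) => m%:R) k.

Lemma pos_separated j (k k' : 'rV['I_(2 ^ j)]_d) : k != k' -> 1 <= `|pos k - pos k'|.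
Proof.
move=> kk'; have [i ki] : exists i, k 0 i != k' 0 i.
  apply/existsP; apply: contraNT kk' => /existsPn H; apply/eqP/rowP => i.
  by have := H i => /negPn /eqP.
apply: le_trans (rV_norm_ge _ i); rewrite !mxE.
have : (k 0 i : nat) != k' 0 i by [].
move: (k 0 i : nat) (k' 0 i : nat) => m m'; rewrite neq_ltn => /orP[] H.
  have : m%:R + 1 <= m'%:R :> R by rewrite natr1 ler_nat.
  by rewrite ler_normr => {}H; apply/orP; right; lra.
have : m'%:R + 1 <= m%:R :> R by rewrite natr1 ler_nat.
by rewrite ler_normr => {}H; apply/orP; left; lra.
Qed.

Lemma card_pos j y a :
  (#|[pred k : 'rV['I_(2 ^ j)]_d | (`|pos k - y| <= a)%R]| <= (Num.truncn (2 * a)).+1 ^ d)%N.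
Proof.
set A := [pred k | _].
have := @size_separated_le R d y 1 a (map (@pos j) (enum A)) ltr01.
rewrite size_map -cardE divr1; apply.
  rewrite /separated pairwise_map.
  have := enum_uniq A; rewrite uniq_pairwise.
  by apply: sub_pairwise => k k' /=; exact: pos_separated.
by move=> x /mapP[k]; rewrite mem_enum => kA ->.
Qed.

(** The l^p mass of the coefficients of generation j near y, where y is in the rescaled coordinates
    of that generation. *)
Definition energy p c j y a : R :=
  \sum_(k : 'rV['I_(2 ^ j)]_d | `|pos k - y| <= a) \sum_i `|c j k i| `^ p.

Lemma energy_ge0 p c j y a : 0 <= energy p c j y a.
Proof. by apply: sumr_ge0 => k _; apply: sumr_ge0 => i _; exact: powR_ge0. Qed.

Lemma coef_le_energy p c j y a k i : 1 <= p -> `|pos k - y| <= a ->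
  `|c j k i| <= energy p c j y a `^ p^-1.
Proof.
move=> p1 ky; have p0 : 0 < p by exact: lt_le_trans p1.
have pp : p * p^-1 = 1 by rewrite mulfV// gt_eqF.
rewrite -[leLHS](@powRr1 _ `|c j k i|)// -pp powRrM.
apply: ge0_ler_powR; rewrite ?nnegrE ?powR_ge0 ?energy_ge0 ?invr_ge0 ?(ltW p0)//.
rewrite /energy (bigD1 k)//= (bigD1 i)//= -addrA lerDl addr_ge0//.
  by apply: sumr_ge0 => i' _; exact: powR_ge0.
by apply: sumr_ge0 => k' _; apply: sumr_ge0 => i' _; exact: powR_ge0.
Qed.

(** Common to two situations: w is either a wavelet or its distance to a Taylor polynomial.
    Boundedly many positions contribute, and each coefficient there is at most the p-th root of the
    energy. *)
Lemma weighted_layer_le p c j y a b (w : 'rV['I_(2 ^ j)]_d -> 'I_(2 ^ d).-1 -> R) :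
  1 <= p -> 0 <= b ->
  (forall k i, `|pos k - y| <= a -> `|w k i| <= b) ->
  (forall k i, a < `|pos k - y| -> w k i = 0) ->
  `|\sum_k \sum_(i < (2 ^ d).-1) c j k i * w k i| <=
    ((Num.truncn (2 * a)).+1 ^ d * 2 ^ d)%N%:R * b * energy p c j y a `^ p^-1.
Proof.
move=> p1 b0 wb w0.
rewrite (bigID (fun k => `|pos k - y| <= a))/= [X in _ + X]big1 ?addr0; last first.
  by move=> k; rewrite -ltNge => ky; rewrite big1// => i _; rewrite w0// mulr0.
set E := energy _ _ _ _ _ `^ _; have E0 : 0 <= E by exact: powR_ge0.
rewrite (le_trans (ler_norm_sum _ _ _))//.
apply: (@le_trans _ _ (\sum_(k : 'rV['I_(2 ^ j)]_d | `|pos k - y| <= a) (2 ^ d)%N%:R * (b * E))).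
  apply: ler_sum => k ky; rewrite (le_trans (ler_norm_sum _ _ _))//.
  apply: (@le_trans _ _ (\sum_(i < (2 ^ d).-1) b * E)).
    apply: ler_sum => i _; rewrite normrM mulrC ler_pM//; first exact: wb.
    exact: coef_le_energy.
  rewrite sumr_const card_ord -[leLHS]mulr_natl ler_wpM2r ?mulr_ge0// ler_nat.
  exact: leq_pred.
rewrite sumr_const -[leLHS]mulr_natl mulrA -natrM mulrA ler_wpM2r//.
by rewrite ler_wpM2r// ler_nat leq_mul2r card_pos orbT.
Qed.

End wavelet_layers.

Section distance_sum.
Context (R : realType).

Lemma sum_e2_dist (mu : R) (j0 n : nat) : 0 < mu ->
  \sum_(0 <= j < n) e2 (- mu * `|j%:R - j0%:R|) <= 2 * (1 - e2 (- mu))^-1.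
Proof.
move=> mu0; apply: (@le_trans _ _ (\sum_(0 <= j < j0 + n) e2 (- mu * `|j%:R - j0%:R|))).
  rewrite [leRHS](big_cat_nat (leq0n n) (leq_addl j0 n))/= lerDl.
  by apply: sumr_ge0 => i _; exact: e2_ge0.
rewrite (big_cat_nat (leq0n j0) (leq_addr n j0))/= mulrDl mul1r.
have G m : \sum_(0 <= i < m) e2 (- mu * i%:R) <= (1 - e2 (- mu))^-1.
  by have := geometric_sum_le 0 m mu0; rewrite mulr0 e2_0 mulr1.
apply: lerD.
  rewrite big_nat_rev add0n; apply: le_trans (G j0).
  rewrite big_nat [leRHS]big_nat; apply: ler_sum => i /andP[_ ij].
  rewrite ler_e2 ler_wnM2l ?oppr_le0 ?(ltW mu0)// distrC natrB// subKr.
  by rewrite ger0_norm// ler_nat leqnSn.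
rewrite -{1}[j0]add0n big_addn addKn; apply: le_trans (G n).
by apply: ler_sum => i _; rewrite natrD addrK ger0_norm.
Qed.

End distance_sum.

Section wavelet_series.
Context (R : realType) (d : nat).
Local Notation V := ('rV[R]_d).
Implicit Types (c : besov_coefs R d) (s p : R).

Lemma series_tail_le (u : nat -> R) (l E : R) (j0 : nat) : (u @ \oo --> l) ->
  (forall n, (j0 <= n)%N -> `|u n - u j0| <= E) -> `|l - u j0| <= E.
Proof.
move=> ul uE; apply/ler_addgt0Pr => e e0.
have [n [jn un]] : exists n, (j0 <= n)%N /\ `|l - u n| <= e.
  have [n0 _ Hn0] : \forall n \near \oo, `|l - u n| <= e.
    by move/cvgrPdist_le: ul; exact.
  exists (maxn j0 n0); split; first exact: leq_maxl.
  by apply: Hn0; exact: leq_maxr.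
rewrite -(subrKA (u n)) (le_trans (ler_normD _ _))// addrC lerD//.
exact: uE.
Qed.

(** The embedding of B^s_{p,q} into B^s_{p,oo}. *)
Lemma besov_norm_layer s p q c : 1 <= p -> (1 <= q)%E ->
  (besov_norm s p q c < +oo)%E ->
  exists2 M : R, 0 < M & forall j, besov_layer s p c j <= M.
Proof.
move=> p1 q1 cfin; have p0 : 0 < p by exact: lt_le_trans p1.
have L0 j : 0 <= besov_layer s p c j.
  rewrite mulr_ge0 ?powR_ge0// sumr_ge0// => k _; apply: sumr_ge0 => i _.
  exact: powR_ge0.
have key (a : R) (X : \bar R) : 0 < a -> (X < +oo)%E ->
    (forall j, ((besov_layer s p c j `^ a)%:E <= X)%E) ->
  exists2 M : R, 0 < M & forall j, besov_layer s p c j <= M.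
  move=> a0 Xfin HX.
  have Xf : X \is a fin_num.
    by rewrite ge0_fin_numE// (le_trans _ (HX 0%N))// lee_fin powR_ge0.
  exists (fine X `^ a^-1 + 1) => [|j]; first by rewrite ltr_wpDl// powR_ge0.
  rewrite (@le_trans _ _ (fine X `^ a^-1)) ?lerDl//.
  have aa : a * a^-1 = 1 by rewrite mulfV// gt_eqF.
  rewrite -[leLHS](powRr1 (L0 j)) -aa powRrM.
  have HXj : besov_layer s p c j `^ a <= fine X by rewrite -lee_fin fineK.
  apply: ge0_ler_powR; rewrite ?nnegrE ?powR_ge0 ?invr_ge0 ?(ltW a0)//.
  by rewrite (le_trans _ HXj)// powR_ge0.
case: q q1 cfin => [q| |//] q1 cfin; rewrite /besov_norm in cfin.
- have q0 : 0 < q by apply: lt_le_trans ltr01 _; rewrite -lee_fin.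
  apply: (key (q / p) (\sum_(0 <= j <oo) (besov_layer s p c j `^ (q / p))%:E)%E).
  + by rewrite divr_gt0.
  + by apply: lty_poweRy cfin; rewrite invr_eq0 gt_eqF.
  + move=> j; apply: (@nneseries_ge_term _ (fun j => (besov_layer s p c j `^ (q / p))%:E)) => i.
    by rewrite lee_fin powR_ge0.
- apply: (key p^-1 _ _ cfin); first by rewrite invr_gt0.
  by move=> j; apply: ereal_sup_ubound; exists j.
Qed.

End wavelet_series.

Section wavelet_bounds.
Context (R : realType) (d : nat) (N : nat).
Local Notation V := ('rV[R]_d).
Implicit Types (c : besov_coefs R d) (s p : R).
Implicit Types (phi : V -> R) (psi : 'I_(2 ^ d).-1 -> V -> R).

Definition taylor_bound (B : R) (g : V -> R) := forall w v : V,
  exists2 q : {poly R}, (size q <= N.+1)%N &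
    forall t : R, 0 <= t <= 1 -> `|g (w + t *: v) - q.[t]| <= B * `|v| ^+ N.+1.

(** Quantitative form of the wavelet system: one support radius S for all the [psi i], and one
    constant B for their suprema and for all Taylor remainders. *)
Record wavelet_bounds phi psi (S B : R) : Prop := WaveletBounds {
  wb_S : 1 <= S ;
  wb_B : 0 < B ;
  wb_supp : forall i x, S < `|x| -> psi i x = 0 ;
  wb_sup : forall i x, `|psi i x| <= B ;
  wb_taylor : forall i, taylor_bound B (psi i) ;
  wb_phi : taylor_bound B phi ;
  wb_cpsi : forall i, continuous (psi i) ;
  wb_cphi : continuous phi }.

Lemma class_C_continuous n (f : V -> R) : class_C n f -> continuous f.
Proof.
by case: n => [//|n] [df _] x; apply: differentiable_continuous; exact: df.
Qed.

Lemma compactly_supported_zero_off (f : V -> R) :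
  compactly_supported f -> zero_off_compact f.
Proof.
move=> cf; exists (closure [set x | f x != 0]) => // x nx.
by apply/eqP/negPn/negP => fx; apply: nx; exact: subset_closure.
Qed.

Lemma zero_off_compact_support (f : V -> R) : zero_off_compact f ->
  exists2 S : R, 1 <= S & forall x, S < `|x| -> f x = 0.
Proof.
move=> [K /compact_bounded[M [_ HM]] fK].
have SK x : K x -> `|x| <= `|M| + 1.
  by apply: HM; rewrite (le_lt_trans (ler_norm M))// ltrDl.
exists (`|M| + 1); first by rewrite lerDr.
by move=> x Sx; apply: fK => /SK; rewrite leNgt Sx.
Qed.

Lemma taylor_bound_le (B B' : R) g : B <= B' -> taylor_bound B g -> taylor_bound B' g.
Proof.
move=> BB' Bg w v; have [q sq Hq] := Bg w v; exists q => // t /Hq /le_trans; apply.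
by rewrite ler_wpM2r// exprn_ge0.
Qed.

Lemma wavelet_boundsP phi psi : wavelet_system N phi psi ->
  exists S B : R, wavelet_bounds phi psi S B.
Proof.
move=> W; have cs i := compactly_supported_zero_off (@psi_compact _ _ _ _ _ W i).
have csp := compactly_supported_zero_off (@phi_compact _ _ _ _ _ W).
have cp i := class_C_continuous (psi_smooth W i).
have /choice[S HS] : forall i, exists S : R, 1 <= S /\ forall x, S < `|x| -> psi i x = 0.
  by move=> i; have [S S1 HS] := zero_off_compact_support (cs i); exists S.
have /choice[B HB] : forall i, exists B : R, 0 < B /\ forall x, `|psi i x| <= B.
  by move=> i; have [B B0 HB] := zero_off_compact_bounded (cp i) (cs i); exists B.
have /choice[B' HB'] : forall i, exists B : R, 0 < B /\ taylor_bound B (psi i).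
  by move=> i; have [C C0 HC] := class_C_taylor (psi_smooth W i) (cs i); exists C.
have [C C0 HC] := class_C_taylor (phi_smooth W) csp.
have S0 i : 0 <= S i by rewrite (le_trans ler01)//; have [] := HS i.
have B0 i : 0 <= B i by rewrite ltW//; have [] := HB i.
have B'0 i : 0 <= B' i by rewrite ltW//; have [] := HB' i.
have le_sum F i : (forall j, 0 <= F j) -> F i <= \sum_(i : 'I_(2 ^ d).-1) F i :> R.
  by move=> F0; rewrite (bigD1 i)//= lerDl sumr_ge0.
have sB0 : 0 <= \sum_i B i by rewrite sumr_ge0.
have sB'0 : 0 <= \sum_i B' i by rewrite sumr_ge0.
exists (1 + \sum_i S i), (C + \sum_i B i + \sum_i B' i); split.
- by rewrite lerDl sumr_ge0.
- by rewrite ltr_wpDr// ltr_wpDr.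
- move=> i x Sx; have [_] := HS i; apply; apply: le_lt_trans Sx.
  by rewrite (le_trans (le_sum S i S0))// lerDr.
- move=> i x; have [_ /(_ x) /le_trans] := HB i; apply.
  by rewrite (le_trans (le_sum B i B0))// -addrA addrCA lerDl addr_ge0// ltW.
- move=> i; have [_] := HB' i; apply: taylor_bound_le.
  by rewrite (le_trans (le_sum B' i B'0))// lerDr addr_ge0// ltW.
- by apply: taylor_bound_le HC; rewrite -addrA lerDl addr_ge0.
- exact: cp.
- exact: class_C_continuous (phi_smooth W).
Qed.

End wavelet_bounds.

Lemma leq_expl a b n : (a <= b)%N -> (a ^ n <= b ^ n)%N.
Proof. by move=> ab; elim: n => // n IH; rewrite !expnS leq_mul. Qed.

(** * Polynomial approximation of the wavelet series at one scale *)

Section local_approximation.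
Context (R : realType) (d : nat) (N : nat).
Local Notation V := ('rV[R]_d).
Context (phi : V -> R) (psi : 'I_(2 ^ d).-1 -> V -> R) (S B : R).
Hypothesis W : wavelet_bounds N phi psi S B.
Context (p : R) (p1 : 1 <= p).
Implicit Types (c : besov_coefs R d) (x y v z : V).

(** In units of generation j. Points y + t v with y - x and v of size at most 2 ^ -j0 lie within 2 *
    2 ^ -j0 of x, and a wavelet reaches S further; the maximum with 0 merges the coarse and the fine
    generations. *)
Definition layer_radius (j0 j : nat) : R :=
  (S + 2) * e2 (Num.max (j%:R - j0%:R) 0).

(** The order of a Taylor remainder of degree N + 1 for a wavelet of generation j on a segment of
    length 2 ^ -j0; it is 1 when j >= j0, where no Taylor expansion is used. *)
Definition attenuation (j0 j : nat) : R :=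
  e2 (- N.+1%:R * Num.max (j0%:R - j%:R) 0).

(* The total size of the coefficients of generation j whose wavelets can be seen
   from the ball of radius 2 ^ -j0 around x. *)
Definition local_size c j0 j x : R :=
  energy p c j (2 ^+ j *: x) (layer_radius j0 j) `^ p^-1.

Definition layer_cst : R := ((Num.truncn (2 * (S + 2))).+1 ^ d * 2 ^ d)%N%:R * B.

Let S0 : 0 < S. Proof. by rewrite (lt_le_trans ltr01)// (wb_S W). Qed.

Let p0 : 0 < p. Proof. exact: lt_le_trans p1. Qed.

Lemma layer_cst_ge0 : 0 <= layer_cst.
Proof. by rewrite mulr_ge0// ltW// (wb_B W). Qed.

Lemma energy_mono c j y y' a a' :
  (forall k : 'rV['I_(2 ^ j)]_d, `|pos R k - y| <= a -> `|pos R k - y'| <= a') ->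
  energy p c j y a `^ p^-1 <= energy p c j y' a' `^ p^-1.
Proof.
move=> H; apply: ge0_ler_powR; rewrite ?nnegrE ?energy_ge0 ?invr_ge0 ?(ltW p0)//.
rewrite /energy big_mkcond [leRHS]big_mkcond/=; apply: ler_sum => k _.
have G0 : 0 <= \sum_(i < (2 ^ d).-1) `|c j k i| `^ p.
  by apply: sumr_ge0 => i _; exact: powR_ge0.
by case: ifP => [/H ->//|_]; case: ifP.
Qed.

Lemma norm_exp2Z j x : `|2 ^+ j *: x| = e2 j%:R * `|x|.
Proof. by rewrite normrZ ger0_norm ?exprn_ge0// e2_nat. Qed.

Let segment_near (j0 j : nat) x y v (t : R) : `|y - x| <= e2 (- j0%:R) ->
  `|v| <= e2 (- j0%:R) -> 0 <= t <= 1 ->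
  `|2 ^+ j *: (y + t *: v) - 2 ^+ j *: x| <= 2 * e2 (j%:R - j0%:R).
Proof.
move=> yx vj /andP[t0 t1]; rewrite -scalerBr norm_exp2Z e2D mulrCA ler_wpM2l ?e2_ge0//.
rewrite (_ : y + t *: v - x = (y - x) + t *: v); last by rewrite addrAC.
rewrite (le_trans (ler_normD _ _))// normrZ (ger0_norm t0).
have : t * `|v| <= `|v| by rewrite ler_piMl.
lra.
Qed.

Lemma fine_layer_le c (j0 j : nat) x y v (t : R) : (j0 <= j)%N ->
  `|y - x| <= e2 (- j0%:R) -> `|v| <= e2 (- j0%:R) -> 0 <= t <= 1 ->
  `|wavelet_layer psi c j (y + t *: v)| <= layer_cst * local_size c j0 j x.
Proof.
move=> j0j yx vj t01; set z := y + t *: v.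
have zx := segment_near j yx vj t01; rewrite -/z in zx.
have E1 : 1 <= e2 (j%:R - j0%:R : R) by rewrite e2_ge1 subr_ge0 ler_nat.
apply: le_trans (@weighted_layer_le _ _ p c j (2 ^+ j *: z) S B
  (fun k i => psi i (2 ^+ j *: z - pos R k)) p1 (ltW (wb_B W)) _ _) _.
- by move=> k i _; exact: wb_sup W _ _.
- by move=> k i kz; apply: (wb_supp W); rewrite distrC.
- rewrite ler_pM ?powR_ge0//.
  + by rewrite mulr_ge0// ltW// (wb_B W).
  + rewrite /layer_cst ler_wpM2r ?(ltW (wb_B W))// ler_nat.
    apply: leq_mul => //; apply: leq_expl; rewrite ltnS le_truncn//.
    by rewrite ler_pM2l// lerDl.
  + apply: energy_mono => k kz; rewrite /layer_radius.
    have -> : Num.max (j%:R - j0%:R) 0 = j%:R - j0%:R :> R.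
      by apply: max_l; rewrite subr_ge0 ler_nat.
    rewrite -(subrKA (2 ^+ j *: z)) (le_trans (ler_normD _ _))//.
    rewrite mulrDl lerD//; apply: le_trans kz _.
    by rewrite ler_peMr// ltW.
Qed.

(** At scale 2 ^ -j the segment has length at most 2 ^ (j - j0), so every wavelet seen from it is
    replaced by its Taylor polynomial along the segment; q is their combination. *)
Lemma coarse_layer_le c (j0 j : nat) x y v : (j <= j0)%N ->
  `|y - x| <= e2 (- j0%:R) -> `|v| <= e2 (- j0%:R) ->
  exists2 q : {poly R}, (size q <= N.+1)%N & forall t : R, 0 <= t <= 1 ->
  `|wavelet_layer psi c j (y + t *: v) - q.[t]| <=
    layer_cst * (attenuation j0 j * local_size c j0 j x).
Proof.
move=> jj0 yx vj.
have E1 : e2 (j%:R - j0%:R : R) <= 1 by rewrite e2_le1 subr_le0 ler_nat.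
have radE : layer_radius j0 j = S + 2.
  rewrite /layer_radius (_ : Num.max _ _ = 0) ?e2_0 ?mulr1//.
  by apply: max_r; rewrite subr_le0 ler_nat.
have attE : attenuation j0 j = e2 (j%:R - j0%:R) ^+ N.+1.
  rewrite /attenuation (_ : Num.max _ _ = j0%:R - j%:R :> R); last first.
    by apply: max_l; rewrite subr_ge0 ler_nat.
  by rewrite e2_exp; congr e2; lra.
have /choice[q Hq] : forall ki : 'rV['I_(2 ^ j)]_d * 'I_(2 ^ d).-1, exists q : {poly R},
   (size q <= N.+1)%N /\ forall t : R, 0 <= t <= 1 ->
   let w := psi ki.2 (2 ^+ j *: (y + t *: v) - pos R ki.1) - q.[t] in
   (`|w| <= B * attenuation j0 j) /\ (S + 2 < `|pos R ki.1 - 2 ^+ j *: x| -> w = 0).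
  move=> [k i] /=.
  (* A position this far away is not seen: the wavelet vanishes on the whole segment and 0 is its
     polynomial. *)
  have [kx|kx] := ltP (S + 2) (`|pos R k - 2 ^+ j *: x|).
    exists 0; rewrite size_poly0; split => // t t01.
    rewrite (wb_supp W) ?horner0 ?subrr ?normr0.
      by split => //; rewrite mulr_ge0 ?e2_ge0 ?(ltW (wb_B W)).
    have := segment_near j yx vj t01.
    set z := 2 ^+ j *: (y + t *: v) => zx.
    have : `|pos R k - 2 ^+ j *: x| <= `|z - pos R k| + `|z - 2 ^+ j *: x|.
      by rewrite -(subrKA z) (le_trans (ler_normD _ _))// distrC.
    lra.
  have [q sq Hq] := wb_taylor W i (2 ^+ j *: y - pos R k) (2 ^+ j *: v).
  exists q; split => // t t01; split => //.
  have -> : 2 ^+ j *: (y + t *: v) - pos R k = 2 ^+ j *: y - pos R k + t *: (2 ^+ j *: v).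
    by rewrite scalerDr addrAC !scalerA [t * _]mulrC.
  apply: le_trans (Hq t t01) _; rewrite ler_wpM2l ?(ltW (wb_B W))// attE.
  rewrite lerXn2r ?nnegrE ?e2_ge0//.
  by rewrite norm_exp2Z e2D ler_wpM2l ?e2_ge0.
exists (\sum_k \sum_(i < (2 ^ d).-1) c j k i *: q (k, i)).
  apply: (leq_trans (size_sum _ _ _)); apply/bigmax_leqP => k _.
  apply: (leq_trans (size_sum _ _ _)); apply/bigmax_leqP => i _.
  by rewrite (leq_trans (size_scale_leq _ _))//; have [] := Hq (k, i).
move=> t t01; rewrite /wavelet_layer horner_sum -sumrB.
under eq_bigr do rewrite horner_sum -sumrB.
under eq_bigr do under eq_bigr do rewrite hornerZ -mulrBr.
apply: le_trans (@weighted_layer_le _ _ p c j (2 ^+ j *: x) (S + 2) (B * attenuation j0 j)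
  (fun k i => psi i (2 ^+ j *: (y + t *: v) - pos R k) - (q (k, i)).[t]) p1 _ _ _) _.
- by rewrite mulr_ge0 ?e2_ge0 ?(ltW (wb_B W)).
- by move=> k i _; have [_ /(_ t t01)[]] := Hq (k, i).
- by move=> k i kx; have [_ /(_ t t01)[_]] := Hq (k, i); exact.
- by rewrite /layer_cst /local_size radE !mulrA.
Qed.

End local_approximation.

Section series_approximation.
Context (R : realType) (d : nat) (N : nat).
Local Notation V := ('rV[R]_d).
Context (phi : V -> R) (psi : 'I_(2 ^ d).-1 -> V -> R) (S B : R).
Hypothesis W : wavelet_bounds N phi psi S B.
Context (p : R) (p1 : 1 <= p).
Implicit Types (c : besov_coefs R d) (x y v z : V) (f : V -> R).

Definition is_wavelet_sum (c0 : R) c f := forall x,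
  (fun n => c0 * phi x + \sum_(0 <= j < n) wavelet_layer psi c j x) @ \oo --> f x.

(** [eta] is the tolerated size at generation [j0]. The tolerance shrinks by 2 ^ -kap per generation
    away from [j0], so that all the layers together contribute a multiple of [eta]. *)
Definition tame c (kap eta : R) (j0 : nat) x := forall j,
  attenuation R N j0 j * local_size S p c j0 j x <= eta * e2 (- kap * `|j%:R - j0%:R|).

Local Notation CL := (layer_cst d S B).
Local Notation G a := (1 - e2 (- a))^-1.

Let p0 : 0 < p. Proof. exact: lt_le_trans p1. Qed.

(** The generations below [j0] and [phi] supply Taylor polynomials, the finer ones are pure error;
    both families of errors are geometric in |j - j0|. The remainder of [phi] is not governed by
    [eta] and stays as a separate term. *)
Lemma tame_approx (c0 : R) c f kap eta (j0 : nat) x y v :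
  is_wavelet_sum c0 c f -> 0 < kap -> 0 <= eta -> tame c kap eta j0 x ->
  `|y - x| <= e2 (- j0%:R) -> `|v| <= e2 (- j0%:R) ->
  exists2 q : {poly R}, (size q <= N.+1)%N & forall t : R, 0 <= t <= 1 ->
  `|f (y + t *: v) - q.[t]| <=
    B * `|c0| * e2 (- (N.+1%:R * j0%:R)) + 4 * (G kap * CL) * eta.
Proof.
move=> Hf k0 eta0 Hx yx vj.
have CL0 : 0 <= CL := layer_cst_ge0 W.
have term0 (j : nat) : 0 <= CL * (eta * e2 (- kap * `|j%:R - j0%:R|)).
  by apply: mulr_ge0 => //; apply: mulr_ge0 => //; exact: e2_ge0.
have sumE m n : \sum_(m <= j < n) CL * (eta * e2 (- kap * `|j%:R - j0%:R|))
    <= 2 * (G kap * CL) * eta.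
  apply: (@le_trans _ _ (\sum_(0 <= j < n) CL * (eta * e2 (- kap * `|j%:R - j0%:R|)))).
    have [mn|nm] := leqP m n.
      by rewrite [leRHS](big_cat_nat (leq0n m) mn)/= lerDr sumr_ge0.
    by rewrite big_geq ?(ltnW nm)// sumr_ge0.
  rewrite -mulr_sumr -mulr_sumr.
  have := sum_e2_dist j0 n k0; set A := \sum_(_ <= _ < _) _; set g := (_)^-1 => AG.
  have : CL * eta * A <= CL * eta * (2 * g) by rewrite ler_wpM2l// mulr_ge0.
  lra.
have [q0 sq0 Hq0] := wb_phi W y v.
have /choice[q Hq] : forall j, exists q : {poly R}, (j <= j0)%N ->
  (size q <= N.+1)%N /\ forall t : R, 0 <= t <= 1 ->
  `|wavelet_layer psi c j (y + t *: v) - q.[t]| <=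
    CL * (eta * e2 (- kap * `|j%:R - j0%:R|)).
  move=> j; have [jj0|] := leqP j j0; last by exists 0.
  have [q sq Hq] := coarse_layer_le W p1 c jj0 yx vj.
  exists q => _; split => // t /Hq /le_trans; apply.
  by rewrite ler_wpM2l.
exists (c0 *: q0 + \sum_(0 <= j < j0) q j).
  rewrite (leq_trans (size_polyD _ _))// geq_max (leq_trans (size_scale_leq _ _))//=.
  rewrite big_nat; apply: (leq_trans (size_sum _ _ _)); apply/bigmax_leqP_seq => j _ /andP[_ jj0].
  by have [] := Hq j (ltnW jj0).
move=> t t01; set z := y + t *: v.
pose u n := c0 * phi z + \sum_(0 <= j < n) wavelet_layer psi c j z.
have H1 : `|f z - u j0| <= 2 * (G kap * CL) * eta.
  apply: (series_tail_le (Hf z)) => n j0n.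
  have -> : u n - u j0 = \sum_(j0 <= j < n) wavelet_layer psi c j z.
    by rewrite /u (big_cat_nat (leq0n j0) j0n)/=; ring.
  rewrite (le_trans (ler_norm_sum _ _ _))//; apply: le_trans (sumE j0 n).
  apply: ler_sum_nat => j /andP[j0j _].
  apply: (le_trans (fine_layer_le W p1 c j0j yx vj t01)).
  rewrite ler_wpM2l//; apply: le_trans (Hx j).
  rewrite /attenuation (_ : Num.max _ _ = 0) ?mulr0 ?e2_0 ?mul1r//.
  by apply: max_r; rewrite subr_le0 ler_nat.
have H2 : `|u j0 - (c0 *: q0 + \sum_(0 <= j < j0) q j).[t]| <=
    B * `|c0| * e2 (- (N.+1%:R * j0%:R)) + 2 * (G kap * CL) * eta.
  rewrite hornerD hornerZ horner_sum /u.
  rewrite (_ : forall a b a' b' : R, a + b - (a' + b') = (a - a') + (b - b')); last first.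
    by move=> *; ring.
  rewrite -mulrBr -sumrB (le_trans (ler_normD _ _))// lerD//.
    rewrite normrM [B * _]mulrC -mulrA ler_wpM2l//.
    apply: (le_trans (Hq0 t t01)); rewrite ler_wpM2l ?(ltW (wb_B W))//.
    rewrite (_ : - (_ * _) = - j0%:R * N.+1%:R); last by ring.
    by rewrite -e2_exp lerXn2r ?nnegrE ?e2_ge0.
  rewrite (le_trans (ler_norm_sum _ _ _))//; apply: le_trans (sumE 0 j0).
  apply: ler_sum_nat => j /andP[_ jj0].
  by have [_] := Hq j (ltnW jj0); exact.
rewrite -(subrKA (u j0)) (le_trans (ler_normD _ _))//.
move: H1 H2; set a := `|_|; set b := `|_|; lra.
Qed.

Definition total_size c j : R :=
  \sum_(k : 'rV['I_(2 ^ j)]_d) \sum_(i < (2 ^ d).-1) `|c j k i| `^ p.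

(** After exchanging the sums, a position is counted once for each point of the family that sees it,
    and these points are separated within a ball around it. *)
Lemma sum_energy_le c (j0 j : nat) (s : seq V) : separated (e2 (- j0%:R)) s ->
  \sum_(x <- s) energy p c j (2 ^+ j *: x) (layer_radius S j0 j) <=
  (2 * S + 5) ^+ d * e2 (d%:R * Num.max (j0%:R - j%:R) 0) * total_size c j.
Proof.
move=> ss; rewrite /energy.
under eq_bigr do rewrite big_mkcond/=.
rewrite exchange_big /total_size mulr_sumr; apply: ler_sum => k _.
rewrite -big_mkcond/= big_const_seq iter_addr_0 -[leLHS]mulr_natl.
set E := \sum_(_ < _) _; have E0 : 0 <= E by apply: sumr_ge0 => i _; exact: powR_ge0.
rewrite ler_wpM2r// -size_filter.
have S1 := wb_S W.
pose z := e2 (- j%:R) *: pos R k.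
(* Diameter of the zone that sees the position, measured in units of the separation; the constant 2
   S + 5 below is 2 (S + 2) + 1. *)
pose X := 2 * (layer_radius S j0 j * e2 (- j%:R)) / e2 (- j0%:R : R).
have XE : X = 2 * (S + 2) * e2 (Num.max (j0%:R - j%:R) 0).
  rewrite /X /layer_radius -e2N opprK -!mulrA -!e2D; congr (_ * (_ * e2 _)).
  by rewrite /Num.max; do 2 case: ifPn; lra.
have F0 : 1 <= e2 (Num.max (j0%:R - j%:R) 0 : R) by rewrite e2_ge1 le_max lexx orbT.
have X0 : 0 <= X by rewrite XE !mulr_ge0 ?e2_ge0//; lra.
apply: (@le_trans _ _ ((Num.truncn X).+1 ^ d)%N%:R).
  rewrite ler_nat; apply: (@size_separated_le _ _ z _ _ _ (e2_gt0 _)).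
    exact: pairwise_filter.
  move=> x; rewrite mem_filter => /andP[kx _].
  have -> : x - z = - (e2 (- j%:R) *: (pos R k - 2 ^+ j *: x)).
    by rewrite scalerBr scalerA -e2_nat -e2D addNr e2_0 scale1r opprB.
  by rewrite normrN normrZ ger0_norm ?e2_ge0// mulrC ler_wpM2r ?e2_ge0.
rewrite natrX mulrC [d%:R * _]mulrC -e2_exp mulrC -exprMn lerXn2r ?nnegrE//.
  by rewrite mulr_ge0 ?e2_ge0//; lra.
rewrite -natr1; have /andP[+ _] := truncn_itv X0; rewrite XE.
set t := (Num.truncn _)%:R; set e := e2 _ in F0 *; nra.
Qed.

(** A Chebyshev argument: a point that is not tame violates the condition at some generation, so the
    p-th powers of the violated inequalities, summed over all points and generations, bound the
    number of points. The hypotheses on [kap] leave a geometric decay in |j - j0|. *)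
Lemma count_not_tame s M c kap eta (j0 : nat) (l : seq V) :
  s <= N%:R -> 0 < kap <= 2^-1 -> 2 * kap * p <= s * p - d%:R -> 0 < eta -> 0 < M ->
  (forall j, total_size c j <= M * e2 (- (s * p - d%:R) * j%:R)) ->
  separated (e2 (- j0%:R)) l -> (forall x, x \in l -> ~ tame c kap eta j0 x) ->
  (size l)%:R <= 2 * G (kap * p) * (2 * S + 5) ^+ d * M * (eta `^ p)^-1
     * e2 (- (s * p - d%:R) * j0%:R).
Proof.
move=> sN /andP[kap0 kap1] kaps eta0 M0 cM ls lt.
have S1 := wb_S W.
have kp0 : 0 < kap * p by rewrite mulr_gt0.
have ep0 : 0 < eta `^ p by rewrite powR_gt0.
(* The p-th power of attenuation over tolerance: a violation of [tame] at generation j reads 1 <= w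
   j * en x j. *)
pose w j := (eta `^ p)^-1 * e2 (kap * p * `|j%:R - j0%:R|) * attenuation R N j0 j `^ p.
have w0 j : 0 <= w j.
  by rewrite !mulr_ge0 ?powR_ge0 ?e2_ge0 ?invr_ge0// ltW.
pose en x j := energy p c j (2 ^+ j *: x) (layer_radius S j0 j).
have /choice[jx Hjx] : forall x, exists j, x \in l -> 1 <= w j * en x j.
  move=> x; have [xl|] := boolP (x \in l); last by exists 0%N.
  have := lt x xl; rewrite /tame => /existsNP[j /negP]; rewrite -ltNge => Hj.
  exists j => _.
  have : (eta * e2 (- kap * `|j%:R - j0%:R|)) `^ p <=
         (attenuation R N j0 j * local_size S p c j0 j x) `^ p.
    apply: ge0_ler_powR; rewrite ?nnegrE ?(ltW p0) ?mulr_ge0 ?e2_ge0 ?powR_ge0 ?(ltW eta0)//.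
    exact: ltW.
  rewrite !powRM ?e2_ge0 ?powR_ge0 ?(ltW eta0)// /local_size -powRrM mulVf ?gt_eqF//.
  rewrite powRr1 ?energy_ge0// -e2M -/(en x j) => H.
  have -> : w j * en x j = ((eta `^ p)^-1 * e2 (kap * p * `|j%:R - j0%:R|)) *
      (attenuation R N j0 j `^ p * en x j) by rewrite /w; ring.
  have E1 : ((eta `^ p)^-1 * e2 (kap * p * `|j%:R - j0%:R|)) *
      (eta `^ p * e2 (- kap * `|j%:R - j0%:R| * p)) = 1.
    rewrite mulrACA mulVf ?gt_eqF// -e2D mul1r -[RHS]e2_0; congr e2; ring.
  by rewrite -[leLHS]E1 ler_wpM2l// mulr_ge0 ?e2_ge0// invr_ge0 ltW.
pose J := (\max_(x <- l) jx x).+1.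
have size_le : (size l)%:R <= \sum_(x <- l) \sum_(0 <= j < J) w j * en x j.
  rewrite -sum1_size natr_sum big_seq [leRHS]big_seq; apply: ler_sum => x xl.
  rewrite (bigD1_seq (jx x)) ?iota_uniq//=; last first.
    rewrite mem_index_iota/= ltnS; exact: (@leq_bigmax_seq _ l xpredT jx x xl isT).
  apply: le_trans (Hjx x xl) _; rewrite lerDl sumr_ge0// => j _.
  by rewrite mulr_ge0// energy_ge0.
apply: (le_trans size_le); rewrite exchange_big/=.
apply: (@le_trans _ _ (\sum_(0 <= j < J) (2 * S + 5) ^+ d * M * (eta `^ p)^-1
   * e2 (- (s * p - d%:R) * j0%:R) * e2 (- (kap * p) * `|j%:R - j0%:R|))).
  apply: ler_sum => j _; rewrite -mulr_sumr.
  apply: (le_trans (ler_wpM2l (w0 j) (sum_energy_le c j ls))).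
  apply: (@le_trans _ _ (w j * ((2 * S + 5) ^+ d * e2 (d%:R * Num.max (j0%:R - j%:R) 0)
      * (M * e2 (- (s * p - d%:R) * j%:R))))).
    rewrite ler_wpM2l// ler_wpM2l// mulr_ge0 ?e2_ge0// exprn_ge0//; lra.
  set m1 := Num.max _ _; set D := `|_|; set K := _ ^+ d.
  have K0 : 0 <= K by rewrite exprn_ge0//; lra.
  have -> : w j * (K * e2 (d%:R * m1) * (M * e2 (- (s * p - d%:R) * j%:R))) =
     K * M * (eta `^ p)^-1 * e2 (kap * p * D - N.+1%:R * m1 * p + d%:R * m1 -
        (s * p - d%:R) * j%:R).
    rewrite /w /attenuation -e2M -/m1 -/D !e2D -!mulNr; ring.
  have -> : forall a b e, K * M * e * a * b = K * M * e * (a * b) by move=> *; ring.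
  rewrite -e2D ler_wpM2l ?mulr_ge0 ?invr_ge0 ?(ltW M0) ?(ltW ep0)// ler_e2.
  (* This settles the generations j <= j0; the finer ones use 2 kap p <= s p - d. *)
  have N1 : s + 2 * kap <= N.+1%:R by rewrite -natr1; lra.
  rewrite /m1 /D; have [jj0|j0j] := leP (j%:R : R) j0%:R.
    rewrite distrC ger0_norm ?subr_ge0// max_l ?subr_ge0//.
    have : 0 <= (j0%:R - j%:R) * p * (N.+1%:R - s - 2 * kap).
      by rewrite !mulr_ge0 ?subr_ge0 ?(ltW p0)//; lra.
    lra.
  rewrite ger0_norm ?subr_ge0 ?(ltW j0j)// max_r ?subr_le0 ?(ltW j0j)//.
  have : 0 <= (j%:R - j0%:R) * (s * p - d%:R - 2 * kap * p).
    by rewrite mulr_ge0 ?subr_ge0 ?(ltW j0j).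
  lra.
rewrite -mulr_sumr; have := sum_e2_dist j0 J kp0.
set A := \sum_(_ <= _ < _) _ => AG.
set K := _ ^+ d * M * _ * _.
have K0 : 0 <= K.
  rewrite !mulr_ge0 ?e2_ge0 ?invr_ge0 ?exprn_ge0 ?(ltW M0) ?(ltW ep0)//; lra.
have : K * A <= K * (2 * G (kap * p)) by rewrite ler_wpM2l.
by rewrite /K; lra.
Qed.

End series_approximation.

Section wavelet_sum_continuity.
Context (R : realType) (d : nat) (N : nat).
Local Notation V := ('rV[R]_d).
Context (phi : V -> R) (psi : 'I_(2 ^ d).-1 -> V -> R) (S B : R).
Hypothesis W : wavelet_bounds N phi psi S B.
Context (p : R) (p1 : 1 <= p).
Implicit Types (c : besov_coefs R d) (x y v z : V) (f : V -> R).

Lemma continuous_wavelet_layer c j : continuous (wavelet_layer psi c j).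
Proof.
apply: continuous_sumr => k; apply: continuous_sumr => i x.
apply: continuousM; first exact: cst_continuous.
apply: (@continuous_comp _ _ _ (fun x => 2 ^+ j *: x - pos R k) (psi i)); last exact: wb_cpsi W _ _.
apply: continuousB; last exact: cst_continuous.
exact: scaler_continuous.
Qed.

Lemma continuous_wavelet_sum (c0 C a : R) c f : 0 < a -> 0 < C ->
  (forall j z, `|wavelet_layer psi c j z| <= C * e2 (- a * j%:R)) ->
  is_wavelet_sum phi psi c0 c f -> continuous f.
Proof.
move=> a0 C0 gC Hf x; suff fx : f y @[y --> x] --> f x by exact: fx.
apply/(@cvgrPdist_le _ _ _ (nbhs x) (nbhs_filter x)) => e e0.
pose G := (1 - e2 (- a))^-1; have G0 : 0 < G by rewrite invr_gt0 subr_gt0 e2_lt1 oppr_lt0.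
have [n Hn] : exists n : nat, C * (G * e2 (- a * n%:R)) <= e / 3.
  have [|n Hn] := @e2_small R a (e / 3 / (C * G)) a0.
    by rewrite divr_gt0 ?mulr_gt0// divr_gt0.
  by exists n; rewrite mulrA mulrC -ler_pdivlMr ?mulr_gt0//; exact: Hn.
pose u n z := c0 * phi z + \sum_(0 <= j < n) wavelet_layer psi c j z.
have Hu z : `|f z - u n z| <= e / 3.
  apply: le_trans Hn; apply: (series_tail_le (u := u ^~ z) (Hf z)) => m nm.
  have -> : u m z - u n z = \sum_(n <= j < m) wavelet_layer psi c j z.
    by rewrite /u (big_cat_nat (leq0n n) nm)/=; ring.
  rewrite (le_trans (ler_norm_sum _ _ _))//.
  apply: (@le_trans _ _ (\sum_(n <= j < m) C * e2 (- a * j%:R))).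
    by apply: ler_sum => j _; exact: gC.
  by rewrite -mulr_sumr ler_wpM2l ?(ltW C0)// geometric_sum_le.
have cu : continuous (u n).
  move=> z; apply: (@continuousD _ _ _ (fun z => c0 * phi z)
      (fun z => \sum_(0 <= j < n) wavelet_layer psi c j z)).
    by apply: continuousM; [exact: cst_continuous|exact: wb_cphi W _].
  by apply: continuous_sumr => j; exact: continuous_wavelet_layer.
have e30 : 0 < e / 3 by rewrite divr_gt0.
have nearu : \forall y \near x, `|u n x - u n y| <= e / 3.
  have cux : u n y @[y --> x] --> u n x by exact: cu.
  by move/(@cvgrPdist_le _ _ _ (nbhs x) (nbhs_filter x)): cux; exact.
near=> y.
have H1 := Hu x; have H2 := Hu y; rewrite distrC in H2.
have H3 : `|u n x - u n y| <= e / 3 by near: y.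
rewrite -(subrKA (u n x)) (le_trans (ler_normD _ _))//.
rewrite -[u n x - f y](subrKA (u n y)).
have := ler_normD (u n x - u n y) (u n y - f y); lra.
Unshelve. all: by end_near. Qed.

(** Layer by layer, the embedding of B^s_{p,oo} into the Hoelder class of exponent s - d/p; it is
    [fine_layer_le] with j0 = j on a segment reduced to a point. *)
Lemma wavelet_layer_le s c M : 0 < M ->
  (forall j, total_size p c j <= M * e2 (- (s * p - d%:R) * j%:R)) ->
  exists2 C : R, 0 < C & forall j z,
    `|wavelet_layer psi c j z| <= C * e2 (- (s - d%:R / p) * j%:R).
Proof.
move=> M0 cM; have p0 : 0 < p by exact: lt_le_trans p1.
have CL0 := layer_cst_ge0 W.
exists (layer_cst d S B * M `^ p^-1 + 1).
  by rewrite ltr_wpDl// mulr_ge0// powR_ge0.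
move=> j z; have z0 : z + 0 *: 0 = z :> V by rewrite scale0r addr0.
have := @fine_layer_le _ _ _ _ _ _ _ W p p1 c j j z z 0 0 (leqnn j).
rewrite z0 subrr normr0 => H; apply: le_trans (H _ _ _) _; rewrite ?e2_ge0 ?lexx ?ler01//.
rewrite mulrDl mul1r.
apply: (@le_trans _ _ (layer_cst d S B * M `^ p^-1 * e2 (- (s - d%:R / p) * j%:R))).
  rewrite -mulrA ler_wpM2l//.
  have -> : - (s - d%:R / p) * j%:R = - (s * p - d%:R) * j%:R * p^-1.
    by field; rewrite gt_eqF.
  rewrite e2M -powRM ?e2_ge0 ?(ltW M0)//.
  apply: ge0_ler_powR; rewrite ?nnegrE ?energy_ge0 ?invr_ge0 ?(ltW p0) ?mulr_ge0 ?e2_ge0 ?(ltW M0)//.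
  apply: le_trans (cM j); rewrite /total_size /energy [leRHS](bigID (fun k => `|pos R k - 2 ^+ j *: z| <= layer_radius S j j))/=.
  by rewrite lerDl; apply: sumr_ge0 => k _; apply: sumr_ge0 => i _; exact: powR_ge0.
by rewrite lerDl e2_ge0.
Qed.

Lemma besovP s q f : (1 <= q)%E -> besov phi psi s p q f -> exists (c0 M : R) c,
  [/\ 0 < M, (forall j, total_size p c j <= M * e2 (- (s * p - d%:R) * j%:R)) &
      is_wavelet_sum phi psi c0 c f].
Proof.
move=> q1 [c0 [c [cfin Hf]]]; have [M M0 HM] := besov_norm_layer p1 q1 cfin.
exists c0, M, c; split => // j.
rewrite mulNr e2N ler_pdivlMr ?e2_gt0//; apply: le_trans (HM j).
by rewrite /besov_layer mulrC.
Qed.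

End wavelet_sum_continuity.

(** * The upper bound on the packing dimension *)

Section pointwise_exponents_on_continuous_functions.
Context (R : realType) (d : nat).
Local Notation V := ('rV[R]_d).
Implicit Types (x y u v z : V) (f : V -> R) (a h : R).

Lemma holder_pointwise f a x : continuous f -> holder_space a x f ->
  exists C r0 : R, exists P : mpoly.mpoly d R,
  [/\ 0 < C, 0 < r0, (mpoly.msize P).-1%:R < a &
    forall r z, 0 < r <= r0 -> ball x r z -> `|f z - peval P z| <= C * r `^ a].
Proof.
move=> cf [C [r0 [P [C0 r00 Pa H]]]]; exists C, r0, P; split => // r z rr0 xz.
rewrite -lee_fin; apply: le_trans (H r rr0).
apply: (@Linf_norm_ge _ _ _ (fun x => f x - peval P x)) => //.
  exact: ball_open.
move=> y; apply: (@continuousB _ _ _ f (peval P)); first exact: cf.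
exact: peval_continuous.
Qed.

Lemma irregular_pointwise f a x : irregular_space a x f ->
  exists C r0 : R, [/\ 0 < C, 0 < r0 &
    forall r, 0 < r < r0 -> exists u, `|u| <= r /\
      exists y, diff_domain (Num.truncn a).+1 u x r y /\
        C * r `^ a <= `|finite_diff (Num.truncn a).+1 u f y|].
Proof.
(* The constant is halved because the suprema over u and over the domain need not be attained. *)
move=> [C [r0 [C0 r00 H]]]; exists (C / 2), r0; split => //; first by rewrite divr_gt0.
move=> r /[dup] /andP[r_gt0 _] rr0; apply: contrapT => nex.
have Cr : 0 < C * r `^ a by rewrite mulr_gt0// powR_gt0.
have : ((C * r `^ a)%:E <= (C / 2 * r `^ a)%:E)%E.
  apply: le_trans (H r rr0) _; apply: ge_ereal_sup => _ [u /= ur <-].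
  apply: Linf_norm_le; first by rewrite mulr_ge0 ?powR_ge0// divr_ge0// ltW.
  move=> y Dy; rewrite leNgt; apply/negP => yC; apply: nex.
  by exists u; split => //; exists y; split => //; exact: ltW.
rewrite lee_fin; lra.
Qed.

(** Both conditions with constants and range of scales depending on m only: countably many such sets
    cover [E_HR], and the counting arguments apply uniformly to the points of each. *)
Definition regular_irregular (n : nat) (h e : R) f (m : nat) : set V :=
  [set x | (exists2 P : mpoly.mpoly d R, (mpoly.msize P <= n)%N &
     forall r z, 0 < r <= m.+1%:R^-1 -> ball x r z ->
       `|f z - peval P z| <= m.+1%:R * r `^ (h - e)) /\
   forall r, 0 < r < m.+1%:R^-1 -> exists u, `|u| <= r /\
     exists y, diff_domain n u x r y /\
       m.+1%:R^-1 * r `^ (h + e) <= `|finite_diff n u f y|].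

(** The bound h + e <= [h] + 1 forces [b] = [h] for the exponent b < h + e supplied by h^+, so
    differences of one order n occur. The polynomial supplied by h^- has degree less than h, hence
    is killed by them. *)
Lemma E_HR_cover h e f : continuous f -> 0 < h -> 0 < e -> h + e <= (Num.truncn h).+1%:R ->
  E_HR h f `<=` \bigcup_m regular_irregular (Num.truncn h).+1 h e f m.
Proof.
move=> cf h0 e0 hen x [_ lo up].
have [_ [a [/= a0 Ha] <-] ha] : exists2 y, [set a%:E | a in [set a | 0 < a /\ holder_space a x f]] y
    & ((h - e)%:E < y)%E.
  by apply: ereal_sup_gt; rewrite -/(lower_exponent f x) lo lte_fin; lra.
have ah : a <= h.
  by rewrite -lee_fin -lo; apply: ereal_sup_ubound; exists a.
have [_ [b [/= b0 Hb] <-] bh] : exists2 y, [set a%:E | a in [set a | 0 < a /\ irregular_space a x f]] y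
    & (y < (h + e)%:E)%E.
  by apply: ereal_inf_lt; rewrite -/(upper_exponent f x) up lte_fin; lra.
have hb : h <= b.
  by rewrite -lee_fin -up; apply: ereal_inf_lbound; exists b.
rewrite lte_fin in ha; rewrite lte_fin in bh.
have bn : Num.truncn b = Num.truncn h.
  apply: truncn_def; rewrite (lt_le_trans bh)// andbT.
  have /andP[hh _] := truncn_itv (ltW h0).
  exact: le_trans hh hb.
have [C [r0 [P [C0 r00 Pa HP]]]] := holder_pointwise cf Ha.
have [C' [r0' [C'0 r0'0 HI]]] := irregular_pointwise Hb.
rewrite bn in HI.
pose M := C + C'^-1 + r0^-1 + r0'^-1; pose m := Num.truncn M.
have Ci0 : 0 < C'^-1 by rewrite invr_gt0.
have ri0 : 0 < r0^-1 by rewrite invr_gt0.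
have ri'0 : 0 < r0'^-1 by rewrite invr_gt0.
have Mm : M < m.+1%:R := truncnS_gt M.
have inv_le (X : R) : 0 < X -> X^-1 < m.+1%:R -> m.+1%:R^-1 <= X.
  by move=> X0 /ltW; rewrite -[X in _ -> _ <= X]invrK lef_pV2 ?posrE ?invr_gt0 ?ltr0n.
have m1 : m.+1%:R^-1 <= 1 :> R by rewrite invf_le1// ler1n.
exists m => //; split.
  exists P.
    have : (mpoly.msize P).-1%:R < h by exact: lt_le_trans ah.
    move=> /ltW; rewrite -(truncn_ge_nat _ (ltW h0)) => PH.
    exact: leq_trans (leqSpred _) _.
  move=> r z /andP[r_gt0 rm] xz.
  apply: le_trans (HP r z _ xz) _.
    by rewrite r_gt0/= (le_trans rm)// inv_le// (le_lt_trans _ Mm)// /M; lra.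
  apply: ler_pM; rewrite ?powR_ge0 ?(ltW C0)//; first by apply: ltW; apply: le_lt_trans Mm; rewrite /M; lra.
  by apply: ger_powR; [rewrite r_gt0 (le_trans rm)|exact: ltW].
move=> r /andP[r_gt0 rm].
have [|u [ur [y [Dy Hy]]]] := HI r.
  by rewrite r_gt0/= (lt_le_trans rm)// inv_le// (le_lt_trans _ Mm)// /M; lra.
exists u; split => //; exists y; split => //; apply: le_trans Hy.
apply: ler_pM; rewrite ?powR_ge0 ?invr_ge0//.
  by apply: inv_le => //; apply: le_lt_trans Mm; rewrite /M; lra.
by apply: ger_powR; [rewrite r_gt0 (le_trans (ltW rm))|exact: ltW].
Qed.

Lemma diff_domain_center n u x r y : diff_domain n u x r y -> ball x r y.
Proof. by move=> /(_ 0); rewrite scale0r addr0 lexx ler01; exact. Qed.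

End pointwise_exponents_on_continuous_functions.

Section packing_upper_bound.
Context (R : realType) (d : nat) (N : nat).
Local Notation V := ('rV[R]_d).
Context (phi : V -> R) (psi : 'I_(2 ^ d).-1 -> V -> R) (S B : R).
Hypothesis W : wavelet_bounds N phi psi S B.
Context (p : R) (p1 : 1 <= p).
Implicit Types (c : besov_coefs R d) (x y v z : V) (f : V -> R).

Let p0 : 0 < p. Proof. exact: lt_le_trans p1. Qed.

Lemma poly_rescale (q : {poly R}) (K : nat) (T : R) : (size q <= K.+1)%N ->
  exists2 q' : {poly R}, (size q' <= K.+1)%N & forall t, q'.[t] = q.[t / T].
Proof.
move=> sq; exists (q \Po (T^-1 *: 'X)).
  apply: (leq_trans (size_comp_poly_leq _ _)); rewrite ltnS.
  have : (size (T^-1 *: 'X : {poly R}) <= 2)%N.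
    by rewrite (leq_trans (size_scale_leq _ _))// size_polyX.
  move: (size q) (size (T^-1 *: 'X : {poly R})) sq => a b; nia.
by move=> t; rewrite horner_comp hornerZ hornerX mulrC.
Qed.

(* If x were tame, f would be within E of a polynomial on a segment T times longer
   than the step u; as f is also close to a polynomial of degree < n, the n-th
   difference with step u gains the factor T ^- n. *)
Lemma tame_diff_le (n : nat) : exists2 CK : R, 0 < CK &
  forall (c0 : R) c f kap eta h e m (j0 : nat) x (T r : R) (u y : V),
  is_wavelet_sum phi psi c0 c f -> 0 < kap -> 0 <= eta -> tame N S p c kap eta j0 x ->
  e2 (- j0%:R) <= m.+1%:R^-1 :> R -> 1 <= T -> n%:R <= T ->
  T * r <= e2 (- j0%:R) / 2 -> 0 < r -> r < e2 (- j0%:R) / 2 ->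
  regular_irregular n h e f m x -> `|u| <= r -> diff_domain n u x r y ->
  `|finite_diff n u f y| <=
    CK * (B * `|c0| * e2 (- (N.+1%:R * j0%:R)) +
          4 * ((1 - e2 (- kap))^-1 * layer_cst d S B) * eta +
          m.+1%:R * e2 (- j0%:R) `^ (h - e) / T ^+ n).
Proof.
have [C C0 HC] := fdiff_poly_le R (maxn N.+1 n) n.
exists (2 ^+ n + C); first by rewrite ltr_wpDl// exprn_ge0.
move=> c0 c f kap eta h e m j0 x T r u y Hf k0 eta0 Hx jm T1 nT Tr r0 rj [[P sP HP] _] ur Dy.
set rho : R := e2 (- j0%:R) in jm Tr rj HP *.
have T0 : 0 < T by rewrite (lt_le_trans _ T1).
have rho0 : 0 < rho := e2_gt0 _.
have yx : `|y - x| < r.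
  by have := diff_domain_center Dy; rewrite -ball_normE/= distrC.
pose v := T *: u.
have vr : `|v| <= rho / 2.
  rewrite normrZ gtr0_norm//; apply: le_trans Tr.
  by rewrite ler_wpM2l ?(ltW T0).
have [||q sq Hq] := tame_approx W p1 Hf k0 eta0 Hx (y := y) (v := v).
- by rewrite -/rho; lra.
- by rewrite -/rho; lra.
set E := B * `|c0| * _ + _ in Hq *.
set M0 := m.+1%:R * rho `^ (h - e).
have zE t : y + t *: u = y + (t / T) *: v.
  by rewrite /v scalerA mulfVK ?gt_eqF.
have t01 t : 0 <= t <= T -> 0 <= t / T <= 1.
  by move=> /andP[t0 tT]; rewrite divr_ge0 ?(ltW T0)//= ler_pdivrMr// mul1r.
have [q' sq' q'E] := poly_rescale T sq.
have [pl spl plE] := peval_line P y u.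
pose g t := f (y + t *: u).
have E0 : 0 <= E.
  by rewrite (le_trans (normr_ge0 _) (Hq 0 _))// lexx ler01.
have M00 : 0 <= M0 by rewrite mulr_ge0 ?powR_ge0.
have gq t : 0 <= t <= T -> `|g t - q'.[t]| <= E.
  by move=> /t01 tT; rewrite /g q'E zE; exact: Hq.
have gp t : 0 <= t <= T -> `|g t - pl.[t]| <= M0.
  move=> /t01 /andP[t0 t1]; rewrite /g plE; apply: HP; first by rewrite rho0.
  rewrite -ball_normE/= distrC zE (_ : _ - x = y - x + (t / T) *: v); last by rewrite addrAC.
  rewrite (le_lt_trans (ler_normD _ _))// normrZ ger0_norm//.
  have : t / T * `|v| <= `|v| by rewrite ler_piMl.
  lra.
have -> : finite_diff n u f y = fdiff n g 0.
  by rewrite -finite_diff_line scale0r addr0.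
have H1 : `|fdiff n (fun t => g t - q'.[t]) 0| <= 2 ^+ n * E.
  apply: fdiff_le => i ni; rewrite add0r; apply: gq.
  by rewrite ler0n/= (le_trans _ nT)// ler_nat.
have H2 : `|fdiff n (horner (q' - pl)) 0| <= C * ((E + M0) / T ^+ n).
  apply: HC => //.
    rewrite (leq_trans (size_polyD _ _))// size_polyN geq_max leq_max sq'/=.
    by rewrite leq_max (leq_trans spl sP) orbT.
  move=> t tT; rewrite hornerD hornerN.
  have := gq t tT; have := gp t tT; rewrite (distrC _ q'.[t]) => Hp Hq'.
  by rewrite -(subrKA (g t)) (le_trans (ler_normD _ _))// lerD.
(* The difference of f - q' is bounded crudely and that of q' - pl gains T ^ -n; pl alone has size
   at most n and is killed. *)
have -> : fdiff n g 0 = fdiff n (fun t => g t - q'.[t]) 0 + fdiff n (horner (q' - pl)) 0.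
  have -> : fdiff n (horner (q' - pl)) 0 = fdiff n (horner q') 0 - fdiff n (horner pl) 0.
    by rewrite -fdiffB; apply: eq_fdiff => t; rewrite hornerD hornerN.
  by rewrite fdiffB (fdiff_poly0 _ (leq_trans spl sP)); ring.
rewrite (le_trans (ler_normD _ _))// (le_trans (lerD H1 H2))//.
have Tn1 : 1 <= T ^+ n by rewrite exprn_ege1.
have Tn0 : 0 < T ^+ n by rewrite (lt_le_trans _ Tn1).
have HE : E / T ^+ n <= E by rewrite ler_pdivrMr// ler_peMr.
rewrite [(E + M0) / _]mulrDl.
have n20 : (0:R) <= 2 ^+ n by rewrite exprn_ge0.
have X0 : 0 <= M0 / T ^+ n by rewrite divr_ge0// ltW.
have : C * (E / T ^+ n) <= C * E by rewrite ler_wpM2l// ltW.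
have : 0 <= 2 ^+ n * (M0 / T ^+ n) by rewrite mulr_ge0.
move: (E / _) (M0 / _) (2 ^+ n) => e1 e2 e3; lra.
Qed.

End packing_upper_bound.

Section packing_upper_bound_conclusion.
Context (R : realType) (d : nat) (N : nat).
Local Notation V := ('rV[R]_d).
Context (phi : V -> R) (psi : 'I_(2 ^ d).-1 -> V -> R) (S B : R).
Hypothesis W : wavelet_bounds N phi psi S B.
Context (p : R) (p1 : 1 <= p).
Implicit Types (c : besov_coefs R d) (f : V -> R).

Let p0 : 0 < p. Proof. exact: lt_le_trans p1. Qed.

(** At generation j the step is r = 2 ^ (-(1 + del) j - 2), the segment is T = 2 ^ (del j) times
    longer, and the tolerance is a small multiple of r ^ (h + e). For a tame point each of the three
    terms in [tame_diff_le] would be at most a quarter of the lower bound on the difference: the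
    first inequality on [del] serves the term with T ^ -n, the second the term of [phi], the choice
    of [k0] the term with [eta]. So no point is tame, and the factor eta ^ -p in [count_not_tame]
    yields the exponent. *)
Lemma packing_regular_irregular (n m : nat) (c0 s M h e del t : R) c f :
  is_wavelet_sum phi psi c0 c f -> 0 < M -> s <= N%:R -> 0 < s - d%:R / p ->
  (forall j, total_size p c j <= M * e2 (- (s * p - d%:R) * j%:R)) ->
  0 < del -> (1 + del) * (h + e) < h - e + del * n%:R ->
  (1 + del) * (h + e) < N.+1%:R -> 0 <= t ->
  (1 + del) * (h + e) * p - (s * p - d%:R) < t ->
  packing_premeasure t (regular_irregular n h e f m) = 0%E.
Proof.
move=> Hf M0 sN sdp cM del0 gap1 gap2 t0 tgt.
pose kap := Num.min (2^-1 : R) ((s - d%:R / p) / 2).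
have kap0 : 0 < kap by rewrite /kap lt_min !divr_gt0// invr_gt0 ltr0n.
have kap12 : kap <= 2^-1 by rewrite ge_min lexx.
have kaps : 2 * kap * p <= s * p - d%:R.
  have -> : s * p - d%:R = (s - d%:R / p) * p by rewrite mulrBl divfK ?gt_eqF.
  rewrite ler_wpM2r ?(ltW p0)//.
  have : kap <= (s - d%:R / p) / 2 by rewrite ge_min lexx orbT.
  lra.
have [CK CK0 HCK] := tame_diff_le W p1 n.
have CL0 := layer_cst_ge0 W; have S1 := wb_S W.
have G0 a : 0 < a -> 0 < (1 - e2 (- a))^-1 :> R.
  by move=> a0; rewrite invr_gt0 subr_gt0 e2_lt1 oppr_lt0.
have Gk0 := G0 _ kap0; have Gkp0 := G0 _ (mulr_gt0 kap0 p0).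
set G := (1 - e2 (- kap))^-1 in HCK Gk0; set Gp := (1 - _)^-1 in Gkp0.
pose A := 4 * (G * layer_cst d S B).
have A0 : 0 <= A by apply: mulr_ge0 => //; apply: mulr_ge0 => //; exact: ltW.
have m0 : 0 < m.+1%:R^-1 :> R by rewrite invr_gt0.
pose k0 := m.+1%:R^-1 / (4 * (CK * A + 1)).
have CKA : 0 <= CK * A by rewrite mulr_ge0// ltW.
have k00 : 0 < k0 by rewrite divr_gt0// mulr_gt0// ltr_wpDl.
(* The part of r ^ (h + e) coming from the summand 2 in the exponent of r. *)
pose Z := e2 (- (2 * (h + e))) : R; have Z0 : 0 < Z := e2_gt0 _.
have B0 := wb_B W.
have CB0 : 0 <= CK * (B * `|c0|) by rewrite mulr_ge0 ?(ltW CK0)// mulr_ge0// ltW.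
have [ja Hja] : exists n0, forall j, (n0 <= j)%N ->
    e2 (- (N.+1%:R - (1 + del) * (h + e)) * j%:R) <=
      m.+1%:R^-1 * Z / (4 * (CK * (B * `|c0|) + 1)).
  apply: e2_small; first by rewrite subr_gt0.
  by apply: divr_gt0; rewrite mulr_gt0// ltr_wpDl.
have [jb Hjb] : exists n0, forall j, (n0 <= j)%N ->
    e2 (- (h - e + del * n%:R - (1 + del) * (h + e)) * j%:R) <=
      m.+1%:R^-1 * Z / (4 * (CK * m.+1%:R)).
  apply: e2_small; first by rewrite subr_gt0.
  by apply: divr_gt0; rewrite !mulr_gt0 ?ltr0n.
have [jc Hjc] : exists n0, forall j, (n0 <= j)%N -> e2 (- del * j%:R) <= n.+1%:R^-1 :> R.
  by apply: e2_small => //; rewrite invr_gt0.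
have [jd Hjd] : exists n0, forall j, (n0 <= j)%N -> e2 (- 1 * j%:R) <= m.+1%:R^-1 :> R.
  by apply: e2_small => //; exact: ltr01.
have K0 : 0 < 2 * Gp * (2 * S + 5) ^+ d * M.
  by rewrite !mulr_gt0// exprn_gt0//; lra.
have kp0 : 0 < k0 `^ p by rewrite powR_gt0.
apply: (@packing_premeasure_eq0 R V _ ((1 + del) * (h + e) * p - (s * p - d%:R)) t
   (2 * Gp * (2 * S + 5) ^+ d * M * (k0 `^ p)^-1 * e2 (2 * (h + e) * p))
   (maxn (maxn ja jb) (maxn jc jd))) => //.
  by apply: mulr_gt0; [apply: mulr_gt0 => //; rewrite invr_gt0|exact: e2_gt0].
move=> j l; rewrite !geq_max => /andP[/andP[/Hja ta /Hjb tb] /andP[/Hjc tc /Hjd td]] lF lsep.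
have j0 : (0 : R) <= j%:R by [].
pose r : R := e2 (- ((1 + del) * j%:R + 2)).
pose T : R := e2 (del * j%:R).
pose eta := k0 * r `^ (h + e).
have r0 : 0 < r := e2_gt0 _.
have rhe0 : 0 < r `^ (h + e) by rewrite powR_gt0.
have rhE : r `^ (h + e) = Z * e2 (- ((1 + del) * (h + e)) * j%:R).
  by rewrite /r /Z -e2M -e2D; congr e2; ring.
have eta0 : 0 < eta by rewrite mulr_gt0.
have n1 : (0 : R) < n.+1%:R by [].
have nT : n.+1%:R <= T.
  rewrite -[leRHS]invrK -e2N -[leLHS]invrK lef_pV2 ?posrE ?invr_gt0 ?e2_gt0//.
  by rewrite -mulNr.
have T0 : 0 < T := e2_gt0 _.
have quarter : e2 (- 2) = 4^-1 :> R.
  by rewrite e2N (e2_nat R 2) -natrX.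
have Tr : T * r = e2 (- j%:R) / 4.
  rewrite /T /r -e2D -quarter -e2D; congr e2; ring.
have rle : r <= e2 (- j%:R) / 4.
  rewrite /r -quarter -e2D ler_e2.
  have : 0 <= del * j%:R by rewrite mulr_ge0// ltW.
  lra.
have rho0 : 0 < e2 (- j%:R) :> R := e2_gt0 _.
rewrite mulN1r in td.
have rlt : r < e2 (- j%:R) / 2.
  by apply: (le_lt_trans rle); rewrite ltr_pM2l// ltf_pV2 ?posrE// ltr_nat.
have rlt1 : r < e2 (- j%:R).
  by apply: (lt_le_trans rlt); rewrite ler_pdivrMr// ler_peMr ?ler1n// ltW.
have nt x : x \in l -> ~ tame N S p c kap eta j x.
  move=> xl Hx; have Fx := lF x xl.
  have [_ HI] := Fx.
  have [|u [ur [y [Dy]]]] := HI r; first by rewrite r0/= (lt_le_trans _ td).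
  have T1 : 1 <= T by rewrite (le_trans _ nT)// ler1n.
  have nT' : n%:R <= T by rewrite (le_trans _ nT)// ler_nat.
  have Tr' : T * r <= e2 (- j%:R) / 2 by rewrite Tr ler_pM2l// lef_pV2 ?posrE// ler_nat.
  have H1 := HCK c0 c f kap eta h e m j x T r u y Hf kap0 (ltW eta0) Hx td T1 nT' Tr' r0
    rlt Fx ur Dy.
  move=> /le_trans /(_ H1); apply/negP; rewrite -ltNge.
  pose L := m.+1%:R^-1 * r `^ (h + e).
  have L0 : 0 < L by rewrite mulr_gt0.
  have LE : L = m.+1%:R^-1 * Z * e2 (- ((1 + del) * (h + e)) * j%:R).
    by rewrite /L rhE mulrA.
  have q4 (X Y : R) : 0 <= X -> 0 <= Y -> Y * (4 * (X + 1)) <= L -> X * Y <= L / 4.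
    move=> X0 Y0 H; rewrite ler_pdivlMr//; apply: le_trans H.
    have -> : Y * (4 * (X + 1)) = X * Y * 4 + Y * 4 by ring.
    by rewrite lerDl mulr_ge0.
  have P1 : CK * (B * `|c0|) * e2 (- (N.+1%:R * j%:R)) <= L / 4.
    apply: q4; [exact: CB0|exact: e2_ge0|].
    move: ta; rewrite -/Z ler_pdivlMr; last by rewrite mulr_gt0// ltr_wpDl.
    move=> ta; have ta' := ler_wpM2r (e2_ge0 (- ((1 + del) * (h + e)) * j%:R)) ta.
    rewrite LE; apply: le_trans ta'.
    rewrite [leRHS]mulrAC -e2D le_eqVlt; apply/orP; left; apply/eqP.
    by congr (e2 _ * _); ring.
  have P2 : CK * A * eta <= L / 4.
    apply: q4 => //; first exact: ltW.
    rewrite /eta /k0 /L; set X := 4 * _.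
    have X0 : X != 0 by rewrite gt_eqF// mulr_gt0// ltr_wpDl.
    by rewrite mulrAC divfK.
  have P3 : CK * (m.+1%:R * e2 (- j%:R) `^ (h - e) / T ^+ n) <= L / 4.
    have Tn : T ^+ n = e2 (del * n%:R * j%:R) by rewrite /T e2_exp; congr e2; ring.
    rewrite Tn -e2M -mulrA -e2B.
    have X0 : 0 < 4 * (CK * m.+1%:R) by rewrite !mulr_gt0.
    move: tb; rewrite ler_pdivlMr// => tb.
    have tb' := ler_wpM2r (e2_ge0 (- ((1 + del) * (h + e)) * j%:R)) tb.
    rewrite ler_pdivlMr// LE; apply: le_trans tb'.
    have EE : e2 (- (h - e + del * n%:R - (1 + del) * (h + e)) * j%:R) *
        e2 (- ((1 + del) * (h + e)) * j%:R) =
        e2 (- j%:R * (h - e) - del * n%:R * j%:R) by rewrite -e2D; congr e2; ring.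
    rewrite [leRHS]mulrAC EE.
    rewrite le_eqVlt; apply/orP; left; apply/eqP; ring.
  rewrite -/L; apply: (@le_lt_trans _ _ (L / 4 + L / 4 + L / 4)); last by lra.
  rewrite -/A mulrDr mulrDr; apply: lerD P3; apply: lerD; last by rewrite mulrA.
  by rewrite mulrA.
have kk : 0 < kap <= 2^-1 by rewrite kap0.
have := count_not_tame W p1 sN kk kaps eta0 M0 cM lsep nt.
rewrite -/Gp; move=> /le_trans; apply.
have -> : (eta `^ p)^-1 = (k0 `^ p)^-1 * e2 (2 * (h + e) * p) * e2 ((1 + del) * (h + e) * p * j%:R).
  rewrite /eta powRM ?(ltW k00) ?(ltW rhe0)// invfM -mulrA -e2D; congr (_ * _).
  by rewrite -powRrM /r -e2M -e2N; congr e2; ring.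
have EE : e2 ((1 + del) * (h + e) * p * j%:R) * e2 (- (s * p - d%:R) * j%:R) =
    e2 (((1 + del) * (h + e) * p - (s * p - d%:R)) * j%:R).
  by rewrite -e2D; congr e2; ring.
rewrite -EE le_eqVlt; apply/orP; left; apply/eqP.
move: ((_ + _) ^+ d) (k0 `^ p)^-1 (e2 _) (e2 _) (e2 _) => x1 x2 x3 x4 x5; ring.
Qed.

End packing_upper_bound_conclusion.

Section packing_dim_E_HR.
Context (R : realType) (d : nat) (N : nat).
Local Notation V := ('rV[R]_d).

Lemma dimension_ge0 (s p h : R) : 0 < p -> s - d%:R / p <= h ->
  0 <= d%:R + (h - s) * p.
Proof.
move=> p0 hs; have : (s - d%:R / p) * p <= h * p by rewrite ler_pM2r.
rewrite mulrBl divfK ?gt_eqF//; lra.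
Qed.

Lemma packing_dim_E_HR_le (phi : V -> R) (psi : 'I_(2 ^ d).-1 -> V -> R) (S B s p h : R)
    (q : \bar R) (f : V -> R) :
  wavelet_bounds N phi psi S B -> 1 <= p -> (1 <= q)%E -> s <= N%:R ->
  0 < s - d%:R / p -> besov phi psi s p q f -> s - d%:R / p <= h <= s ->
  (packing_dim (E_HR h f) <= (d%:R + (h - s) * p)%:E)%E.
Proof.
move=> W p1 q1 sN sdp fB /andP[hs1 hs2].
have p0 : 0 < p by exact: lt_le_trans p1.
have h0 : 0 < h by exact: lt_le_trans hs1.
have [c0 [M [c [M0 cM Hf]]]] := besovP p1 q1 fB.
have [C C0 gC] := wavelet_layer_le W p1 M0 cM.
have cf := continuous_wavelet_sum W sdp C0 gC Hf.
have D0 := dimension_ge0 p0 hs1.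
apply/lee_addgt0Pr => tau tau0; rewrite -EFinD.
pose n := (Num.truncn h).+1; pose gam := n%:R - h.
have gam0 : 0 < gam by rewrite subr_gt0 truncnS_gt.
have gam1 : gam <= 1.
  have /andP[] := truncn_itv (ltW h0); rewrite /gam /n -natr1; lra.
have h1 : 0 < h + 1 by rewrite addr_gt0.
(* The first bound keeps (1 + del) (h + e) below h + 1, hence below N + 1; the second keeps the loss
   in the dimension below tau. *)
pose del := Num.min ((2 * (h + 1))^-1) (tau / (2 * p * (h + 1))).
have del0 : 0 < del 
  by rewrite lt_min invr_gt0 mulr_gt0// divr_gt0// !mulr_gt0.
have delA : del * (h + 1) <= 2^-1.
  have : del <= (2 * (h + 1))^-1 by rewrite ge_min lexx.
  by rewrite invfM ler_pdivlMr.
have delB : del * (h + 1) * p <= tau / 2.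
  have : del <= tau / (2 * p * (h + 1)) by rewrite ge_min lexx orbT.
  rewrite ler_pdivlMr ?mulr_gt0//; lra.
have del1 : del <= 2^-1 by apply: le_trans delA; rewrite ler_peMr ?(ltW del0)//; lra.
(* With this e the required gap 2 e + del e < del (n - h) = 4 e holds, as del <= 1/2. *)
pose e := del * gam / 4.
have e0 : 0 < e by rewrite divr_gt0// mulr_gt0.
have e1 : 4 * e <= del.
  rewrite /e mulrCA mulfV// mulr1 ler_piMr// ltW//.
have e4 : 4 * e = del * gam by rewrite /e; field.
have de : del * e <= 2^-1 * e by rewrite ler_wpM2r// ltW.
apply: (@packing_dim_le R V _ (regular_irregular n h e f)).
- by rewrite addr_ge0// ltW.
- apply: E_HR_cover => //; rewrite -/n.
  have : e <= gam by rewrite /e; nra.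
  rewrite /gam; lra.
- move=> m; apply: (packing_regular_irregular W p1 m Hf M0 sN sdp cM del0).
  + have := e4; rewrite /gam mulrBr => e4'.
    rewrite mulrDl mul1r mulrDr; lra.
  + rewrite -natr1 mulrDl mul1r mulrDr; move: delA; rewrite mulrDr mulr1; lra.
  + by rewrite addr_ge0// ltW.
  + have : (del * h + e + del * e) * p <= del * (h + 1) * p.
      by rewrite ler_wpM2r ?(ltW p0)// mulrDr mulr1; lra.
    rewrite (_ : (1 + del) * (h + e) * p = h * p + (del * h + e + del * e) * p); last by ring.
    move: delB; move: ((_ + _) * p) => X; lra.
Qed.

End packing_dim_E_HR.

(** * The saturating function *)

Section mixed_radix.
Context (R : realType).

(* Generation m + 1 of the construction refines generation m by m + 4 binary
   digits: the blocks get longer, but stay negligible compared with jj m. *)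
Fixpoint jj (m : nat) : nat := if m is m'.+1 then (jj m' + (m' + 4))%N else 0%N.

Lemma jjS m : jj m.+1 = (jj m + (m + 4))%N. Proof. by []. Qed.

Lemma jj_le m n : (m <= n)%N -> (jj m <= jj n)%N.
Proof.
elim: n => [|n IH]; first by rewrite leqn0 => /eqP->.
rewrite leq_eqVlt => /predU1P[->//|]; rewrite ltnS => /IH H.
by rewrite jjS (leq_trans H)// leq_addr.
Qed.

Lemma jj_lt m n : (m < n)%N -> (jj m + (m + 4) <= jj n)%N.
Proof. exact: (@jj_le m.+1 n). Qed.

Lemma leq_jj m : (m <= jj m)%N.
Proof. by elim: m => // m IH; rewrite jjS; lia. Qed.

Lemma jj_inj m n : jj m = jj n -> m = n.
Proof.
by move=> e; have [H|H|//] := ltngtP m n; have := jj_lt H; lia.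
Qed.

Lemma jj_sqr m : (m * m <= 2 * jj m)%N.
Proof. by elim: m => // m IH; rewrite jjS; nia. Qed.

(** [jj] grows quadratically, so losses linear in m change no exponent; the constant comes from
    completing the square. *)
Lemma linear_le_jj (K e : R) : 0 < e -> exists C : R, forall m : nat,
  K * m%:R <= e * (jj m)%:R + C.
Proof.
move=> e0; exists (K ^+ 2 / (2 * e)) => m.
have H : m%:R * m%:R <= 2 * (jj m)%:R :> R by rewrite -natrM -natrM ler_nat jj_sqr.
have H2 : e * (m%:R * m%:R) <= e * (2 * (jj m)%:R) by rewrite ler_wpM2l// ltW.
have : 0 <= (e * m%:R - K) ^+ 2 / (2 * e) by rewrite divr_ge0 ?sqr_ge0// mulr_ge0// ltW.
have -> : (e * m%:R - K) ^+ 2 / (2 * e) =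
    e * (m%:R * m%:R) / 2 - K * m%:R + K ^+ 2 / (2 * e) by field; rewrite gt_eqF.
lra.
Qed.

Lemma jjS_le (e : R) : 0 < e -> exists C : R, forall m : nat,
  (jj m.+1)%:R <= (1 + e) * (jj m)%:R + C.
Proof.
move=> e0; have [C HC] := @linear_le_jj 1 e e0; exists (C + 4) => m.
by have := HC m; rewrite jjS natrD natrD; lra.
Qed.

Lemma sum_nat_mul (V : nmodType) (F : nat -> V) a b :
  \sum_(0 <= k < a * b) F k = \sum_(0 <= q < a) \sum_(0 <= r < b) F (q * b + r)%N.
Proof.
elim: a => [|a IH]; first by rewrite !big_geq.
rewrite big_nat_recr//= -IH mulSn addnC (big_cat_nat (leq0n _) (leq_addr b _))/=.
congr (_ + _); rewrite -{1}[(a * b)%N]add0n big_addn addKn.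
by apply: eq_bigr => r _; rewrite addnC.
Qed.

(* A mixture of probability weights on the blocks of m + 4 digits: the l-th one
   is uniform on the blocks whose last m + 4 - l digits vanish. *)
Definition block_weight (m b : nat) : R :=
  (m + 5)%:R^-1 * \sum_(0 <= l < m + 5)
     if (2 ^ (m + 4 - l) %| b)%N then e2 (- l%:R) else 0.

Fixpoint weight (m k : nat) : R :=
  if m is m'.+1 then
    weight m' (k %/ 2 ^ (m' + 4)) * block_weight m' (k %% 2 ^ (m' + 4))
  else 1.

Lemma block_weight_ge0 m b : 0 <= block_weight m b.
Proof.
rewrite mulr_ge0// sumr_ge0// => l _; case: ifP => // _; exact: e2_ge0.
Qed.

Lemma weight_ge0 m k : 0 <= weight m k.
Proof.
by elim: m k => [|m IH] k /=; [exact: ler01|rewrite mulr_ge0// block_weight_ge0].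
Qed.

Lemma block_weight_le1 m b : block_weight m b <= 1.
Proof.
rewrite /block_weight mulrC ler_pdivrMr ?mul1r; last by rewrite ltr0n addnS.
apply: (@le_trans _ _ (\sum_(0 <= l < m + 5) 1)).
  by apply: ler_sum => l _; case: ifP => // _; rewrite e2_le1 oppr_le0.
by rewrite big_mkord sumr_const card_ord.
Qed.

(** For each l there are 2 ^ l multiples of 2 ^ (m + 4 - l) below 2 ^ (m + 4), and each receives 2 ^
    -l. *)
Lemma sum_block_weight m : \sum_(0 <= b < 2 ^ (m + 4)) block_weight m b = 1.
Proof.
rewrite -mulr_sumr exchange_big/= (eq_big_nat _ _ (F2 := fun=> 1)); last first.
  move=> l /andP[_ lm].
  have -> : (2 ^ (m + 4) = 2 ^ l * 2 ^ (m + 4 - l))%N.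
    by rewrite -expnD subnKC//; lia.
  rewrite sum_nat_mul.
  rewrite (eq_bigr (fun=> e2 (- l%:R))).
    rewrite big_mkord sumr_const card_ord -[LHS]mulr_natl natrX -e2_nat -e2D addrN e2_0//.
  move=> q _; have p2 : (0 < 2 ^ (m + 4 - l))%N by rewrite expn_gt0.
  rewrite big_ltn// addn0 dvdn_mull// big_nat big1 ?addr0// => r /andP[r0 r1].
  by rewrite dvdn_addr ?dvdn_mull// gtnNdvd.
rewrite big_mkord sumr_const card_ord mulVf// pnatr_eq0 addnS//.
Qed.

Lemma sum_weight m : \sum_(0 <= k < 2 ^ jj m) weight m k = 1.
Proof.
elim: m => [|m IH]; first by rewrite big_nat1.
rewrite jjS expnD sum_nat_mul -[RHS]IH; apply: eq_bigr => q _.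
rewrite (eq_big_nat _ _ (F2 := fun r => weight m q * block_weight m r)); last first.
  move=> r /andP[_ r1] /=.
  by rewrite divnMDl ?expn_gt0// divn_small// addn0 modnMDl modn_small.
by rewrite -mulr_sumr sum_block_weight mulr1.
Qed.

(** Block weights are at most 1, so weights decrease along descendants. This controls the finer
    wavelets near a point by the weight of its own cell. *)
Lemma weight_ancestor m n k : (m <= n)%N ->
  weight n k <= weight m (k %/ 2 ^ (jj n - jj m)).
Proof.
elim: n k => [|n IH] k; first by rewrite leqn0 => /eqP->; rewrite subnn expn0 divn1.
rewrite leq_eqVlt => /predU1P[->|]; first by rewrite subnn expn0 divn1.
rewrite ltnS => mn.
rewrite [leLHS]/=; apply: (@le_trans _ _ (weight n (k %/ 2 ^ (n + 4)))).
  by rewrite ler_piMr ?weight_ge0// block_weight_le1.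
apply: (le_trans (IH _ mn)); rewrite -divnMA -expnD jjS.
by rewrite (_ : (n + 4 + (jj n - jj m) = jj n + (n + 4) - jj m)%N)//; have := jj_le mn; lia.
Qed.

(* The block of m + 4 digits 1 0 t 1 0 .. 0, where t has a digits. *)
Definition block (m a t : nat) : nat := 2 ^ (m.+1 - a) * (2 ^ (a + 2) + (2 * t).+1).

(** The leading digits 1 0 place the block between 1/2 and 3/4 of 2 ^ (m + 4), which keeps coded
    points away from the boundary of their cell and from its quarter point. *)
Lemma block_bounds m a t : (a <= m.+1)%N -> (t < 2 ^ a)%N ->
  (2 ^ (m + 3) <= block m a t)%N /\ ((block m a t).+1 <= 3 * 2 ^ (m + 2))%N.
Proof.
move=> am ta; rewrite /block.
have -> : (2 ^ (m + 3) = 2 ^ (m.+1 - a) * 2 ^ (a + 2))%N by rewrite -expnD; congr expn; lia.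
have -> : (3 * 2 ^ (m + 2) = 2 ^ (m.+1 - a) * (3 * 2 ^ (a + 1)))%N.
  by rewrite mulnCA -expnD; congr (_ * 2 ^ _)%N; lia.
have : (0 < 2 ^ (m.+1 - a))%N by rewrite expn_gt0.
rewrite !expnD; move: (2 ^ (m.+1 - a))%N (2 ^ a)%N ta => x y ta x0.
split; first by rewrite leq_mul2l; apply/orP; right; lia.
have : (x * (y * 2 ^ 2 + (2 * t).+1) + x <= x * (3 * (y * 2 ^ 1)))%N.
  by rewrite -mulnSr leq_mul2l; apply/orP; right; lia.
lia.
Qed.

Lemma block_lt m a t : (a <= m.+1)%N -> (t < 2 ^ a)%N -> (block m a t < 2 ^ (m + 4))%N.
Proof.
move=> am ta; have [_ H] := block_bounds am ta.
by rewrite (leq_trans H)// (_ : m + 4 = 2 + (m + 2))%N ?expnD ?leq_mul2r ?orbT//; lia.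
Qed.

(** The block ends with exactly m + 1 - a zeros, so the l-th term of the mixture charges it if and
    only if l >= a + 3. The lower bound keeps the first of these terms, the upper bound sums the
    geometric series. *)
Lemma block_weight_block m a t : (a <= m.+1)%N ->
  (m + 5)%:R^-1 * e2 (- (a + 3)%:R) <= block_weight m (block m a t) <= e2 (- (a + 2)%:R).
Proof.
move=> am.
have dvdE l : (l <= m + 4)%N -> (2 ^ (m + 4 - l) %| block m a t)%N = (a + 3 <= l)%N.
  move=> lm; rewrite /block; apply/idP/idP => [H|al].
    rewrite leqNgt; apply/negP => la.
    have : (2 ^ (m.+1 - a).+1 %| 2 ^ (m.+1 - a) * (2 ^ (a + 2) + (2 * t).+1))%N.
      by apply: dvdn_trans H; rewrite dvdn_exp2l//; lia.
    rewrite expnSr dvdn_pmul2l ?expn_gt0// dvdn2 oddD oddX/= addn2/= oddM/=.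
    by [].
  by apply: dvdn_mulr; rewrite dvdn_exp2l//; lia.
have m5 : (0 : R) < (m + 5)%:R by rewrite ltr0n addnS.
have sumE : \sum_(0 <= l < m + 5)
     (if (2 ^ (m + 4 - l) %| block m a t)%N then e2 (- l%:R) else 0) =
     \sum_(a + 3 <= l < m + 5) e2 (- l%:R) :> R.
  rewrite (@big_cat_nat _ _ _ (a + 3))//=; last by lia.
  rewrite big_nat big1 ?add0r => [|l /andP[_ la]].
    apply: eq_big_nat => l /andP[l1 l2]; have lm : (l <= m + 4)%N by lia.
    by rewrite (dvdE l lm) l1.
  have lm : (l <= m + 4)%N by lia.
  by rewrite (dvdE l lm) leqNgt la.
rewrite /block_weight sumE; apply/andP; split.
  rewrite ler_pM2l ?invr_gt0// big_ltn ?lerDl; last by lia.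
  by rewrite sumr_ge0// => l _; exact: e2_ge0.
rewrite mulrC ler_pdivrMr//.
apply: (@le_trans _ _ (e2 (- (a + 2)%:R))); last by rewrite ler_peMr ?e2_ge0// ler1n addnS.
have := @geometric_sum_le R 1 (a + 3) (m + 5) ltr01.
under eq_bigr do rewrite mulN1r.
move=> /le_trans; apply; rewrite mulN1r.
have -> : (1 - e2 (- 1))^-1 = e2 1 :> R.
  by rewrite e2N (e2_nat R 1) expr1; field.
by rewrite -e2D ler_e2 !natrD; lra.
Qed.

End mixed_radix.

(** * Points with prescribed digit patterns *)

Section coded_points.
Context (R : realType).

(** The index of a cell of generation m in one coordinate: [a] gives the number of free digits in
    each block, [t] their values. *)
Fixpoint code (a t : nat -> nat) (m : nat) : nat :=
  if m is m'.+1 then (code a t m' * 2 ^ (m' + 4) + block m' (a m') (t m'))%N else 0%N.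

Section admissible_code.
Context (a t : nat -> nat) (am : forall m, (a m <= m.+1)%N) (ta : forall m, (t m < 2 ^ a m)%N).

Lemma code_div m : (code a t m.+1 %/ 2 ^ (m + 4) = code a t m)%N.
Proof. by rewrite /= divnMDl ?expn_gt0// divn_small ?addn0// block_lt. Qed.

Lemma code_mod m : (code a t m.+1 %% 2 ^ (m + 4) = block m (a m) (t m))%N.
Proof. by rewrite /= modnMDl modn_small// block_lt. Qed.

Lemma code_lt m : (code a t m < 2 ^ jj m)%N.
Proof.
elim: m => // m IH; rewrite jjS expnD /=.
apply: leq_trans (leq_mul IH (leqnn (2 ^ (m + 4)))).
by rewrite mulSn addnC ltn_add2r block_lt.
Qed.

Lemma weight_codeS m : weight R m.+1 (code a t m.+1) =
  weight R m (code a t m) * block_weight R m (block m (a m) (t m)).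
Proof. by rewrite -(code_div m) -(code_mod m). Qed.

Let lo m : R := ((code a t m)%:R + 2^-1) * e2 (- (jj m)%:R).
Let up m : R := ((code a t m)%:R + 3 / 4) * e2 (- (jj m)%:R).

Let codeS m : ((code a t m.+1)%:R : R) =
  (code a t m)%:R * e2 (m + 4)%:R + (block m (a m) (t m))%:R.
Proof. by rewrite /= natrD natrM natrX -e2_nat. Qed.

Let blockS m : 2^-1 * e2 (m + 4)%:R <= (block m (a m) (t m))%:R :> R /\
   (block m (a m) (t m))%:R + 1 <= 3 / 4 * e2 (m + 4)%:R :> R.
Proof.
have [b1 b2] := block_bounds (am m) (ta m).
rewrite e2_nat (_ : m + 4 = (m + 2).+2)%N; last by lia.
move: b1 b2; rewrite (_ : m + 3 = (m + 2).+1)%N; last by lia.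
rewrite -!(ler_nat R) natrM -natr1 !natrX !exprS; lra.
Qed.

Let e2S m : e2 (- (jj m)%:R) = e2 (m + 4)%:R * e2 (- (jj m.+1)%:R) :> R.
Proof. by rewrite -e2D jjS natrD; congr e2; ring. Qed.

Let lo_le m n : (m <= n)%N -> lo m <= lo n.
Proof.
elim: n => [|n IH]; first by rewrite leqn0 => /eqP->.
rewrite leq_eqVlt => /predU1P[->//|]; rewrite ltnS => /IH /le_trans; apply.
rewrite /lo e2S mulrA ler_wpM2r ?e2_ge0// codeS.
have [] := blockS n; lra.
Qed.

Let up_le m n : (m <= n)%N -> up n <= up m.
Proof.
elim: n => [|n IH]; first by rewrite leqn0 => /eqP->.
rewrite leq_eqVlt => /predU1P[->//|]; rewrite ltnS => /IH; apply: le_trans.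
rewrite /up (e2S n) mulrA ler_wpM2r ?e2_ge0// codeS.
have [] := blockS n; lra.
Qed.

(** By [block_bounds] the intervals from [lo m] to [up m] are nested; the supremum of their left
    ends lies in all of them. *)
Lemma coded_point : exists x : R, forall m,
  (code a t m)%:R + 2^-1 <= e2 (jj m)%:R * x <= (code a t m)%:R + 3 / 4.
Proof.
have lu m n : lo m <= up n.
  apply: (@le_trans _ _ (lo (maxn m n))); first by apply: lo_le; exact: leq_maxl.
  apply: (@le_trans _ _ (up (maxn m n))); last by apply: up_le; exact: leq_maxr.
  by rewrite /lo /up ler_wpM2r ?e2_ge0// lerD2l; lra.
exists (sup (range lo)) => m.
have e2m : 0 < e2 (jj m)%:R :> R := e2_gt0 _.
rewrite mulrC; apply/andP; split.
  rewrite -ler_pdivrMr// -e2N; apply: ub_le_sup; last by exists m.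
  by exists (up 0) => _ [k _ <-].
rewrite -ler_pdivlMr// -e2N; apply: ge_sup; first by exists (lo 0); exists 0%N.
by move=> _ [k _ <-]; exact: lu.
Qed.

End admissible_code.

Lemma code_inj a t t' m : (forall m, (a m <= m.+1)%N) ->
  (forall m, (t m < 2 ^ a m)%N) -> (forall m, (t' m < 2 ^ a m)%N) ->
  code a t m = code a t' m -> forall i, (i < m)%N -> t i = t' i.
Proof.
move=> am ta ta'; elim: m => [//|m IH] e i.
have cm : code a t m = code a t' m by rewrite -(code_div am ta) -(code_div am ta') e.
have bm : block m (a m) (t m) = block m (a m) (t' m).
  by rewrite -(code_mod am ta) -(code_mod am ta') e.
rewrite ltnS leq_eqVlt => /predU1P[->|]; last exact: IH.
move: bm => /eqP; rewrite /block eqn_pmul2l ?expn_gt0// eqn_add2l => /eqP; lia.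
Qed.

(** A share th of the m + 1 available digits of block m is free; with th = beta / d in each
    coordinate, about 2 ^ (beta jj m) cells of generation m are coded. *)
Definition digits (th : R) (m : nat) : nat := Num.truncn (th * m.+1%:R).

Section weight_bounds.
Context (th : R) (th0 : 0 < th) (th1 : th <= 1).

Lemma digits_le m : (digits th m <= m.+1)%N.
Proof.
have : th * m.+1%:R <= m.+1%:R by rewrite ler_piMl.
by move=> /le_truncn; rewrite natrK.
Qed.

Lemma digits_itv m : th * (m + 4)%:R - 4 <= (digits th m)%:R <= th * (m + 4)%:R.
Proof.
have x0 : 0 <= th * m.+1%:R by rewrite mulr_ge0// ltW.
have /andP[H1 H2] := truncn_itv x0.
rewrite -/(digits th m) in H1 H2; rewrite natrD.
have E1 : (digits th m).+1%:R = (digits th m)%:R + 1 :> R by rewrite natr1.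
have E2 : m.+1%:R = m%:R + 1 :> R by rewrite natr1.
rewrite E1 in H2; rewrite !E2 in H1 H2.
move: (m%:R : R) ((digits th m)%:R : R) H1 H2 th0 th1 => x k H1 H2 t0 t1.
by apply/andP; split; lra.
Qed.

Lemma weight_code_le t m : (forall m, (t m < 2 ^ digits th m)%N) ->
  weight R m (code (digits th) t m) <= e2 (- th * (jj m)%:R + 2 * m%:R).
Proof.
move=> ta; elim: m => [|m IH]; first by rewrite /= !mulr0 addr0 e2_0.
rewrite (weight_codeS digits_le ta).
have /andP[_ bw] := block_weight_block R (t m) (digits_le m).
apply: (le_trans (ler_pM (weight_ge0 _ _ _) (block_weight_ge0 _ _ _) IH bw)).
rewrite -e2D ler_e2 jjS -natr1 !natrD.
have /andP[] := digits_itv m; rewrite natrD; lra.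
Qed.

Lemma weight_code_ge e : 0 < e -> exists C : R, forall t m,
  (forall m, (t m < 2 ^ digits th m)%N) ->
  e2 (- (th + e) * (jj m)%:R - C * m%:R) <= weight R m (code (digits th) t m).
Proof.
move=> e0; have [_ /e2_log[c ->] Hc] := succn_le_e2 e0.
exists (c + 3) => t m ta; elim: m => [|m IH]; first by rewrite /= !mulr0 subr0 e2_0.
rewrite (weight_codeS digits_le ta).
have /andP[bw _] := block_weight_block R (t m) (digits_le m).
apply: le_trans (ler_pM (e2_ge0 _) _ IH bw); last by rewrite mulr_ge0 ?e2_ge0// invr_ge0.
have m5 : (m + 5)%:R <= e2 (c + e * (m + 4)%:R) :> R.
  by rewrite e2D (_ : m + 5 = (m + 4).+1)%N ?Hc//; lia.
have m5' : e2 (- (c + e * (m + 4)%:R)) <= (m + 5)%:R^-1 :> R.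
  by rewrite e2N lef_pV2 ?posrE ?e2_gt0// ltr0n addnS.
apply: le_trans (ler_wpM2l (e2_ge0 _) (ler_wpM2r (e2_ge0 _) m5')).
rewrite -!e2D ler_e2 jjS -natr1 !natrD.
have /andP[_] := digits_itv m; rewrite natrD; lra.
Qed.

(** Rounding costs a bounded factor per block and the mixture a factor m + 5; on the logarithmic
    scale all of this is absorbed by [succn_le_e2] and [linear_le_jj]. *)
Lemma weight_code_bounds e : 0 < e -> exists C : R, forall t m,
  (forall m, (t m < 2 ^ digits th m)%N) ->
  e2 (- (th + e) * (jj m)%:R - C) <= weight R m (code (digits th) t m)
    <= e2 (- (th - e) * (jj m)%:R + C).
Proof.
move=> e0; have e20 : 0 < e / 2 by rewrite divr_gt0.
have [C1 HC1] := weight_code_ge e20.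
have [C2 HC2] := linear_le_jj C1 e20; have [C3 HC3] := linear_le_jj 2 e0.
exists (`|C2| + `|C3|) => t m ta; apply/andP; split.
  apply: le_trans (HC1 t m ta); rewrite ler_e2.
  have := HC2 m; have := ler_norm C2; have := normr_ge0 C3; lra.
apply: (le_trans (weight_code_le _ ta)); rewrite ler_e2.
have := HC3 m; have := ler_norm C3; have := normr_ge0 C2; lra.
Qed.

End weight_bounds.

Section binary_digits.
Context (a : nat -> nat) (y : R) (y0 : 0 <= y) (y1 : y < 1).

Definition digit_pos m : nat := \sum_(0 <= i < m) a i.

(** The integer formed by the first [digit_pos m] binary digits of y. [digit_block] cuts these
    digits into blocks of lengths [a m], which serve as the free digits of a coded point. *)
Definition prefix m : nat := Num.truncn (e2 (digit_pos m)%:R * y).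

Definition digit_block m : nat := prefix m.+1 %% 2 ^ a m.

Lemma prefix_div m : (prefix m.+1 %/ 2 ^ a m = prefix m)%N.
Proof.
rewrite {2}/prefix; apply/esym/truncn_def.
set q := (_ %/ _)%N; pose X := e2 (digit_pos m.+1)%:R * y.
have XE : X = (2 ^ a m)%:R * (e2 (digit_pos m)%:R * y).
  by rewrite /X /digit_pos big_nat_recr//= natrD e2D natrX -e2_nat; ring.
have X0 : 0 <= X by rewrite mulr_ge0// e2_ge0.
have p2 : (0 : R) < (2 ^ a m)%:R by rewrite ltr0n expn_gt0.
have /andP[H1 H2] := truncn_itv X0.
apply/andP; split.
  rewrite -(ler_pM2l p2) -XE; apply: le_trans H1; rewrite -natrM ler_nat mulnC.
  exact: leq_divM.
rewrite -(ltr_pM2l p2) -XE; apply: (lt_le_trans H2); rewrite -natrM ler_nat.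
by rewrite mulnC; exact: ltn_ceil (expn_gt0 2 (a m)).
Qed.

Lemma digit_block_lt m : (digit_block m < 2 ^ a m)%N.
Proof. by rewrite ltn_mod expn_gt0. Qed.

Lemma prefix0 : prefix 0 = 0%N.
Proof.
by apply: truncn_def; rewrite /digit_pos big_geq// e2_0 mul1r y0.
Qed.

End binary_digits.

Lemma prefix_eq a (y y' : R) m : 0 <= y < 1 -> 0 <= y' < 1 ->
  (forall i, (i < m)%N -> digit_block a y i = digit_block a y' i) ->
  prefix a y m = prefix a y' m.
Proof.
move=> /andP[y0 y1] /andP[y0' y1']; elim: m => [|m IH] H; first by rewrite !prefix0.
rewrite (divn_eq (prefix a y m.+1) (2 ^ a m)) (divn_eq (prefix a y' m.+1) (2 ^ a m)).
rewrite !prefix_div// IH => [|i im]; last by apply: H; rewrite ltnS ltnW.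
by have := H m (leqnn _); rewrite /digit_block => ->.
Qed.

Lemma prefix_eq_dist a (y y' : R) m : 0 <= y -> 0 <= y' ->
  prefix a y m = prefix a y' m -> `|y - y'| <= e2 (- (digit_pos a m)%:R).
Proof.
move=> y0 y0' e.
have X0 : 0 <= e2 (digit_pos a m)%:R * y by rewrite mulr_ge0// e2_ge0.
have X0' : 0 <= e2 (digit_pos a m)%:R * y' by rewrite mulr_ge0// e2_ge0.
have /andP[] := truncn_itv X0; have /andP[] := truncn_itv X0'.
rewrite -/(prefix a y m) -/(prefix a y' m) e -natr1 => H1 H2 H3 H4.
rewrite e2N -[leRHS]mul1r ler_pdivlMr ?e2_gt0// mulrC.
rewrite -[X in X * _](ger0_norm (e2_ge0 _)) -normrM mulrBr ler_norml; lra.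
Qed.

Lemma digit_pos_ge (th : R) m : 0 < th -> th <= 1 ->
  th * (jj m)%:R - 4 * m%:R <= (digit_pos (digits th) m)%:R.
Proof.
move=> th0 th1; elim: m => [|m IH]; first by rewrite /digit_pos big_geq// !mulr0 subr0.
rewrite /digit_pos big_nat_recr//= -/(digit_pos _ m) !natrD -natr1.
have /andP[+ _] := digits_itv th0 th1 m; rewrite natrD; lra.
Qed.

End coded_points.

Section levels.
Context (A : nat).

(** Partial inverse of m |-> jj m + A; searching up to j is enough because m <= jj m. *)
Definition level (j : nat) : option nat :=
  omap (@nat_of_ord _) [pick m : 'I_j.+1 | jj m + A == j].

Lemma level_jj m : level (jj m + A) = Some m.
Proof.
rewrite /level; case: pickP => [m' /= /eqP|/=].
  by move=> /addIn/jj_inj ->.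
have mj : (m < (jj m + A).+1)%N by have := leq_jj m; lia.
by move=> /(_ (Ordinal mj)); rewrite /= eqxx.
Qed.

Lemma levelE j m : level j = Some m -> j = (jj m + A)%N.
Proof. by rewrite /level; case: pickP => [m' /= /eqP mj [<-]|]. Qed.

End levels.

(** * The saturating coefficients and their Besov norm *)

Section saturating_coefficients.
Context (R : realType) (d : nat) (s p : R) (A : nat).
Hypotheses (p1 : 1 <= p) (A2 : (2 <= A)%N).

Let p0 : 0 < p. Proof. exact: lt_le_trans p1. Qed.

(** Summable, which serves every finite q >= 1, and subexponential, so that no exponent changes. *)
Definition damping (j : nat) : R := j.+1%:R^-1 ^+ 2.

Lemma damping_gt0 j : 0 < damping j.
Proof. by rewrite exprn_gt0// invr_gt0. Qed.

Lemma damping_le1 j : damping j <= 1.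
Proof. by rewrite exprn_ile1// ?invr_ge0// invf_le1// ler1n. Qed.

Lemma damping_le i j : (i <= j)%N -> damping j <= damping i.
Proof.
move=> ij; rewrite lerXn2r ?nnegrE ?invr_ge0//.
by rewrite lef_pV2 ?posrE// ler_nat.
Qed.

Lemma sum_damping n : \sum_(0 <= j < n) damping j <= 2.
Proof.
case: n => [|n]; first by rewrite big_geq.
(* Telescoping: the sharper bound 2 - 1 / (n + 1) is what the induction preserves. *)
apply: (@le_trans _ _ (2 - n.+1%:R^-1)); last by rewrite gerBl invr_ge0.
elim: n => [|n IH]; first by rewrite big_nat1 /damping invr1 expr1n; lra.
rewrite big_nat_recr//= (le_trans (lerD IH (lexx _)))// /damping.
have : n.+2%:R = n.+1%:R + 1 :> R by rewrite natr1.
have : 0 < n.+1%:R :> R by [].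
move: (n.+1%:R : R) (n.+2%:R : R) => x y x0 ->.
rewrite -subr_ge0.
have -> : 2 - (x + 1)^-1 - (2 - x^-1 + (x + 1)^-1 ^+ 2) = ((x + 1) ^+ 2 * x)^-1.
  by field; rewrite !gt_eqF// addr_gt0.
by rewrite invr_ge0 mulr_ge0 ?sqr_ge0// ltW.
Qed.

Lemma damping_ge e : 0 < e -> exists C : R, forall j, e2 (- e * j%:R - C) <= damping j.
Proof.
move=> e0; have e20 : 0 < e / 2 by rewrite divr_gt0.
have [_ /e2_log[c ->] Hc] := succn_le_e2 e20; exists (2 * c) => j.
have H : e2 (- (c + e / 2 * j%:R)) <= j.+1%:R^-1 :> R.
  by rewrite e2N lef_pV2 ?posrE ?e2_gt0// e2D.
have := lerXn2r 2 _ _ H; rewrite !nnegrE e2_ge0 invr_ge0 => /(_ isT (ler0n _ _)).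
by rewrite e2_exp (_ : - (c + e / 2 * j%:R) * 2 = - e * j%:R - 2 * c)//; lra.
Qed.

(** Multiples of 2 ^ A shifted by a quarter of 2 ^ A: one position per cell, and [k %/ 2 ^ A] is the
    index of that cell. *)
Definition on_lattice j (k : 'rV['I_(2 ^ j)]_d) : bool :=
  [forall i, (k 0%R i %% 2 ^ A == 2 ^ (A - 2))%N].

Definition cell_weight j (k : 'rV['I_(2 ^ j)]_d) m : R :=
  \prod_i weight R m (k 0%R i %/ 2 ^ A)%N.

(* In each cell of generation m, the first wavelet of scale jj m + A is used once,
   near the point with coordinates 1/4 in the cell; the weights of the cells make
   the sum over the cells independent of m. *)
Definition saturating_coefs : besov_coefs R d := fun j k i =>
  if (val i == 0%N) && on_lattice k then
    if level A j is Some m then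
      e2 (- (s - d%:R / p) * (jj m)%:R) * damping j * cell_weight k m `^ p^-1
    else 0
  else 0.

Lemma cell_weight_ge0 j (k : 'rV['I_(2 ^ j)]_d) m : 0 <= cell_weight k m.
Proof. by apply: prodr_ge0 => i _; exact: weight_ge0. Qed.

Lemma sum_rV_prod n (F : nat -> R) :
  \sum_(k : 'rV['I_n]_d) \prod_i F (k 0 i) = (\sum_(x < n) F x) ^+ d.
Proof.
have -> : (\sum_(x < n) F x) ^+ d = \prod_(i < d) \sum_(x < n) F x.
  by rewrite prodr_const card_ord.
rewrite bigA_distr_bigA/=.
rewrite (reindex (fun f : {ffun 'I_d -> 'I_n} => \row_i f i))/=.
  by apply: eq_bigr => f _; apply: eq_bigr => i _; rewrite mxE.
exists (fun k : 'rV['I_n]_d => [ffun i => k 0 i]).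
  by move=> f _; apply/ffunP => i; rewrite ffunE mxE.
by move=> k _; apply/rowP => i; rewrite mxE ffunE.
Qed.

(** The sum factors over the coordinates, and in each of them exactly one position per cell
    survives. *)
Lemma sum_cell_weight m :
  \sum_(k : 'rV['I_(2 ^ (jj m + A))]_d | on_lattice k) cell_weight k m = 1.
Proof.
pose F x : R := if (x %% 2 ^ A == 2 ^ (A - 2))%N then weight R m (x %/ 2 ^ A)%N else 0.
rewrite big_mkcond/= (eq_bigr (fun k : 'rV['I_(2 ^ (jj m + A))]_d => \prod_i F (k 0 i))).
  rewrite sum_rV_prod -(big_mkord xpredT F) expnD sum_nat_mul.
  rewrite (eq_big_nat _ _ (F2 := weight R m)); first by rewrite sum_weight expr1n.
  move=> q _; rewrite (eq_big_nat _ _ (F2 := fun r =>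
      if r == (2 ^ (A - 2))%N then weight R m q else 0)); last first.
    move=> r /andP[_ rA].
    by rewrite /F modnMDl modn_small// divnMDl ?expn_gt0// divn_small// addn0.
  rewrite (bigD1_seq (2 ^ (A - 2))%N) ?iota_uniq//=; last first.
    by rewrite mem_index_iota/= ltn_exp2l//; lia.
  by rewrite eqxx big1 ?addr0// => r /negbTE->.
move=> k _; case: ifPn => [/forallP kA|/forallPn[i ki]].
  by apply: eq_bigr => i _; rewrite /F kA.
by apply/esym/eqP; rewrite prodf_seq_eq0; apply/hasP; exists i;
  rewrite ?mem_index_enum//= /F (negbTE ki).
Qed.

(** The power p undoes the p-th root of the weights, which then sum to 1. *)
Lemma total_size_saturating j : total_size p saturating_coefs j <=
  if level A j is Some m then e2 (- (s * p - d%:R) * (jj m)%:R) * damping j `^ p else 0.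
Proof.
rewrite /total_size /saturating_coefs; case E : (level A j) => [m|]; last first.
  rewrite big1// => k _; rewrite big1// => i _.
  by rewrite if_same normr0 powR0// gt_eqF.
rewrite (levelE E) => {E}.
apply: (@le_trans _ _ (\sum_(k : 'rV['I_(2 ^ (jj m + A))]_d) if on_lattice k then
   e2 (- (s * p - d%:R) * (jj m)%:R) * damping (jj m + A) `^ p * cell_weight k m else 0)).
  apply: ler_sum => k _; case: ifP => kA; last first.
    by rewrite big1// => i _; rewrite andbF normr0 powR0// gt_eqF.
  under eq_bigr do rewrite andbT.
  set X := _ * _ * _; have X0 : 0 <= X.
    by rewrite !mulr_ge0 ?e2_ge0 ?powR_ge0// ltW// damping_gt0.
  have XE : `|X| `^ p = e2 (- (s * p - d%:R) * (jj m)%:R) * damping (jj m + A) `^ p *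
      cell_weight k m.
    rewrite ger0_norm// /X powRM ?powR_ge0 ?mulr_ge0 ?e2_ge0 ?(ltW (damping_gt0 _))//.
    rewrite powRM ?e2_ge0 ?(ltW (damping_gt0 _))// -powRrM mulVf ?gt_eqF//.
    rewrite powRr1 ?cell_weight_ge0// -e2M; congr (e2 _ * _ * _).
    by field; rewrite gt_eqF.
  rewrite -XE; have Xp : 0 <= `|X| `^ p by exact: powR_ge0.
  case: (2 ^ d).-1 => [|n]; first by rewrite big_ord0.
  rewrite big_ord_recl/= big1 ?addr0//= => i _.
  by rewrite normr0 powR0// gt_eqF.
by rewrite -big_mkcond/= -mulr_sumr sum_cell_weight mulr1.
Qed.

End saturating_coefficients.

Section saturating_function.
Context (R : realType) (d : nat) (N : nat).
Local Notation V := ('rV[R]_d).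
Context (phi : V -> R) (psi : 'I_(2 ^ d).-1 -> V -> R) (S B : R).
Hypothesis W : wavelet_bounds N phi psi S B.
Context (s p : R) (A : nat) (p1 : 1 <= p) (sdp : 0 < s - d%:R / p).
Hypotheses (A2 : (2 <= A)%N) (SA : 16 * S <= 2 ^+ A).
Implicit Types (x z : V).

Local Notation sig := (s - d%:R / p).
Local Notation c := (@saturating_coefs R d s p A).

Let p0 : 0 < p. Proof. exact: lt_le_trans p1. Qed.

Let total_le j : total_size p c j <=
  e2 ((s * p - d%:R) * A%:R) * e2 (- (s * p - d%:R) * j%:R) * damping R j `^ p.
Proof.
apply: (le_trans (total_size_saturating d s p1 A2 j)).
case E : (level A j) => [m|]; last by rewrite !mulr_ge0 ?e2_ge0 ?powR_ge0.
rewrite ler_wpM2r ?powR_ge0// -e2D ler_e2 (levelE E) natrD; lra.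
Qed.

Lemma total_size_saturating_le j : total_size p c j <=
  e2 ((s * p - d%:R) * A%:R) * e2 (- (s * p - d%:R) * j%:R).
Proof.
apply: (le_trans (total_le j)); rewrite ler_piMr ?mulr_ge0 ?e2_ge0//.
have e1 : 1 = 1 `^ p :> R by rewrite powR1.
rewrite [leRHS]e1; apply: ge0_ler_powR; rewrite ?nnegrE ?(ltW p0)//.
  exact: ltW (damping_gt0 _ _).
exact: damping_le1.
Qed.

Lemma besov_norm_saturating q : (1 <= q)%E -> (besov_norm s p q c < +oo)%E.
Proof.
move=> q1; pose K : R := e2 ((s * p - d%:R) * A%:R).
have layer_ge0 j : 0 <= besov_layer s p c j.
  by rewrite mulr_ge0 ?powR_ge0//; apply: sumr_ge0 => k _; apply: sumr_ge0 => i _; exact: powR_ge0.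
have layer_le j : besov_layer s p c j <= K * damping R j `^ p.
  have H := ler_wpM2l (e2_ge0 ((s * p - d%:R) * j%:R)) (total_le j).
  apply: (le_trans H); rewrite -/K.
  have E1 : e2 ((s * p - d%:R) * j%:R) * e2 (- (s * p - d%:R) * j%:R) = 1 :> R.
    by rewrite -e2D mulNr subrr e2_0.
  have E2 (a b x y : R) : a * (x * b * y) = a * b * (x * y) by ring.
  by rewrite E2 E1 mul1r.
have pw a j : 0 <= a -> besov_layer s p c j `^ a <= K `^ a * damping R j `^ (p * a).
  move=> a0; rewrite powRrM -powRM ?powR_ge0 ?e2_ge0//.
  apply: ge0_ler_powR => //; rewrite nnegrE; first exact: layer_ge0.
  by apply: mulr_ge0; [exact: e2_ge0|exact: powR_ge0].
case: q q1 => [q| |//] q1; rewrite /besov_norm.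
- have q1' : 1 <= q by rewrite -lee_fin.
  apply: poweR_lty; apply: (@le_lt_trans _ _ (K `^ (q / p) * 2)%:E); last exact: ltry.
  apply: nneseries_le => [j|n]; first by rewrite lee_fin powR_ge0.
  rewrite sumEFin lee_fin; apply: (@le_trans _ _ (\sum_(0 <= j < n) K `^ (q / p) * damping R j)).
    apply: ler_sum => j _; apply: (le_trans (pw _ _ _)).
      by rewrite divr_ge0 ?(ltW p0)// (le_trans ler01).
    rewrite ler_wpM2l ?powR_ge0// mulrCA mulfV ?gt_eqF// mulr1.
    by apply: ge1r_powR => //; rewrite damping_gt0 damping_le1.
  by rewrite -mulr_sumr ler_wpM2l ?powR_ge0// sum_damping.
- apply: (@le_lt_trans _ _ (K `^ p^-1)%:E); last exact: ltry.
  apply: ge_ereal_sup => _ [j _ <-]; rewrite lee_fin.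
  apply: (le_trans (pw _ _ _)); first by rewrite invr_ge0 ltW.
  rewrite mulfV ?gt_eqF// powRr1 ?(ltW (damping_gt0 _ _))//.
  by rewrite ler_piMr ?powR_ge0// damping_le1.
Qed.

Lemma saturating_sum_exists : exists f, is_wavelet_sum phi psi 0 c f.
Proof.
have K0 : 0 < e2 ((s * p - d%:R) * A%:R) :> R := e2_gt0 _.
have [C C0 gC] := wavelet_layer_le W p1 K0 total_size_saturating_le.
suff cv x : cvgn (fun n => 0 * phi x + \sum_(0 <= j < n) wavelet_layer psi c j x).
  exists (fun x => limn (fun n => 0 * phi x + \sum_(0 <= j < n) wavelet_layer psi c j x)).
  by move=> x; exact: cv.
have -> : (fun n => 0 * phi x + \sum_(0 <= j < n) wavelet_layer psi c j x) =
   series (fun j => wavelet_layer psi c j x).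
  by apply/funext => n; rewrite mul0r add0r.
apply: normed_cvg; apply: (@series_le_cvg _ _ (geometric C (e2 (- sig)))) => //.
- by move=> n /=; exact: normr_ge0.
- by move=> n; rewrite /geometric/=; apply: mulr_ge0; [exact: ltW|exact: exprn_ge0 (e2_ge0 _)].
- by move=> n; apply: (le_trans (gC n x)); rewrite /geometric/= e2_exp.
- apply: is_cvg_geometric_series.
  by rewrite ger0_norm ?e2_ge0// e2_lt1 oppr_lt0.
Qed.

(** In units of a cell of generation m the supports have radius S / 2 ^ A <= 1/16 around quarter
    points; this is the origin of the sixteenths below. *)
Lemma lattice_near m (k : 'rV['I_(2 ^ (jj m + A))]_d) z i : on_lattice A k ->
  `|pos R k - 2 ^+ (jj m + A) *: z| <= S ->
  `|(k 0%R i %/ 2 ^ A)%N%:R + 4^-1 - e2 (jj m)%:R * z 0 i| <= 16^-1.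
Proof.
move=> /forallP/(_ i)/eqP kA kz.
have := le_trans (rV_norm_ge _ i) kz; rewrite !mxE.
have p2 : 0 < 2 ^+ A :> R by rewrite exprn_gt0.
have kE : (k 0 i)%:R = 2 ^+ A * ((k 0%R i %/ 2 ^ A)%N%:R + 4^-1) :> R.
  rewrite {1}(divn_eq (k 0 i) (2 ^ A)) kA natrD natrM !natrX mulrDr mulrC; congr (_ + _).
  by rewrite -[in RHS](subnK A2) exprD; field.
rewrite kE exprD -e2_nat [_ * 2 ^+ A]mulrC -mulrA -mulrBr normrM (gtr0_norm p2) => H.
rewrite -(ler_pM2l p2) (le_trans H)//; move: SA; lra.
Qed.

Definition near_cst : R := ((Num.truncn (2 * S)).+1 ^ d * 2 ^ d)%N%:R * B.

Lemma near_cst_ge0 : 0 <= near_cst.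
Proof. by rewrite mulr_ge0// ltW// (wb_B W). Qed.

Lemma layer_near_le (c' : besov_coefs R d) j z w : 0 <= w ->
  (forall k i, `|pos R k - 2 ^+ j *: z| <= S -> `|c' j k i| <= w) ->
  `|wavelet_layer psi c' j z| <= near_cst * w.
Proof.
move=> w0 cw; rewrite /wavelet_layer.
rewrite (bigID (fun k => `|pos R k - 2 ^+ j *: z| <= S))/= [X in _ + X]big1 ?addr0; last first.
  move=> k; rewrite -ltNge => kz; rewrite big1// => i _.
  by rewrite (wb_supp W) ?mulr0// distrC.
rewrite (le_trans (ler_norm_sum _ _ _))//.
apply: (@le_trans _ _ (\sum_(k : 'rV['I_(2 ^ j)]_d | `|pos R k - 2 ^+ j *: z| <= S)
   (2 ^ d)%N%:R * (B * w))).
  apply: ler_sum => k kz; rewrite (le_trans (ler_norm_sum _ _ _))//.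
  apply: (@le_trans _ _ (\sum_(i < (2 ^ d).-1) B * w)).
    apply: ler_sum => i _; rewrite normrM mulrC ler_pM//; first exact: wb_sup W _ _.
    exact: cw.
  rewrite sumr_const card_ord -[leLHS]mulr_natl ler_wpM2r ?mulr_ge0 ?(ltW (wb_B W))//.
  by rewrite ler_nat leq_pred.
rewrite sumr_const -[leLHS]mulr_natl mulrA -natrM /near_cst -mulrA ler_wpM2r//.
  by rewrite mulr_ge0// ltW// (wb_B W).
by rewrite ler_nat leq_mul2r card_pos orbT.
Qed.

Lemma saturating_layer_le m z w : 0 <= w ->
  (forall k : 'rV['I_(2 ^ (jj m + A))]_d, on_lattice A k ->
     `|pos R k - 2 ^+ (jj m + A) *: z| <= S -> cell_weight R A k m <= w) ->
  `|wavelet_layer psi c (jj m + A) z| <=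
    near_cst * (e2 (- sig * (jj m)%:R) * damping R (jj m + A) * w `^ p^-1).
Proof.
move=> w0 cw; have w'0 : 0 <= e2 (- sig * (jj m)%:R) * damping R (jj m + A) * w `^ p^-1.
  by rewrite !mulr_ge0 ?e2_ge0 ?powR_ge0// ltW// damping_gt0.
apply: layer_near_le => // k i kz; rewrite /saturating_coefs level_jj.
case: ifP => [/andP[_ kA]|_]; last by rewrite normr0.
rewrite ger0_norm; last by rewrite !mulr_ge0 ?e2_ge0 ?powR_ge0// ltW// damping_gt0.
rewrite ler_wpM2l ?mulr_ge0 ?e2_ge0 ?(ltW (damping_gt0 _ _))//.
apply: ge0_ler_powR; rewrite ?nnegrE ?cell_weight_ge0 ?invr_ge0 ?(ltW p0)//.
exact: cw.
Qed.

Lemma saturating_layer0 j z : level A j = None -> wavelet_layer psi c j z = 0.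
Proof.
move=> jN; rewrite /wavelet_layer big1// => k _; rewrite big1// => i _.
by rewrite /saturating_coefs jN if_same mul0r.
Qed.

(** The supports lie over the intervals from q + 3/16 to q + 5/16, and one coordinate in a gap
    between two of them is enough to avoid them all. *)
Lemma coarse_layer0 m z (i : 'I_d) (kap : nat) :
  kap%:R + 5 / 16 < e2 (jj m)%:R * z 0 i < kap%:R + 19 / 16 ->
  wavelet_layer psi c (jj m + A) z = 0.
Proof.
move=> /andP[z1 z2]; apply/eqP; rewrite -normr_le0.
apply: le_trans (@saturating_layer_le m z 0 _ _) _ => //; last first.
  by rewrite powR0 ?invr_eq0 ?gt_eqF// !mulr0.
move=> k kA kz; have := lattice_near i kA kz; rewrite ler_norml => /andP[h1 h2].
exfalso; move: h1 h2; set q := (_ %/ _)%N => h1 h2.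
have : (kap < q)%N by rewrite -(ltr_nat R); lra.
have : (q < kap.+1)%N by rewrite -(ltr_nat R) -natr1; lra.
lia.
Qed.

(** Only descendants of the cell [kap] are felt at a point well inside it: the margins 3/16 and 1/8,
    multiplied by 2 ^ (jj n - jj m) >= 16, exceed the distance from the point to the cell felt
    there. *)
Lemma near_ancestor m n (x : R) (q kap : nat) : (m < n)%N ->
  kap%:R + 3 / 16 <= e2 (jj m)%:R * x <= kap%:R + 7 / 8 ->
  `|q%:R + 4^-1 - e2 (jj n)%:R * x| <= 16^-1 ->
  (q %/ 2 ^ (jj n - jj m))%N = kap.
Proof.
move=> mn /andP[x1 x2]; rewrite ler_norml => /andP[h1 h2].
have jmn := jj_lt mn.
pose P := (2 ^ (jj n - jj m))%N.
have P16 : (16 <= P)%N.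
  by rewrite /P (_ : 16 = 2 ^ 4)%N// leq_exp2l//; lia.
have PE : e2 (jj n)%:R * x = P%:R * (e2 (jj m)%:R * x).
  by rewrite mulrA /P natrX -e2_nat -e2D -natrD subnK//; lia.
rewrite PE in h1 h2.
have P16' : 16 <= P%:R :> R by rewrite (ler_nat R 16).
have Px1 := ler_wpM2l (ler0n R P) x1; have Px2 := ler_wpM2l (ler0n R P) x2.
have q1 : (kap * P <= q)%N.
  by rewrite -ltnS -(ltr_nat R) -natr1 natrM; lra.
have q2 : (q < kap.+1 * P)%N.
  by rewrite -(ltr_nat R) natrM -natr1; lra.
apply/eqP; rewrite eqn_leq -ltnS ltn_divLR ?expn_gt0// q2/=.
by rewrite leq_divRL ?expn_gt0.
Qed.

(** Every finer wavelet felt at z has at most the weight of the cell of z, by [near_ancestor] and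
    [weight_ancestor], and the remaining factors form a geometric series of exponent s - d/p. *)
Lemma fine_tail m z (kap : 'I_d -> nat) n :
  (forall i, (kap i)%:R + 3 / 16 <= e2 (jj m)%:R * z 0 i <= (kap i)%:R + 7 / 8) ->
  `|\sum_(jj m.+1 + A <= j < n) wavelet_layer psi c j z| <=
    near_cst * (1 - e2 (- sig))^-1 * e2 (- sig * (jj m.+1)%:R) * damping R (jj m + A) *
    (\prod_i weight R m (kap i)) `^ p^-1.
Proof.
move=> Hz; set P := (\prod_i _) `^ _.
have P0 : 0 <= P by exact: powR_ge0.
have w0 : 0 <= \prod_i weight R m (kap i) by apply: prodr_ge0 => i _; exact: weight_ge0.
have nc0 := near_cst_ge0.
have D0 : 0 < damping R (jj m + A) by exact: damping_gt0.
have K0 : 0 <= near_cst * damping R (jj m + A) * P * e2 (sig * A%:R).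
  apply: mulr_ge0; last exact: e2_ge0.
  by apply: mulr_ge0 => //; apply: mulr_ge0 => //; exact: ltW.
rewrite (le_trans (ler_norm_sum _ _ _))//.
apply: (@le_trans _ _ (\sum_(jj m.+1 + A <= j < n)
   near_cst * damping R (jj m + A) * P * e2 (sig * A%:R) * e2 (- sig * j%:R))).
  apply: ler_sum_nat => j /andP[j1 _].
  case E : (level A j) => [l|]; last first.
    by rewrite saturating_layer0// normr0 mulr_ge0 ?e2_ge0.
  have jE := levelE E; rewrite jE in j1 *.
  have ml : (m < l)%N.
    by rewrite ltnNge; apply/negP => /(@jj_le l m); have := jjS m; lia.
  apply: le_trans (saturating_layer_le w0 _) _.
    move=> k kA kz; rewrite /cell_weight; apply: ler_prod => i _.
    rewrite weight_ge0/=.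
    rewrite -(near_ancestor ml (Hz i) (lattice_near i kA kz)).
    exact: weight_ancestor (ltnW ml).
  rewrite -/P.
  have EE : e2 (sig * A%:R) * e2 (- sig * (jj l + A)%:R) = e2 (- sig * (jj l)%:R) :> R.
    by rewrite -e2D natrD; congr e2; ring.
  have E3 (a b x y w : R) : a * b * x * y * w = a * (y * w * b * x) by ring.
  rewrite E3 EE; apply: ler_wpM2l => //; apply: ler_wpM2r => //.
  apply: ler_wpM2l; first exact: e2_ge0.
  by apply: damping_le; rewrite leq_add2r jj_le// ltnW.
rewrite -mulr_sumr; apply: (le_trans (ler_wpM2l K0 (geometric_sum_le _ _ sdp))).
set G := (_)^-1.
have EE : e2 (sig * A%:R) * e2 (- sig * (jj m.+1 + A)%:R) = e2 (- sig * (jj m.+1)%:R) :> R.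
  by rewrite -e2D natrD; congr e2; ring.
rewrite -EE le_eqVlt; apply/orP; left; apply/eqP; ring.
Qed.

End saturating_function.

(** * Exponents at the coded points *)

Lemma common_bound (a b c d : nat) :
  exists j, [/\ (a <= j)%N, (b <= j)%N, (c <= j)%N & (d <= j)%N].
Proof. by exists (a + b + c + d)%N; split; lia. Qed.

Section exponents.
Context (R : realType) (d : nat).
Local Notation V := ('rV[R]_d).
Implicit Types (x y u z : V) (f : V -> R) (a h : R).

Lemma e2_small1 (z : R) : 0 < z -> exists n0, forall n, (n0 <= n)%N -> e2 (- n%:R) <= z.
Proof.
move=> /(e2_small ltr01)[n0 H]; exists n0 => n /H.
by rewrite mulN1r.
Qed.

(** The Hoelder condition with the zero polynomial, stated pointwise. *)
Definition flat_at f x a := exists C r0 : R, [/\ 0 < C, 0 < r0 &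
  forall r z, 0 < r <= r0 -> ball x r z -> `|f z| <= C * r `^ a].

Lemma flat_holder f x a : 0 < a -> flat_at f x a -> holder_space a x f.
Proof.
move=> a0 [C [r0 [C0 r00 H]]]; exists C, r0, 0; split => //.
  by rewrite mpoly.msize0.
move=> r rr0; apply: Linf_norm_le; first by rewrite mulr_ge0 ?powR_ge0// ltW.
by move=> z zx; rewrite /peval mpoly.meval0 subr0; exact: H zx.
Qed.

Lemma diff_domain_points n u x r y i : diff_domain n u x r y -> (i <= n)%N ->
  ball x r (y + i%:R *: u).
Proof.
move=> Dy; case: n Dy => [|n] Dy ni.
  by move: ni; rewrite leqn0 => /eqP->; rewrite scale0r addr0; exact: diff_domain_center Dy.
have := Dy (i%:R / n.+1%:R); rewrite -[u *+ _]scaler_nat scalerA divfK ?pnatr_eq0//; apply.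
by rewrite divr_ge0//= ler_pdivrMr// mul1r ler_nat.
Qed.

(** An n-th difference combines n + 1 values of f, so it is of order r ^ al, which is negligible
    against r ^ a. *)
Lemma flat_not_irregular f x al a : 0 < a < al -> flat_at f x al -> ~ irregular_space a x f.
Proof.
move=> /andP[a0 aal] [C [r0 [C0 r00 H]]] /irregular_pointwise[C' [r0' [C'0 r0'0 HI]]].
set n := (Num.truncn a).+1 in HI.
have K0 : 0 < C' / (2 * (2 ^+ n * C)) by rewrite divr_gt0// !mulr_gt0.
have [j1 Hj1] : exists n0, forall j, (n0 <= j)%N -> e2 (- (al - a) * j%:R) <= C' / (2 * (2 ^+ n * C)).
  by apply: e2_small => //; rewrite subr_gt0.
have [j2 Hj2] : exists n0, forall j, (n0 <= j)%N -> e2 (- j%:R) <= r0.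
  exact: e2_small1.
have [j3 Hj3] : exists n0, forall j, (n0 <= j)%N -> e2 (- j%:R) <= r0' / 2.
  by apply: e2_small1; rewrite divr_gt0.
have [j [l1 l2 l3 _]] := common_bound j1 j2 j3 0.
have {}Hj1 := Hj1 j l1; have {}Hj2 := Hj2 j l2; have {}Hj3 := Hj3 j l3.
pose r : R := e2 (- j%:R).
have r_gt0 : 0 < r := e2_gt0 _.
have r1 : r <= r0 by exact: Hj2.
have r2 : r < r0'.
  by apply: (@le_lt_trans _ _ (r0' / 2)); [exact: Hj3|rewrite ltr_pdivrMr//; lra].
have [|u [ur [y [Dy]]]] := HI r; first by rewrite r_gt0 r2.
rewrite -[y in finite_diff _ _ _ y]addr0 -(scale0r u) finite_diff_line => Hlo.
have Hup : `|fdiff n (fun t => f (y + t *: u)) 0| <= 2 ^+ n * (C * r `^ al).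
  apply: fdiff_le => i ni; rewrite add0r; apply: H; first by rewrite r_gt0.
  exact: diff_domain_points Dy ni.
have := le_trans Hlo Hup; apply/negP; rewrite -ltNge.
have -> : r `^ al = e2 (- (al - a) * j%:R) * r `^ a.
  by rewrite /r -!e2M -e2D; congr e2; ring.
have ra0 : 0 < r `^ a by rewrite powR_gt0.
move: Hj1; rewrite ler_pdivlMr ?mulr_gt0// ?exprn_gt0// => Hj.
rewrite !mulrA ltr_pM2r//; move: Hj; move: (e2 _) (2 ^+ n) => E F; lra.
Qed.

(* P is small on a ball much larger than the step of the differences, so that its
   n-th differences are negligible although its degree may exceed n. *)
Lemma flat_irregular_not_holder f x al h e : continuous f -> 0 < h -> 0 < e ->
  h + 4 * e <= (Num.truncn h).+1%:R -> h + 2 * e <= al ->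
  flat_at f x (h - e) -> irregular_space (h + e) x f -> ~ holder_space al x f.
Proof.
move=> cf h0 e0 hen hal; have hal' : h - e <= al by lra.
have half : 4^-1 + 4^-1 < 1 :> R by lra.
move=> [C0 [r0 [C00 r00 H0]]] /irregular_pointwise[C' [r0' [C'0 r0'0 HI]]].
move=> /(holder_pointwise cf)[C1 [r1 [P [C10 r10 _ H1]]]].
pose n := (Num.truncn h).+1.
have nE : (Num.truncn (h + e)).+1 = n.
  congr S; apply: truncn_def; have /andP[t1 _] := truncn_itv (ltW h0).
  apply/andP; split; first by lra.
  by apply: lt_le_trans hen; lra.
rewrite nE in HI.
have [CK CK0 HCK] := fdiff_poly_le R (mpoly.msize P) n.
have twon : 0 < 2 ^+ n :> R by rewrite exprn_gt0.
have [ja Hja] : exists n0, forall j, (n0 <= j)%N ->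
    e2 (- (2 * (al - (h + e))) * j%:R) <= e2 (- (2 * (h + e)) + 2 * al) * C' / (4 * (2 ^+ n * C1)).
  apply: e2_small; first by rewrite mulr_gt0//; lra.
  by rewrite divr_gt0// !mulr_gt0 ?e2_gt0.
(* The exponent is positive because n >= h + 4 e: the gain T ^ -n outweighs the fact that the step
   is of the order of the square of the radius. *)
have [jb Hjb] : exists n0, forall j, (n0 <= j)%N ->
    e2 (- (h - e + n%:R - 2 * (h + e)) * j%:R) <= e2 (- (2 * (h + e))) * C' / (4 * (CK * (C0 + C1))).
  apply: e2_small; first by rewrite /n; lra.
  by rewrite divr_gt0// !mulr_gt0 ?e2_gt0// addr_gt0.
have [jc Hjc] : exists n0, forall j, (n0 <= j)%N -> e2 (- j%:R) <= Num.min r0 r1.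
  by apply: e2_small1; rewrite lt_min r00.
have [jd Hjd] : exists n0, forall j, (n0 <= j)%N -> e2 (- j%:R) <= r0'.
  exact: e2_small1.
have [j [la lb lc ld]] := common_bound ja jb jc jd.
move: {Hja}(Hja j la) => Hja.
move: {Hjb}(Hjb j lb) => Hjb.
move: {Hjc}(Hjc j lc) => Hjc.
move: {Hjd}(Hjd j ld) => Hjd.
(* The step r is rho ^ 2 / 4, so a segment T = 1 / rho times longer still fits in the ball of radius
   rho. *)
pose rho : R := e2 (- j%:R); pose T : R := e2 j%:R; pose r : R := e2 (- (2 * j%:R + 2)).
have rho0 : 0 < rho := e2_gt0 _.
have r_gt0 : 0 < r := e2_gt0 _.
have T1 : 1 <= T by rewrite e2_ge1.
have T0 : 0 < T := e2_gt0 _.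
have quarter : e2 (- 2) = 4^-1 :> R by rewrite e2N (e2_nat R 2) -natrX.
have Tr : T * r = rho / 4.
  by rewrite /T /r /rho -quarter -!e2D; congr e2; ring.
have r_le : r <= rho / 4 by rewrite -Tr ler_peMl// ltW.
have rho_r0 : rho <= r0 by rewrite (le_trans Hjc)// ge_min lexx.
have rho_r1 : rho <= r1 by rewrite (le_trans Hjc)// ge_min lexx orbT.
have r_lt : r < rho by apply: (le_lt_trans r_le); rewrite ltr_pdivrMr//; lra.
have [|u [ur [y [Dy]]]] := HI r; first by rewrite r_gt0 (lt_le_trans r_lt).
rewrite -[y in finite_diff _ _ _ y]addr0 -(scale0r u) finite_diff_line => Hlo.
have [q sq qE] := peval_line P y u.
have yx : `|y - x| < r by have := diff_domain_center Dy; rewrite -ball_normE/= distrC.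
have Hup1 : `|fdiff n (fun t => f (y + t *: u) - q.[t]) 0| <= 2 ^+ n * (C1 * r `^ al).
  apply: fdiff_le => i ni; rewrite add0r qE; apply: H1.
    by rewrite r_gt0 (le_trans (ltW r_lt)).
  exact: diff_domain_points Dy ni.
have Hup2 : `|fdiff n (horner q) 0| <= CK * ((C0 + C1) * rho `^ (h - e) / T ^+ n).
  apply: HCK => // t /andP[t0 tT].
  have bt : ball x rho (y + t *: u).
    rewrite -ball_normE/= distrC addrAC (le_lt_trans (ler_normD _ _))//.
    rewrite normrZ ger0_norm//.
    have : t * `|u| <= T * r by rewrite ler_pM.
    rewrite Tr; lra.
  have rr0 : 0 < rho <= r0 by rewrite rho0.
  have rr1 : 0 < rho <= r1 by rewrite rho0.
  have K0 := H0 rho _ rr0 bt.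
  have K1 := H1 rho _ rr1 bt.
  rewrite qE -[peval P _](subKr (f (y + t *: u))) (le_trans (ler_normB _ _))//.
  rewrite mulrDl lerD// (le_trans K1)// ler_wpM2l ?(ltW C10)//.
  apply: ger_powR; last exact: hal'.
  by apply/andP; split; [exact: rho0|rewrite e2_le1 oppr_le0 ler0n].
have fE : fdiff n (fun t => f (y + t *: u)) 0 =
   fdiff n (fun t => f (y + t *: u) - q.[t]) 0 + fdiff n (horner q) 0.
  by rewrite fdiffB; ring.
rewrite {}fE in Hlo; have Htot := le_trans Hlo (le_trans (ler_normD _ _) (lerD Hup1 Hup2)).
have rhE : r `^ (h + e) = e2 (- (2 * (h + e))) * e2 (- (2 * (h + e)) * j%:R).
  by rewrite -e2D /r -[LHS]e2M; congr e2; ring.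
have rh0 : 0 < r `^ (h + e) by rewrite powR_gt0.
have B1 : 2 ^+ n * (C1 * r `^ al) <= C' * r `^ (h + e) / 4.
  move: Hja; rewrite ler_pdivlMr ?mulr_gt0// => Hja.
  have Hm := ler_wpM2r (e2_ge0 (- (2 * al) - 2 * (h + e) * j%:R)) Hja.
  have E1 : e2 (- (2 * al) - 2 * (h + e) * j%:R) * e2 (- (2 * (al - (h + e))) * j%:R) = r `^ al.
    by rewrite -e2D /r -[RHS]e2M; congr e2; ring.
  have E2 : e2 (- (2 * al) - 2 * (h + e) * j%:R) * e2 (- (2 * (h + e)) + 2 * al) = r `^ (h + e).
    by rewrite -e2D /r -[RHS]e2M; congr e2; ring.
  rewrite ler_pdivlMr// -E1 -E2.
  have F1 (t c v w : R) : t * (c * (v * w)) * 4 = w * (4 * (t * c)) * v by ring.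
  have F2 (c v w : R) : c * (v * w) = w * c * v by ring.
  by rewrite F1 [leRHS]F2.
have B2 : CK * ((C0 + C1) * rho `^ (h - e) / T ^+ n) <= C' * r `^ (h + e) / 4.
  have C01 : 0 < C0 + C1 by rewrite addr_gt0.
  move: Hjb; rewrite ler_pdivlMr; last by rewrite !mulr_gt0.
  move=> Hjb.
  have Hm := ler_wpM2r (e2_ge0 (- (2 * (h + e)) * j%:R)) Hjb.
  have E1 : rho `^ (h - e) / T ^+ n = e2 (- (h - e + n%:R - 2 * (h + e)) * j%:R) *
      e2 (- (2 * (h + e)) * j%:R).
    by rewrite -[RHS]e2D /rho /T e2_exp -[X in X / _]e2M -e2N -[LHS]e2D; congr e2; ring.
  rewrite -[X in CK * X]mulrA E1 rhE ler_pdivlMr//.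
  have F1 (t c v w : R) : t * (c * (v * w)) * 4 = v * (4 * (t * c)) * w by ring.
  have F2 (c v w : R) : c * (v * w) = v * c * w by ring.
  by rewrite F1 [leRHS]F2.
have Cr : 0 < C' * r `^ (h + e) by rewrite mulr_gt0.
have := le_trans Htot (lerD B1 B2); apply/negP; rewrite -ltNge.
by rewrite -mulrDr gtr_pMr.
Qed.

(** Flatness bounds both exponents from below and irregularity bounds h^+ from above. The bound h^-
    <= h takes both, since the polynomial in the Hoelder condition is arbitrary. *)
Lemma exponents_eq f x h e0 : continuous f -> 0 < h -> 0 < e0 ->
  (forall a, 0 < a < h -> flat_at f x a) ->
  (forall a, h < a < h + e0 -> irregular_space a x f) ->
  lower_exponent f x = h%:E /\ upper_exponent f x = h%:E.
Proof.
move=> cf h0 e00 Hflat Hirr.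
have hn : h < (Num.truncn h).+1%:R by exact: truncnS_gt.
split; apply/eqP; rewrite eq_le; apply/andP; split.
- apply: ge_ereal_sup => _ [al [al0 Hal] <-]; rewrite lee_fin leNgt; apply/negP => hal.
  pose e := Num.min (Num.min ((al - h) / 2) (e0 / 2)) (Num.min (((Num.truncn h).+1%:R - h) / 4) (h / 2)).
  have eb : [/\ 0 < e, e <= (al - h) / 2, e <= e0 / 2, e <= ((Num.truncn h).+1%:R - h) / 4 & e <= h / 2].
    by rewrite /e !lt_min !ge_min !lexx !orbT !divr_gt0 ?subr_gt0.
  have [ep e1 e2' e3 e4] := eb.
  apply: (@flat_irregular_not_holder f x al h e cf h0 ep) Hal; [lra|lra| |].
    by apply: Hflat; apply/andP; split; lra.
  by apply: Hirr; apply/andP; split; lra.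
- apply/lee_addgt0Pr => e ep; pose a := Num.max (h - e) (h / 2).
  have a0 : 0 < a by rewrite lt_max divr_gt0// orbT.
  have ah : a < h by rewrite gt_max; apply/andP; split; move: h0 ep; lra.
  have : (a%:E <= lower_exponent f x)%E.
    apply: ereal_sup_ubound; exists a => //; split => //; apply: flat_holder => //.
    by apply: Hflat; rewrite a0.
  move=> /(leeD2r e%:E); apply: le_trans; rewrite -EFinD lee_fin.
  by rewrite -lerBlDr le_max lexx.
- apply/lee_addgt0Pr => e ep; pose a := h + Num.min e (e0 / 2).
  have m0 : 0 < Num.min e (e0 / 2) by rewrite lt_min ep divr_gt0.
  have m1 : Num.min e (e0 / 2) <= e by rewrite ge_min lexx.
  have m2 : Num.min e (e0 / 2) <= e0 / 2 by rewrite ge_min lexx orbT.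
  have : (upper_exponent f x <= a%:E)%E.
    apply: ereal_inf_lbound; exists a => //; split; first by rewrite addr_gt0.
    by apply: Hirr; apply/andP; split; rewrite /a; lra.
  by move=> /le_trans; apply; rewrite -EFinD lee_fin lerD2l.
- apply: le_ereal_inf_tmp => _ [a [a0 Ha] <-]; rewrite lee_fin leNgt; apply/negP => ah.
  apply: (@flat_not_irregular f x ((a + h) / 2) a) Ha; first by apply/andP; split; lra.
  by apply: Hflat; apply/andP; split; lra.
Qed.

End exponents.

Section diff_domain_topology.
Context (R : realType) (d : nat).
Local Notation V := ('rV[R]_d).

Lemma diff_domainP n (u x y : V) r :
  ball x r y -> ball x r (y + u *+ n) -> diff_domain n u x r y.
Proof.
rewrite -ball_normE/= => b0 b1 t /andP[t0 t1]; rewrite -ball_normE/=.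
have -> : x - (y + t *: (u *+ n)) = (1 - t) *: (x - y) + t *: (x - (y + u *+ n)).
  by move: (u *+ n) => w; apply/rowP => i; rewrite !mxE; ring.
rewrite (le_lt_trans (ler_normD _ _))// !normrZ (ger0_norm t0) ger0_norm ?subr_ge0//.
have [->|tN] := eqVneq t 1; first by rewrite subrr mul0r add0r mul1r.
have t1' : 0 < 1 - t by rewrite subr_gt0 lt_neqAle tN.
rewrite [ltRHS](_ : r = (1 - t) * r + t * r); last by ring.
rewrite ltr_leD//; first by rewrite ltr_pM2l.
by rewrite ler_wpM2l// ltW.
Qed.

Lemma open_diff_domain n (u x : V) r : open (diff_domain n u x r).
Proof.
have -> : diff_domain n u x r = ball x r `&` (fun y => y + u *+ n) @^-1` ball x r.
  apply/seteqP; split => y; last by move=> [b0 b1]; exact: diff_domainP.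
  move=> Dy; split; first exact: diff_domain_center Dy.
  by have := Dy 1; rewrite lexx ler01 scale1r; exact.
apply: openI; first exact: ball_open.
apply: open_comp; last exact: ball_open.
move=> y _; apply: (@continuousD _ _ _ (fun y : V => y) (fun=> u *+ n)).
  exact: cvg_id.
exact: cst_continuous.
Qed.

Lemma continuous_finite_diff n (u : V) (f : V -> R) : continuous f ->
  continuous (finite_diff n u f).
Proof.
move=> cf; elim: n => [//|n IH].
have -> : finite_diff n.+1 u f = fun y => finite_diff n u f (y + u) - finite_diff n u f y.
  by [].
move=> y; apply: (@continuousB _ _ _ (fun y : V => finite_diff n u f (y + u)) (finite_diff n u f));
  last exact: IH.
apply: (@continuous_comp _ _ _ (fun y : V => y + u) (finite_diff n u f)); last exact: IH.
apply: (@continuousD _ _ _ (fun y : V => y) (fun=> u)); first exact: cvg_id.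
exact: cst_continuous.
Qed.

End diff_domain_topology.

(** * Size and oscillation of the saturating function near a coded point *)

Section coded_exponents.
Context (R : realType) (d : nat) (N : nat).
Local Notation V := ('rV[R]_d).
Context (phi : V -> R) (psi : 'I_(2 ^ d).-1 -> V -> R) (S B : R).
Hypothesis W : wavelet_bounds N phi psi S B.
Context (s p : R) (A : nat) (p1 : 1 <= p) (sdp : 0 < s - d%:R / p).
Hypotheses (A2 : (2 <= A)%N) (SA : 16 * (S + N.+1%:R * (2 * S + 1)) <= 2 ^+ A).
Context (f : V -> R) (Hf : is_wavelet_sum phi psi 0 (@saturating_coefs R d s p A) f).
Context (kap : nat -> 'I_d -> nat) (x0 : V) (id0 : 'I_d).
Hypothesis kap_x0 : forall m i,
  (kap m i)%:R + 2^-1 <= e2 (jj m)%:R * x0 0 i <= (kap m i)%:R + 3 / 4.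
Hypothesis kap_lt : forall m i, (kap m i < 2 ^ jj m)%N.
Context (beta : R).
Local Notation P m := (\prod_i weight R m (kap m i)).
Hypothesis P_bounds : forall e, 0 < e -> exists C : R, forall m,
  e2 (- (beta + e) * (jj m)%:R - C) <= P m <= e2 (- (beta - e) * (jj m)%:R + C).
Local Notation sig := (s - d%:R / p).
Local Notation c := (@saturating_coefs R d s p A).
Local Notation h := (sig + beta / p).
Hypothesis h0 : 0 < h.
Implicit Types (x y z u : V).

Let p0 : 0 < p. Proof. exact: lt_le_trans p1. Qed.

Let S1 : 1 <= S. Proof. exact: wb_S W. Qed.

Let SA' : 16 * S <= 2 ^+ A.
Proof.
apply: le_trans SA; rewrite ler_pM2l// lerDl mulr_ge0//.
by move: S1; lra.
Qed.

Lemma scale_bracket (r : R) : 0 < r < 1 ->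
  exists M, e2 (- (jj M.+1)%:R) <= r < e2 (- (jj M)%:R).
Proof.
move=> /andP[r0 r1]; have ex : exists m, e2 (- (jj m)%:R) <= r.
  have [n Hn] := e2_small1 r0; exists n; apply: le_trans (Hn n _) => //.
  by rewrite ler_e2 lerN2 ler_nat leq_jj.
case: (ex_minnP ex) => -[|M] HM Hmin.
  by move: HM; rewrite /= oppr0 e2_0 leNgt r1.
exists M; rewrite HM ltNge; apply/negP => /Hmin; by rewrite ltnn.
Qed.

Let layers_below M z j : (j < jj M.+1 + A)%N ->
  (forall m, (m <= M)%N -> wavelet_layer psi c (jj m + A) z = 0) ->
  wavelet_layer psi c j z = 0.
Proof.
move=> jM H0; case E : (level A j) => [m|]; last exact: saturating_layer0.
have jE := levelE E; rewrite jE in jM *; apply: H0.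
rewrite leqNgt; apply/negP => Mm; have := @jj_le M.+1 m Mm.
by rewrite leqNgt -(ltn_add2r A) jM.
Qed.

Lemma fine_remainder M z : 
  (forall i, (kap M i)%:R + 3 / 16 <= e2 (jj M)%:R * z 0 i <= (kap M i)%:R + 7 / 8) ->
  `|f z - \sum_(0 <= j < jj M.+1 + A) wavelet_layer psi c j z| <=
    near_cst d S B * (1 - e2 (- sig))^-1 * e2 (- sig * (jj M.+1)%:R) *
    damping R (jj M + A) * P M `^ p^-1.
Proof.
move=> Hz; have Hfz : \sum_(0 <= j < n) wavelet_layer psi c j z @[n --> \oo] --> f z.
  by have := @Hf z; under eq_fun do rewrite mul0r add0r.
apply: (series_tail_le (u := fun n => \sum_(0 <= j < n) wavelet_layer psi c j z)) => // n nM.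
rewrite (big_cat_nat (leq0n _) nM)/= [X in `|X|]addrAC subrr add0r.
exact: (fine_tail W p1 sdp A2 SA' n Hz).
Qed.

(** If 8 r lies between 2 ^ -jj (M + 1) and 2 ^ -jj M, the ball of radius r avoids the wavelets of
    all generations up to M, and the rest is bounded by the weight of the M-th cell. Replacing jj M
    by jj (M + 1) costs a factor close to 1 in the exponent. *)
Lemma coded_flat a : 0 < a < h -> flat_at f x0 a.
Proof.
move=> /andP[a0 ah].
(* The room h - a is shared by the error e on the weight and the error e' on the ratio of successive
   [jj], so that a * (1 + e') = h - e / p. *)
pose e := p * (h - a) / 2.
have e0 : 0 < e by rewrite divr_gt0// mulr_gt0// subr_gt0.
have ep : e / p = (h - a) / 2 by rewrite /e mulrAC [p * _]mulrC mulfK ?gt_eqF.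
pose e' := (h - a) / (2 * a).
have e'0 : 0 < e' by rewrite divr_gt0 ?subr_gt0// mulr_gt0.
have ae' : a * (1 + e') = h - e / p.
  have F (y : R) : a * (1 + (y - a) / (2 * a)) = y - (y - a) / 2.
    by field; rewrite gt_eqF.
  by rewrite ep /e' F.
have [C1 HC1] := P_bounds e0; have [C2 HC2] := jjS_le e'0.
pose K := near_cst d S B * (1 - e2 (- sig))^-1.
have K0 : 0 <= K.
  apply: mulr_ge0; first exact: near_cst_ge0 W.
  by rewrite invr_ge0 subr_ge0 e2_le1 oppr_le0 ltW.
exists (K * e2 (C1 / p + (C2 + 3) * a) + 1), 16^-1; split => //.
  by rewrite ltr_wpDl// mulr_ge0// e2_ge0.
move=> r z /andP[r0 r16] zr.
have eighth : e2 3 = 8 :> R by rewrite (e2_nat R 3) -natrX.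
have r8 : 0 < 8 * r < 1 by rewrite mulr_gt0//=; lra.
have [M /andP[M1 M2]] := scale_bracket r8.
have zx i : `|z 0 i - x0 0 i| < r.
  move: zr; rewrite -ball_normE/= distrC => /le_lt_trans; apply.
  by have := rV_norm_ge (z - x0) i; rewrite !mxE.
(* The point x0 has position 1/2 to 3/4 in its cells and is moved by less than 1/8 of a cell. *)
have zm m i : (m <= M)%N -> (kap m i)%:R + 3 / 8 < e2 (jj m)%:R * z 0 i < (kap m i)%:R + 7 / 8.
  move=> mM; have /andP[k1 k2] := kap_x0 m i.
  have Hd : `|e2 (jj m)%:R * (z 0 i - x0 0 i)| < 8^-1.
    rewrite normrM ger0_norm ?e2_ge0//.
    have H1 : e2 (jj m)%:R <= e2 (jj M)%:R :> R by rewrite ler_e2 ler_nat jj_le.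
    have H2 : e2 (jj M)%:R * (8 * r) < 1.
      by move: M2; rewrite e2N -[_^-1]mul1r ltr_pdivlMr ?e2_gt0// mulrC.
    have H3 : e2 (jj m)%:R * `|z 0 i - x0 0 i| <= e2 (jj M)%:R * r.
      by apply: ler_pM => //; [exact: e2_ge0|exact: ltW].
    by apply: (le_lt_trans H3); move: H2; lra.
  move: Hd; rewrite mulrBr ltr_norml => /andP[d1 d2]; apply/andP; split; lra.
have H0 : \sum_(0 <= j < jj M.+1 + A) wavelet_layer psi c j z = 0.
  rewrite big_nat big1// => j /andP[_ jM]; apply: (layers_below jM) => m mM.
  apply: (coarse_layer0 W p1 sdp A2 SA' (i := id0) (kap := kap m id0)).
  by have /andP[] := zm m id0 mM; move=> z1 z2; apply/andP; split; lra.
have zM i : (kap M i)%:R + 3 / 16 <= e2 (jj M)%:R * z 0 i <= (kap M i)%:R + 7 / 8.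
  by have /andP[z1 z2] := zm M i (leqnn M); apply/andP; split; lra.
have := fine_remainder zM; rewrite H0 subr0 -/K => fz.
have nc0 := near_cst_ge0 W.
have /andP[_ PM] := HC1 M.
have P0 : 0 <= P M by apply: prodr_ge0 => i _; exact: weight_ge0.
have PMp : P M `^ p^-1 <= e2 ((- (beta - e) * (jj M)%:R + C1) / p).
  by rewrite e2M; apply: ge0_ler_powR; rewrite ?nnegrE ?e2_ge0 ?invr_ge0 ?(ltW p0).
apply: (le_trans fz).
apply: (@le_trans _ _ (K * (e2 (- sig * (jj M)%:R) * e2 ((- (beta - e) * (jj M)%:R + C1) / p)))).
  rewrite -!(mulrA K); apply: ler_wpM2l => //; apply: ler_pM => //.
  - by rewrite mulr_ge0 ?e2_ge0 ?ltW ?damping_gt0.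
  - exact: powR_ge0.
  - rewrite -[leRHS]mulr1; apply: ler_pM; rewrite ?e2_ge0 ?damping_le1 ?(ltW (damping_gt0 _ _))//.
    rewrite ler_e2 !mulNr lerN2 ler_pM2l// ler_nat; exact: jj_le.
have M1' : e2 (- ((jj M.+1)%:R + 3)) <= r.
  by rewrite opprD e2D [e2 (- 3)]e2N eighth ler_pdivrMr// mulrC.
have ra : e2 (- ((jj M.+1)%:R + 3) * a) <= r `^ a.
  by rewrite e2M; apply: ge0_ler_powR; rewrite ?nnegrE ?e2_ge0 ?(ltW a0) ?(ltW r0).
apply: le_trans (ler_wpM2l _ ra); last by rewrite addr_ge0// mulr_ge0// e2_ge0.
rewrite [leRHS]mulrDl mul1r; apply: ler_wpDr; first exact: e2_ge0.
rewrite -[leRHS]mulrA; apply: ler_wpM2l => //; rewrite -!e2D ler_e2.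
have jM := HC2 M; have := ler_wpM2l (ltW a0) jM; rewrite mulrDr mulrA ae'.
move: ((jj M.+1)%:R : R) ((jj M)%:R : R) => j1 j2 H.
have -> : (- (beta - e) * j2 + C1) / p = - (beta / p - e / p) * j2 + C1 / p by ring.
by move: (beta / p) (e / p) (C1 / p) H => b1 b2 b3; lra.
Qed.

(** For steps longer than the support of a wavelet: only the starting point of the difference sees
    it. *)
Lemma fdiff_first n (g : R -> R) (t : R) : (forall i, (0 < i <= n)%N -> g (t + i%:R) = 0) ->
  `|fdiff n g t| = `|g t|.
Proof.
elim: n t => [//|n IH] t g0 /=.
have -> : fdiff n g (t + 1) = 0.
  apply/eqP; rewrite -normr_le0 -(mulr0 (2 ^+ n)); apply: fdiff_le => i ni.
  by rewrite -addrA nat1r g0 ?normr0.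
by rewrite sub0r normrN; apply: IH => i /andP[i0 ni]; apply: g0; rewrite i0 leqW.
Qed.

Lemma marked_cell m : exists k : 'rV['I_(2 ^ (jj m + A))]_d,
  forall i, (k 0 i : nat) = (kap m i * 2 ^ A + 2 ^ (A - 2))%N.
Proof.
have lt i : (kap m i * 2 ^ A + 2 ^ (A - 2) < 2 ^ (jj m + A))%N.
  apply: (@leq_trans ((kap m i).+1 * 2 ^ A)).
    by rewrite mulSn addnC ltn_add2r ltn_exp2l//; move: A2; lia.
  by rewrite expnD leq_mul2r kap_lt orbT.
by exists (\row_i Ordinal (lt i)) => i; rewrite mxE.
Qed.

Section own_layer.
Context (m : nat) (k0 : 'rV['I_(2 ^ (jj m + A))]_d).
Hypothesis k0E : forall i, (k0 0 i : nat) = (kap m i * 2 ^ A + 2 ^ (A - 2))%N.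
Context (i0 : 'I_(2 ^ d).-1) (i00 : val i0 = 0%N).

Let off_lt : (2 ^ (A - 2) < 2 ^ A)%N.
Proof. by rewrite ltn_exp2l//; move: A2; lia. Qed.

Let k0_lattice : on_lattice A k0.
Proof. by apply/forallP => i; rewrite k0E modnMDl modn_small. Qed.

Lemma marked_coef : c k0 i0 = e2 (- sig * (jj m)%:R) * damping R (jj m + A) * P m `^ p^-1.
Proof.
rewrite /saturating_coefs i00 eqxx k0_lattice level_jj/=; congr (_ * _ `^ _).
apply: eq_bigr => i _; congr (weight _ _ _).
by rewrite k0E divnMDl ?expn_gt0// divn_small ?addn0.
Qed.

(** Two positions in use differ by at least 2 ^ A in some coordinate, whereas S and the coordinates
    of v are at most 2 ^ A / 16. *)
Lemma own_layer z v : 2 ^+ (jj m + A) *: z = pos R k0 + v ->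
  (forall i, `|v 0 i| <= 2 ^+ A / 16) ->
  wavelet_layer psi c (jj m + A) z = c k0 i0 * psi i0 v.
Proof.
move=> zE vA; have pA : 0 < 2 ^+ A :> R by rewrite exprn_gt0.
have SA16 : S <= 2 ^+ A / 16 by rewrite ler_pdivlMr// mulrC.
rewrite /wavelet_layer (bigD1 k0)//= [X in _ + X]big1 ?addr0; last first.
  move=> k kk0; rewrite big1// => i _; rewrite /saturating_coefs.
  case: ifP => [/andP[_ kA]|_]; last by rewrite mul0r.
  rewrite (wb_supp W) ?mulr0//.
  have [l kl] : exists l, k 0 l != k0 0 l.
    apply/existsP; apply: contraNT kk0 => /existsPn H; apply/eqP/rowP => l.
    by have := H l => /negPn/eqP.
  rewrite zE; apply: lt_le_trans (rV_norm_ge _ l); rewrite !mxE.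
  have kE : (k 0 l : nat) = ((k 0%R l %/ 2 ^ A) * 2 ^ A + 2 ^ (A - 2))%N.
    by rewrite {1}(divn_eq (k 0%R l) (2 ^ A)); move/forallP/(_ l)/eqP: kA => ->.
  have qk : (k 0%R l %/ 2 ^ A)%N != kap m l.
    apply: contra_neq kl => qk; apply/val_inj => /=.
    by rewrite kE k0E qk.
  rewrite kE k0E !natrD !natrM !natrX.
  have := vA l; rewrite ler_norml => /andP[v1 v2].
  have dist : 2 ^+ A <= `|(kap m l)%:R * 2 ^+ A - (k 0%R l %/ 2 ^ A)%N%:R * 2 ^+ A| :> R.
    rewrite -mulrBl normrM (gtr0_norm pA) ler_peMl ?(ltW pA)//.
    move: qk; set q := (_ %/ _)%N; rewrite neq_ltn => /orP[] H.
      have : q%:R + 1 <= (kap m l)%:R :> R by rewrite natr1 ler_nat.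
      by rewrite ler_normr => {}H; apply/orP; left; lra.
    have : (kap m l)%:R + 1 <= q%:R :> R by rewrite natr1 ler_nat.
    by rewrite ler_normr => {}H; apply/orP; right; lra.
  move: dist v1 v2 SA16 pA; move: (2 ^+ A : R) => X.
  move: ((_ %/ _)%N%:R * X) ((kap m l)%:R * X) (2 ^+ (A - 2)) (v 0 l) => b a y w.
  move=> dist v1 v2 SA16 pA.
  have -> : a + y + w - (b + y) = a - b + w by ring.
  move: dist; rewrite ler_normr ltr_normr => /orP[] H; apply/orP; [left|right]; lra.
rewrite (bigD1 i0)//= big1 ?addr0; last first.
  move=> i ii0; rewrite /saturating_coefs; case: ifP => [/andP[/eqP iz _]|_]; last by rewrite mul0r.
  by case/negP: ii0; apply/eqP/val_inj; rewrite iz i00.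
by rewrite zE addrAC subrr add0r.
Qed.

End own_layer.

(** The difference starts at the point y0 of the support of the own wavelet and leaves it at the
    first step, so in the own layer it equals the coefficient times psi y0, up to sign. The choice
    of A leaves room in the cell for N + 1 such steps at distance at most 1/16 from the quarter
    point; there the coarser layers vanish and the finer ones are bounded by [fine_remainder]. *)
Lemma marked_diff (i0 : 'I_(2 ^ d).-1) (y0 : V) m n :
  val i0 = 0%N -> psi i0 y0 != 0 -> (n <= N.+1)%N -> exists u y,
  [/\ `|u| <= e2 (- (jj m)%:R),
      forall t : R, 0 <= t <= n%:R -> `|y + t *: u - x0| < e2 (- (jj m)%:R) &
      e2 (- sig * (jj m)%:R) * damping R (jj m + A) * P m `^ p^-1 * `|psi i0 y0| -
      2 ^+ n * (near_cst d S B * (1 - e2 (- sig))^-1 * e2 (- sig * (jj m.+1)%:R) *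
        damping R (jj m + A) * P m `^ p^-1) <= `|finite_diff n u f y|].
Proof.
move=> i00 y00 nN.
have small1 : 3 / 4 - (4^-1 - 16^-1) < 1 :> R by lra.
have [k0 k0E] := marked_cell m.
(* A step of 2 S + 1 in every coordinate leaves the cube of radius S from any of its points. *)
pose w : V := const_mx (2 * S + 1).
pose E : R := e2 (- (jj m + A)%:R).
pose u := E *: w; pose y := E *: (pos R k0 + y0); pose v (t : R) := y0 + t *: w.
pose z (t : R) := y + t *: u.
have pA : 0 < 2 ^+ A :> R by rewrite exprn_gt0.
have zE t : 2 ^+ (jj m + A) *: z t = pos R k0 + v t.
  have EJ : 2 ^+ (jj m + A) * E = 1 by rewrite -e2_nat /E -e2D addrN e2_0.
  rewrite /z /y /u /v scalerDr !scalerA [_ * t * E]mulrAC EJ mul1r scale1r.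
  by rewrite -addrA.
have y0S : `|y0| <= S.
  rewrite leNgt; apply/negP => /(wb_supp W i0) y0z.
  by rewrite y0z eqxx in y00.
have w0 : 0 <= 2 * S + 1 by move: S1; lra.
have vA t i : 0 <= t <= N.+1%:R -> `|v t 0 i| <= 2 ^+ A / 16.
  move=> /andP[t0 tN]; rewrite !mxE ler_pdivlMr//; apply: le_trans SA.
  rewrite mulrC ler_pM2l// (le_trans (ler_normD _ _))// lerD//.
    exact: le_trans (rV_norm_ge _ _) y0S.
  by rewrite normrM (ger0_norm t0) (ger0_norm w0) ler_wpM2r.
have zc t i : 0 <= t <= N.+1%:R ->
    (kap m i)%:R + 3 / 16 <= e2 (jj m)%:R * z t 0 i <= (kap m i)%:R + 5 / 16.
  move=> tN; have := congr1 (fun M : V => M 0 i) (zE t).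
  have := vA t i tN; rewrite ler_norml => /andP[v1 v2].
  rewrite [X in X = _]mxE [X in _ = X]mxE [X in _ = X + _]mxE k0E natrD natrM !natrX => H.
  have pE : 2 ^+ A = 4 * 2 ^+ (A - 2) :> R by rewrite -{1}(subnK A2) exprD mulrC -natrX.
  have : 2 ^+ A * (e2 (jj m)%:R * z t 0 i) = (kap m i)%:R * 2 ^+ A + 2 ^+ (A - 2) + v t 0 i.
    by rewrite -H exprD -(e2_nat R (jj m)); ring.
  have q0 : 0 < 2 ^+ (A - 2) :> R by rewrite exprn_gt0.
  rewrite pE in v1 v2 *; move: v1 v2 q0.
  move: (2 ^+ (A - 2) : R) (e2 _ * _) ((kap m i)%:R : R) (v t 0 i) => q X k b v1 v2 q0 HX.
  have q4 : 0 < 4 * q by rewrite mulr_gt0.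
  by apply/andP; split; rewrite -(ler_pM2l q4); lra.
have zx t i : 0 <= t <= N.+1%:R -> `|e2 (jj m)%:R * (z t 0 i - x0 0 i)| <= 9 / 16.
  move=> tN; have /andP[z1 z2] := zc t i tN; have /andP[k1 k2] := kap_x0 m i.
  rewrite mulrBr ler_norml; move: z1 z2 k1 k2.
  move: (e2 _ * _) (e2 _ * _) ((kap m i)%:R : R) => a b k z1 z2 k1 k2.
  by apply/andP; split; lra.
have nNR : n%:R <= N.+1%:R :> R by rewrite ler_nat.
have own t : 0 <= t <= N.+1%:R -> wavelet_layer psi c (jj m + A) (z t) = c k0 i0 * psi i0 (v t).
  by move=> tN; apply: (own_layer k0E i00 (zE t)) => i; exact: vA.
have rem t : 0 <= t <= N.+1%:R -> `|f (z t) - wavelet_layer psi c (jj m + A) (z t)| <=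
    near_cst d S B * (1 - e2 (- sig))^-1 * e2 (- sig * (jj m.+1)%:R) *
        damping R (jj m + A) * P m `^ p^-1.
  move=> tN; have Hz i : (kap m i)%:R + 3 / 16 <= e2 (jj m)%:R * z t 0 i <= (kap m i)%:R + 7 / 8.
    have /andP[z1 z2] := zc t i tN; rewrite z1/= (le_trans z2)// lerD2l.
    by move: small1; lra.
  have := fine_remainder Hz.
  have Jm : (jj m + A < jj m.+1 + A)%N by rewrite ltn_add2r jjS -[ltnLHS]addn0 ltn_add2l addnS.
  rewrite (bigD1_seq (jj m + A)%N) ?iota_uniq//=; last by rewrite mem_index_iota.
  rewrite [X in `|_ - (_ + X)|]big1_seq ?addr0// => j /andP[jJ]; rewrite mem_index_iota => /andP[_ jm].
  case El : (level A j) => [l|]; last exact: saturating_layer0.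
  have jE := levelE El; rewrite jE in jJ jm *.
  have lm : (l < m)%N.
    rewrite ltn_neqAle; apply/andP; split; first by apply: contraNneq jJ => ->.
    rewrite leqNgt; apply/negP => /(@jj_le m.+1 l); rewrite leqNgt.
    by rewrite -(ltn_add2r A) jm.
  apply: (coarse_layer0 W p1 sdp A2 SA' (i := id0) (kap := kap l id0)).
  have /andP[k1 k2] := kap_x0 l id0.
  (* Distances at most 9/16 of a cell of generation m are below 1/16 of a coarser cell, so the point
     stays in the gap of that generation. *)
  have Hd : `|e2 (jj l)%:R * (z t 0 id0 - x0 0 id0)| <= 1 / 16.
    have -> : e2 (jj l)%:R * (z t 0 id0 - x0 0 id0) =
        e2 ((jj l)%:R - (jj m)%:R) * (e2 (jj m)%:R * (z t 0 id0 - x0 0 id0)).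
      by rewrite mulrA -e2D subrK.
    rewrite normrM ger0_norm ?e2_ge0//.
    have e4 : e2 ((jj l)%:R - (jj m)%:R) <= 16^-1 :> R.
      have -> : 16^-1 = e2 (- 4) :> R by rewrite e2N (e2_nat R 4) -natrX.
      rewrite ler_e2 lerBlDr.
      have : (jj l)%:R + 4 <= (jj m)%:R :> R.
        rewrite -natrD ler_nat; apply: leq_trans (jj_lt lm).
        by rewrite leq_add2l leq_addl.
      by move=> {}Hl; move: Hl; lra.
    rewrite mul1r -[leRHS]mulr1; apply: ler_pM => //; first exact: e2_ge0.
    by apply: le_trans (zx t id0 tN) _; rewrite ler_pdivrMr// mul1r ler_nat.
  move: Hd; rewrite mulrBr ler_norml => /andP[d1 d2].
  move: k1 k2 d1 d2; move: (e2 _ * _) (e2 _ * _) ((kap l id0)%:R : R) => a b k k1 k2 d1 d2.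
  by apply/andP; split; lra.
exists u, y; split.
- apply: rV_norm_le => [|i]; first exact: e2_ge0.
  rewrite !mxE normrM ger0_norm ?e2_ge0// (ger0_norm w0) /E natrD opprD e2D -mulrA.
  rewrite ler_piMr ?e2_ge0// e2N mulrC ler_pdivrMr ?e2_gt0// mul1r e2_nat.
  apply: le_trans SA.
  have N1 : 2 * S + 1 <= N.+1%:R * (2 * S + 1) by rewrite ler_peMl// ler1n.
  by move: S1 N1; move: (N.+1%:R * (2 * S + 1)) => X; lra.
- move=> t /andP[t0 tn]; rewrite -/(z t).
  have tN : 0 <= t <= N.+1%:R by rewrite t0 (le_trans tn).
  apply: rV_norm_lt => [|i]; first exact: e2_gt0.
  have := zx t i tN; rewrite normrM ger0_norm ?e2_ge0// !mxE => H.
  rewrite e2N -[ltRHS]mul1r ltr_pdivlMr ?e2_gt0// mulrC.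
  apply: le_lt_trans H _; rewrite ltr_pdivrMr// mul1r ltr_nat//.
- rewrite -[y in finite_diff _ _ _ y]addr0 -[y + 0](_ : y + 0 *: u = _); last by rewrite scale0r.
  rewrite finite_diff_line -/z.
  have -> : fdiff n (fun t => f (z t)) 0 =
     fdiff n (fun t => wavelet_layer psi c (jj m + A) (z t)) 0 +
     fdiff n (fun t => f (z t) - wavelet_layer psi c (jj m + A) (z t)) 0.
    by rewrite [X in _ = _ + X]fdiffB; ring.
  have H0 : 0 <= (0 : R) <= N.+1%:R by rewrite lexx ler0n.
  have H1 : `|fdiff n (fun t => wavelet_layer psi c (jj m + A) (z t)) 0| =
      e2 (- sig * (jj m)%:R) * damping R (jj m + A) * P m `^ p^-1 * `|psi i0 y0|.
    rewrite fdiff_first.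
      rewrite own// normrM (marked_coef k0E i00) ger0_norm.
        by rewrite /v scale0r addr0.
      by rewrite mulr_ge0 ?powR_ge0// mulr_ge0 ?e2_ge0// ltW// damping_gt0.
    move=> i /andP[i1 ni]; rewrite add0r own; last first.
      by rewrite ler0n/= ler_nat (leq_trans ni).
    rewrite (wb_supp W) ?mulr0//; apply: lt_le_trans (rV_norm_ge _ id0).
    rewrite !mxE; have := le_trans (rV_norm_ge y0 id0) y0S; rewrite ler_norml => /andP[a1 _].
    rewrite ltr_normr; apply/orP; left.
    have i1R : 1 <= i%:R :> R by rewrite ler1n.
    have := ler_wpM2r w0 i1R; move: a1 S1.
    by move: (i%:R * (2 * S + 1)) (y0 0 id0) => X Y; lra.
  have H2 : `|fdiff n (fun t => f (z t) - wavelet_layer psi c (jj m + A) (z t)) 0| <=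
     2 ^+ n * (near_cst d S B * (1 - e2 (- sig))^-1 * e2 (- sig * (jj m.+1)%:R) *
        damping R (jj m + A) * P m `^ p^-1).
    apply: fdiff_le => i ni; rewrite add0r; apply: rem.
    by rewrite ler0n/= ler_nat (leq_trans ni).
  rewrite -H1; apply: (le_trans (lerB (lexx _) H2)).
  set D1 := fdiff _ _ _; set D2 := fdiff _ _ _.
  by rewrite -[in leLHS](addrK D2 D1) lerBlDr; exact: ler_normB.
Qed.

Hypothesis cf : continuous f.

(** For r between 2 ^ -jj (M + 1) and 2 ^ -jj M the difference of generation M + 1 is admissible.
    The finer layers are smaller by 2 ^ (-(s - d/p) (M + 5)), hence at most half of it when M is
    large. *)
Lemma coded_irregular (i0 : 'I_(2 ^ d).-1) (y0 : V) a :
  val i0 = 0%N -> psi i0 y0 != 0 -> h < a < N.+1%:R -> irregular_space a x0 f.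
Proof.
move=> i00 y00 /andP[ha aN].
have a0 : 0 < a by apply: lt_trans ha.
pose n := (Num.truncn a).+1.
have nN : (n <= N.+1)%N.
  rewrite ltnS -ltnS -(ltr_nat R); apply: le_lt_trans aN.
  by have /andP[] := truncn_itv (ltW a0).
(* Damping and weight cost e1 each, which raises the exponent from h to (a + h) / 2; e' pays for
   passing from jj (M + 1) to jj M and gives (a + h) / 2 * (1 + e') = a. *)
pose e1 := (a - h) / 4; pose e2' := p * e1.
have e10 : 0 < e1 by rewrite divr_gt0 ?subr_gt0.
have e20 : 0 < e2' by rewrite mulr_gt0.
have e2p : e2' / p = e1 by rewrite /e2' mulrC mulKf ?gt_eqF.
pose e' := (a - h) / (a + h).
have ah0 : 0 < a + h by rewrite addr_gt0.
have e'0 : 0 < e' by rewrite divr_gt0 ?subr_gt0.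
have aE : (a + h) / 2 * (1 + e') = a.
  have F (y : R) : 0 < a + y -> (a + y) / 2 * (1 + (a - y) / (a + y)) = a.
    by move=> ay; field; rewrite gt_eqF.
  exact: F.
have [C1 HC1] := damping_ge e10; have [C2 HC2] := P_bounds e20.
have [C4 HC4] := jjS_le e'0.
have psi0 : 0 < `|psi i0 y0| by rewrite normr_gt0.
pose nG := near_cst d S B * (1 - e2 (- sig))^-1.
have nG0 : 0 <= nG.
  apply: mulr_ge0; first exact: near_cst_ge0 W.
  by rewrite invr_ge0 subr_ge0 e2_le1 oppr_le0 ltW.
have n2 : 0 < 2 ^+ n :> R by rewrite exprn_gt0.
have [m1 Hm1] : exists n0, forall m, (n0 <= m)%N ->
    e2 (- sig * m%:R) <= `|psi i0 y0| / (2 * (2 ^+ n * (nG + 1))).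
  by apply: e2_small => //; rewrite divr_gt0// !mulr_gt0// ltr_wpDl.
pose C5 := e1 * A%:R + C1 + C2 / p + (a + h) / 2 * C4.
exists (e2 (- C5) * (`|psi i0 y0| / 2)), (Num.min 1 (e2 (- (jj m1)%:R))); split.
- by rewrite mulr_gt0 ?e2_gt0// divr_gt0.
- by rewrite lt_min ltr01 e2_gt0.
move=> r /andP[r0]; rewrite lt_min => /andP[r1 rm1].
have [|M /andP[M1 M2]] := @scale_bracket r; first by rewrite r0.
have mM : (m1 <= M.+1)%N.
  rewrite leqNgt; apply/negP => /ltnW/jj_le Mm.
  have := le_lt_trans M1 rm1; rewrite ltr_e2 ltrN2 ltr_nat ltnNge => /negP; apply.
  exact: Mm.
have [u [y [um yx Hlo]]] := marked_diff M.+1 i00 y00 nN.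
apply: le_ereal_sup_tmp; exists (Linf_norm (diff_domain n u x0 r) (finite_diff n u f)).
  by exists u => //=; exact: le_trans M1.
have Dy : diff_domain n u x0 r y.
  have bt t : 0 <= t <= n%:R -> ball x0 r (y + t *: u).
    by move=> tn; rewrite -ball_normE/= distrC (lt_le_trans (yx t tn)).
  apply: diff_domainP.
    by have := bt 0; rewrite scale0r addr0 lexx ler0n; exact.
  by have := bt n%:R; rewrite lexx ler0n scaler_nat; exact.
apply: le_trans (Linf_norm_ge (@open_diff_domain _ _ _ _ _ _) _ Dy); last exact: continuous_finite_diff.
rewrite lee_fin; apply: le_trans Hlo.
set cm := e2 (- sig * (jj M.+1)%:R) * damping R (jj M.+1 + A) * P M.+1 `^ p^-1.
have P0 : 0 <= P M.+1 by apply: prodr_ge0 => i _; exact: weight_ge0.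
have cm0 : 0 <= cm.
  by rewrite mulr_ge0 ?powR_ge0// mulr_ge0 ?e2_ge0// ltW// damping_gt0.
have tailE : 2 ^+ n * (near_cst d S B * (1 - e2 (- sig))^-1 * e2 (- sig * (jj M.+2)%:R) *
      damping R (jj M.+1 + A) * P M.+1 `^ p^-1) <= cm * (`|psi i0 y0| / 2).
  have -> : e2 (- sig * (jj M.+2)%:R) = e2 (- sig * (jj M.+1)%:R) * e2 (- sig * (M.+1 + 4)%:R) :> R.
    by rewrite -e2D jjS natrD; congr e2; ring.
  have F (t g b1 b2 b3 b4 : R) : t * (g * (b1 * b2) * b3 * b4) = b1 * b3 * b4 * (t * (g * b2)).
    by ring.
  rewrite -/nG F -/cm; apply: ler_wpM2l => //.
  have H1 : e2 (- sig * (M.+1 + 4)%:R) <= `|psi i0 y0| / (2 * (2 ^+ n * (nG + 1))).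
    apply: Hm1; exact: leq_trans mM (leq_addr _ _).
  have nG1 : 0 < nG + 1 by rewrite ltr_wpDl.
  rewrite ler_pdivlMr in H1; last by rewrite !mulr_gt0.
  have H2 : 0 <= e2 (- sig * (M.+1 + 4)%:R) * 2 ^+ n.
    by apply: mulr_ge0; [exact: e2_ge0|exact: ltW].
  rewrite ler_pdivlMr//; apply: le_trans H1.
  have -> : 2 ^+ n * (nG * e2 (- sig * (M.+1 + 4)%:R)) * 2 =
     e2 (- sig * (M.+1 + 4)%:R) * 2 ^+ n * (2 * nG) by ring.
  have -> : e2 (- sig * (M.+1 + 4)%:R) * (2 * (2 ^+ n * (nG + 1))) =
     e2 (- sig * (M.+1 + 4)%:R) * 2 ^+ n * (2 * nG + 2) by ring.
  by apply: ler_wpM2l => //; rewrite lerDl.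
have split2 : cm * `|psi i0 y0| = cm * (`|psi i0 y0| / 2) + cm * (`|psi i0 y0| / 2).
  by field.
rewrite lerBrDr; apply: le_trans (lerD (lexx _) tailE) _.
rewrite split2 lerD2r mulrAC; apply: ler_wpM2r; first by rewrite divr_ge0// ltW.
have rE : r `^ a <= e2 (- (jj M)%:R * a).
  by rewrite e2M; apply: ge0_ler_powR; rewrite ?nnegrE ?e2_ge0 ?(ltW a0) ?(ltW r0) ?(ltW M2).
apply: (le_trans (ler_wpM2l (e2_ge0 _) rE)); rewrite -e2D.
have /andP[PM _] := HC2 M.+1.
have PMp : e2 ((- (beta + e2') * (jj M.+1)%:R - C2) / p) <= P M.+1 `^ p^-1.
  by rewrite e2M; apply: ge0_ler_powR; rewrite ?nnegrE ?e2_ge0 ?invr_ge0 ?(ltW p0).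
have DM := HC1 (jj M.+1 + A)%N.
apply: (@le_trans _ _ (e2 (- sig * (jj M.+1)%:R) * e2 (- e1 * (jj M.+1 + A)%:R - C1) *
   e2 ((- (beta + e2') * (jj M.+1)%:R - C2) / p))); last first.
  apply: ler_pM => //; [by rewrite mulr_ge0 ?e2_ge0|exact: e2_ge0|].
  by apply: ler_wpM2l => //; exact: e2_ge0.
rewrite -!e2D ler_e2 natrD /C5.
have jM := ler_wpM2l (ltW (divr_gt0 ah0 (ltr0n R 2))) (HC4 M); move: jM.
rewrite mulrDr [X in _ <= X + _]mulrA aE.
have -> : (- (beta + e2') * (jj M.+1)%:R - C2) / p = - (beta / p + e1) * (jj M.+1)%:R - C2 / p.
  by rewrite -e2p; ring.
have e1E : sig + (beta / p + e1) + e1 = (a + h) / 2 by rewrite /e1; field; rewrite gt_eqF.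
move: ((jj M)%:R : R) ((jj M.+1)%:R : R) ((a + h) / 2) e1E => j1 j2 H2 e1E jM.
have -> : - sig * j2 + (- e1 * (j2 + A%:R) - C1) + (- (beta / p + e1) * j2 - C2 / p) =
   - (sig + (beta / p + e1) + e1) * j2 - (e1 * A%:R + C1 + C2 / p) by ring.
rewrite e1E; move: jM; move: (e1 * A%:R + C1 + C2 / p) => X jM.
have F (a1 a2 a3 a4 a5 a6 : R) : a1 * a2 <= a3 * a4 + a1 * a5 ->
    - (a6 + a1 * a5) + - a4 * a3 <= - a1 * a2 - a6.
  rewrite -subr_ge0 => H; rewrite -subr_ge0.
  by rewrite (_ : _ - _ = a3 * a4 + a1 * a5 - a1 * a2)//; ring.
exact: F jM.
Qed.

End coded_exponents.

(** * The lower bound on the Hausdorff dimension *)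

Section mass_distribution.
Context (R : realType) (V : normedModType R) (d : nat).
Local Notation T := (measurableTypeR R).

(** The mass distribution principle for the image under G of the Lebesgue measure on a cube. The
    parameters sent into a set of diameter D are enclosed in a cube of volume at most C D ^ t, so G
    itself need not be measurable. *)
Lemma hausdorff_measure_neq0 (cen : 'I_d -> R) (e : R) (G : d.-tuple T -> V)
    (E : set V) (t C e0 : R) :
  0 < e -> 0 <= t -> 0 < C -> 0 < e0 -> (forall y, box cen e y -> E (G y)) ->
  (forall D, 0 <= D <= e0 -> exists r,
    [/\ 0 <= r, (2 * r) ^+ d <= C * D `^ t &
      forall y y', box cen e y -> box cen e y' -> `|G y - G y'| <= D ->
        forall i, `|tnth y' i - tnth y i| <= r]) ->
  hausdorff_measure t E != 0%E.
Proof.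
move=> e_gt0 t0 C0 e00 EG HD; apply/negP => /eqP HE.
have : (hausdorff_premeasure e0 t E <= hausdorff_measure t E)%E.
  by apply: ereal_sup_ubound; exists e0.
rewrite HE; apply/negP; rewrite -ltNge.
have v0 : 0 < (2 * e) ^+ d by rewrite exprn_gt0// mulr_gt0.
apply: (@lt_le_trans _ _ ((2 * e) ^+ d / C)%:E); first by rewrite lte_fin divr_gt0.
apply: le_ereal_inf_tmp => _ [U [EU dU] <-].
have HB n : exists F : set (d.-tuple T), [/\ measurable F,
    (forall y, box cen e y -> U n (G y) -> F y) &
    (lebesgue R d F <= C%:E * diam_pow t (U n))%E].
  have [[y0 [By0 Uy0]]|no] := pselect (exists y, box cen e y /\ U n (G y)); last first.
    exists set0; split => //.
      by move=> y By Uy; apply: no; exists y.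
    by rewrite measure0 mule_ge0 ?lee_fin ?(ltW C0) ?diam_pow_ge0.
  have Un0 : U n !=set0 by exists (G y0).
  have df : diam (U n) = (fine (diam (U n)))%:E.
    rewrite fineK// ge0_fin_numE ?diam_ge0//.
    exact: le_lt_trans (dU n) (ltry _).
  have [|r [r0 rC Hr]] := HD (fine (diam (U n))).
    by rewrite -!lee_fin -df dU diam_ge0.
  exists (box (fun i => tnth y0 i) r); split.
  - exact: measurable_box.
  - move=> y By Uy i; apply: Hr => //.
    by rewrite -lee_fin -df; exact: diam_ge.
  - rewrite lebesgue_box// /diam_pow ifF; last first.
      by apply/negbTE/set0P.
    by rewrite df poweR_EFin -EFinM lee_fin.
have /choice[F HF] := HB.
have cov : box cen e `<=` \bigcup_n F n.
  move=> y By; have [n _ Uy] := EU _ (EG _ By).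
  by exists n => //; have [_ H _] := HF n; exact: H.
have mF n : measurable (F n) by have [] := HF n.
have H1 : (((2 * e) ^+ d)%:E <= \sum_(0 <= n <oo) lebesgue R d (F n))%E.
  rewrite -(lebesgue_box cen (ltW e_gt0)).
  exact: measure_sigma_subadditive mF (measurable_box cen e) cov.
have H2 : (\sum_(0 <= n <oo) lebesgue R d (F n) <=
    C%:E * \sum_(0 <= n <oo) diam_pow t (U n))%E.
  rewrite -nneseriesZl => [|i _]; last exact: diam_pow_ge0.
  by apply: lee_nneseries => [i _ _|n _]; [exact: measure_ge0|have [] := HF n].
move: (le_trans H1 H2).
by move=> H3; rewrite EFinM muleC lee_pdivrMl.
Qed.

End mass_distribution.

Section coded_set.
Context (R : realType) (d : nat).
Local Notation T := (measurableTypeR R).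
Local Notation V := 'rV[R]_d.

(** Points in the part [1/2, 3/4] of different cells are at least 3/4 of a cell apart. *)
Lemma code_dist (a t t' : nat -> nat) (x x' : R) m :
  (code a t m)%:R + 2^-1 <= e2 (jj m)%:R * x <= (code a t m)%:R + 3 / 4 ->
  (code a t' m)%:R + 2^-1 <= e2 (jj m)%:R * x' <= (code a t' m)%:R + 3 / 4 ->
  `|x - x'| <= 4^-1 * e2 (- (jj m)%:R) -> code a t m = code a t' m.
Proof.
move=> H1 H2; rewrite e2N ler_pdivlMr ?e2_gt0// mulrC => H3.
have {H3} : `|e2 (jj m)%:R * x - e2 (jj m)%:R * x'| <= 4^-1.
  by rewrite -mulrBr normrM ger0_norm ?e2_ge0.
rewrite ler_norml => /andP[H3 H4].
have F (k k' : nat) : (k%:R : R) < k'%:R + 1 -> (k <= k')%N.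
  by rewrite natr1 ltr_nat ltnS.
move: H1 H2 => /andP[a1 a2] /andP[b1 b2].
apply/eqP; rewrite eqn_leq; apply/andP; split; apply: F.
- by move: a1 b2 H4;
    move: (e2 _ * x) (e2 _ * x') ((code _ t _)%:R : R) ((code _ t' _)%:R : R); clear; move=> *; lra.
- by move: a2 b1 H3;
    move: (e2 _ * x) (e2 _ * x') ((code _ t _)%:R : R) ((code _ t' _)%:R : R); clear; move=> *; lra.
Qed.

Section coded_map.
Context (th : R) (th0 : 0 < th) (th1 : th <= 1) (d0 : (0 < d)%N).
Local Notation a := (digits th).
Local Notation quarter := (@box R d (fun=> 2^-1) 4^-1).
Context (G : d.-tuple T -> V).
Hypothesis GP : forall y, quarter y -> forall m i,
  (code a (digit_block a (tnth y i)) m)%:R + 2^-1 <= e2 (jj m)%:R * G y 0 i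
    <= (code a (digit_block a (tnth y i)) m)%:R + 3 / 4.

Lemma quarter01 y : quarter y -> forall i, 0 <= tnth y i < 1.
Proof.
move=> Qy i; have := Qy i; rewrite ler_norml => /andP[h1 h2].
by apply/andP; split; lra.
Qed.

(** Close images share their cell of generation m, hence the free digits of the first m blocks,
    hence as many binary digits of the parameters. *)
Lemma coded_map_dist y y' m : quarter y -> quarter y' ->
  `|G y - G y'| <= 4^-1 * e2 (- (jj m)%:R) ->
  forall i, `|tnth y' i - tnth y i| <= e2 (- (digit_pos a m)%:R).
Proof.
move=> Qy Qy' Hd i; have y1 := quarter01 Qy i; have y1' := quarter01 Qy' i.
have [/andP[y0 _] /andP[y0' _]] := (y1, y1').
rewrite distrC; apply: prefix_eq_dist => //; apply: prefix_eq => //.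
apply: (code_inj (digits_le th1) (digit_block_lt _ _) (digit_block_lt _ _)).
apply: (code_dist (GP Qy m i) (GP Qy' m i)); apply: le_trans Hd.
by have := rV_norm_ge (G y - G y') i; rewrite !mxE.
Qed.

(** The gap between t and d th pays both for the ratio of jj (m + 1) to jj m and for the digits lost
    by rounding in each block. *)
Lemma digit_pos_jjS (t : R) : 0 <= t -> t < d%:R * th -> exists C : R, forall m,
  t * (jj m.+1)%:R - C <= d%:R * (digit_pos a m)%:R.
Proof.
move=> t0 td; pose g := d%:R * th - t.
have g0 : 0 < g by rewrite subr_gt0.
have t1 : 0 < t + 1 by rewrite ltr_wpDl.
have [c c0 H3] : exists2 c, 0 < c & t * c <= g / 2.
  exists (g / (2 * (t + 1))); first by rewrite divr_gt0// mulr_gt0.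
  have -> : t * (g / (2 * (t + 1))) = g / 2 * (t / (t + 1)).
    by field; rewrite gt_eqF.
  by rewrite ler_piMr ?divr_ge0 ?(ltW g0)// ler_pdivrMr// mul1r lerDl.
have g20 : 0 < g / 2 by rewrite divr_gt0.
have [C1 HC1] := jjS_le c0; have [C2 HC2] := linear_le_jj (4 * d%:R) g20.
exists (t * C1 + C2) => m.
have H1 := ler_wpM2l t0 (HC1 m).
have H2 := ler_wpM2l (ler0n R d) (@digit_pos_ge _ _ m th0 th1).
have H4 := ler_wpM2r (ler0n R (jj m)) H3.
move: H1 H2 H4 (HC2 m); rewrite /g.
move: ((jj m.+1)%:R : R) ((jj m)%:R : R) (m%:R : R) ((digit_pos a m)%:R : R) (d%:R : R).
clear - c; move=> j2 j1 x b D H1 H2 H4 H5.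
have K1 : t * ((1 + c) * j1 + C1) = t * j1 + t * c * j1 + t * C1 by ring.
have K2 : D * (th * j1 - 4 * x) = D * th * j1 - 4 * D * x by ring.
have K3 : (D * th - t) / 2 * j1 = D * th * j1 / 2 - t * j1 / 2 by ring.
rewrite K1 in H1; rewrite K2 in H2; rewrite K3 in H4 H5.
move: H1 H2 H4 H5; move: (t * j2) (t * c * j1) (t * C1) (D * th * j1) (4 * D * x) (D * b) (t * j1).
by move=> *; lra.
Qed.

Lemma coded_hausdorff_measure (E : set V) (t : R) : 0 <= t -> t < d%:R * th ->
  (forall y, quarter y -> E (G y)) -> hausdorff_measure t E != 0%E.
Proof.
move=> t0 td EG; have [C HC] := digit_pos_jjS t0 td.
(* In the constant, 2 ^ d comes from the factor 2 in 2 r, C from [digit_pos_jjS], and 2 ^ (2 t) from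
   D >= 2 ^ (-jj (M + 1) - 2). *)
apply: (@hausdorff_measure_neq0 _ _ _ (fun=> 2^-1) 4^-1 G E t
  (e2 (d%:R + C + 2 * t)) 8^-1) => //; first exact: e2_gt0.
move=> D; rewrite le_eqVlt => /andP[/predU1P[<-|D0] D8].
  exists 0; split => //.
    by rewrite mulr0 expr0n eqn0Ngt d0 mulr_ge0 ?e2_ge0 ?powR_ge0.
  (* Diameter 0 amounts to the injectivity of the coding map: equal images share all digits. *)
  move=> y y' Qy Qy' GG i; rewrite leNgt; apply/negP => yy.
  have thd : th / 2 < d%:R * th.
    apply: (@lt_le_trans _ _ th); first by rewrite ltr_pdivrMr// mulr2n mulrDr mulr1 ltrDl.
    by rewrite ler_peMl ?(ltW th0)// ler1n.
  have [C' HC'] := @digit_pos_jjS (th / 2) (divr_ge0 (ltW th0) (ler0n _ _)) thd.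
  have thd0 : 0 < th / 2 / d%:R by rewrite !divr_gt0// ltr0n.
  have z0 : 0 < `|tnth y' i - tnth y i| * e2 (- (C' / d%:R)) / 2.
    by rewrite divr_gt0// mulr_gt0 ?e2_gt0.
  have [n Hn] := e2_small thd0 z0.
  have H1 := @coded_map_dist y y' n Qy Qy' _ i.
  have := Hn n (leqnn n); rewrite ler_pdivlMr// e2N ler_pdivlMr ?e2_gt0//.
  apply/negP; rewrite -ltNge.
  have dR : 0 < d%:R :> R by rewrite ltr0n.
  apply: (@le_lt_trans _ _ (e2 (- (th / 2 / d%:R) * n%:R + C' / d%:R))).
    apply: le_trans (H1 _) _.
      by rewrite (le_trans GG)// mulr_ge0// e2_ge0.
    rewrite ler_e2 lerNl opprD mulNr opprK -(ler_pM2l dR) mulrBr.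
    rewrite (mulrC _ n%:R) [d%:R * (n%:R * _)]mulrCA.
    rewrite [d%:R * (_ / d%:R)]mulrC divfK ?gt_eqF// [d%:R * (_ / d%:R)]mulrC divfK ?gt_eqF//.
    apply: le_trans (HC' n); rewrite lerD2r mulrC ler_wpM2l ?divr_ge0 ?(ltW th0)//.
    by rewrite ler_nat (leq_trans (leq_jj n))// jj_le.
  rewrite e2D -[ltLHS]mulr1 -[ltRHS]mulrA [2 * _]mulrC mulrA ltr_pM2l ?ltr1n//.
  by rewrite mulr_gt0 ?e2_gt0.
have [|M /andP[M1 M2]] := @scale_bracket R (4 * D).
  by rewrite mulr_gt0//= (le_lt_trans (ler_wpM2l _ D8))//; lra.
exists (e2 (- (digit_pos a M)%:R)); split; first exact: e2_ge0.
  have DE : e2 (- (jj M.+1)%:R - 2) <= D.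
    rewrite e2B (_ : e2 2 = 4) ?ler_pdivrMr//; first by rewrite mulrC.
    by rewrite (e2_nat R 2) -natrX.
  have Dt : e2 ((- (jj M.+1)%:R - 2) * t) <= D `^ t.
    by rewrite e2M; apply: ge0_ler_powR; rewrite ?nnegrE ?e2_ge0 ?(ltW D0).
  apply: le_trans (ler_wpM2l (e2_ge0 _) Dt).
  rewrite -e2D exprMn -e2_nat e2_exp -e2D ler_e2.
  have := HC M; move: ((jj _)%:R : R) ((digit_pos _ _)%:R : R) (d%:R : R).
  clear; move=> j b D H.
  rewrite -subr_ge0; rewrite -subr_ge0 in H.
  by rewrite (_ : _ - _ = D * b - (t * j - C))//; ring.
move=> y y' Qy Qy' GG; apply: coded_map_dist => //.
apply: (le_trans GG); rewrite -ler_pdivrMl ?invr_gt0// invrK.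
exact: ltW.
Qed.

Lemma coded_hausdorff_dim (E : set V) :
  (forall y, quarter y -> E (G y)) -> ((d%:R * th)%:E <= hausdorff_dim E)%E.
Proof.
move=> EG; apply: le_ereal_inf_tmp => _ [t [/= t0 HE] <-].
rewrite lee_fin leNgt; apply/negP => td.
by have := coded_hausdorff_measure t0 td EG; rewrite HE eqxx.
Qed.

End coded_map.
End coded_set.

(** * Dimension of the level sets of the saturating function *)

Section saturating_function.
Context (R : realType) (d : nat) (N : nat).
Local Notation V := ('rV[R]_d).

Lemma prod_e2_bounds (F : 'I_d -> R) (u v : R) :
  (forall i, e2 u <= F i <= e2 v) -> e2 (u * d%:R) <= \prod_i F i <= e2 (v * d%:R).
Proof.
have const (w : R) : \prod_(i < d) e2 w = e2 (w * d%:R).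
  by rewrite prodr_const card_ord e2_exp.
move=> H; rewrite -!const; apply/andP; split; apply: ler_prod => i _;
  have /andP[H1 H2] := H i.
- by rewrite e2_ge0.
- by rewrite H2 (le_trans (e2_ge0 _) H1).
Qed.

Lemma wavelet_neq0 (phi : V -> R) (psi : 'I_(2 ^ d).-1 -> V -> R) i :
  wavelet_system N phi psi -> exists x, psi i x != 0.
Proof.
move=> hW; apply: contrapT => no.
have [/(_ (inr (i, 0%N, 0)))[_ /eqP H] _ _] := wavelet_basis hW; apply: H.
rewrite (_ : _ \o _ = cst 0%E) ?Lnorm0//; apply/funext => t /=; congr EFin.
by apply/eqP/negP => /negP H; apply: no; exists (2 ^+ 0 *: vec t - map_mx intr 0).
Qed.

Context (phi : V -> R) (psi : 'I_(2 ^ d).-1 -> V -> R) (S B : R).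
Hypothesis W : wavelet_bounds N phi psi S B.
Context (s p : R) (A : nat) (p1 : 1 <= p) (sdp : 0 < s - d%:R / p) (d0 : (0 < d)%N).
Hypotheses (A2 : (2 <= A)%N) (SA : 16 * (S + N.+1%:R * (2 * S + 1)) <= 2 ^+ A).
Context (f : V -> R) (Hf : is_wavelet_sum phi psi 0 (@saturating_coefs R d s p A) f).
Context (i0 : 'I_(2 ^ d).-1) (y0 : V) (i00 : val i0 = 0%N) (y00 : psi i0 y0 != 0).

Lemma saturating_continuous : continuous f.
Proof.
have M0 : 0 < e2 ((s * p - d%:R) * A%:R) := e2_gt0 _.
have [C C0 gC] := wavelet_layer_le W p1 M0 (total_size_saturating_le d s p1 A2).
by have := continuous_wavelet_sum W sdp C0 gC Hf.
Qed.

(** The exponent beta of the weights solves h = s - d/p + beta / p, and it is spread evenly over the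
    coordinates by th = beta / d. *)
Lemma saturating_hausdorff_dim (h : R) : s - d%:R / p <= h <= s -> s <= N%:R ->
  ((d%:R + (h - s) * p)%:E <= hausdorff_dim (E_HR h f))%E.
Proof.
move=> /andP[hs1 hs2] sN; have p0 : 0 < p := lt_le_trans ltr01 p1.
have h0 : 0 < h := lt_le_trans sdp hs1.
have dR : 0 < d%:R :> R by rewrite ltr0n.
pose beta : R := d%:R + (h - s) * p.
have hE : s - d%:R / p + beta / p = h by rewrite /beta; field; rewrite gt_eqF.
(* For beta = 0 the bound is trivial, and the coding is used with th > 0 only. *)
have := dimension_ge0 p0 hs1; rewrite -/beta le_eqVlt => /predU1P[<-|beta0].
  by apply: le_ereal_inf_tmp => _ [t [/= t0 _] <-]; rewrite lee_fin.
pose th := beta / d%:R.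
have th0 : 0 < th by rewrite divr_gt0.
have th1 : th <= 1.
  rewrite ler_pdivrMr// mul1r /beta gerDl mulr_le0_ge0 ?(ltW p0)//.
  by rewrite subr_le0.
have dth : d%:R * th = beta by rewrite /th mulrC divfK// gt_eqF.
pose kap (y : d.-tuple (measurableTypeR R)) m i :=
  code (digits th) (digit_block (digits th) (tnth y i)) m.
have ta (y : d.-tuple (measurableTypeR R)) i m :
    (digit_block (digits th) (tnth y i) m < 2 ^ digits th m)%N.
  exact: digit_block_lt.
have /choice[G GP] : forall y : d.-tuple (measurableTypeR R), exists x : V,
    forall m i, (kap y m i)%:R + 2^-1 <= e2 (jj m)%:R * x 0 i <= (kap y m i)%:R + 3 / 4.
  move=> y.
  have /choice[x Hx] : forall i : 'I_d, exists x : R, forall m,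
      (kap y m i)%:R + 2^-1 <= e2 (jj m)%:R * x <= (kap y m i)%:R + 3 / 4.
    by move=> i; have [x Hx] := coded_point R (digits_le th1) (ta y i); exists x => m; exact: Hx.
  by exists (\row_i x i) => m i; rewrite mxE.
rewrite -dth; apply: (coded_hausdorff_dim th0 th1 d0 (G := G)) => [y _|y _]; first exact: GP.
have PB e : 0 < e -> exists C : R, forall m,
    e2 (- (beta + e) * (jj m)%:R - C) <= \prod_i weight R m (kap y m i)
      <= e2 (- (beta - e) * (jj m)%:R + C).
  move=> e0; have ed0 : 0 < e / d%:R by rewrite divr_gt0.
  have [C HC] := weight_code_bounds th0 th1 ed0; exists (C * d%:R) => m.
  have := prod_e2_bounds (fun i => HC _ m (ta y i)).
  have ed : e / d%:R * d%:R = e by rewrite divfK// gt_eqF.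
  rewrite (_ : (- (th + e / d%:R) * (jj m)%:R - C) * d%:R =
    - (d%:R * th + e / d%:R * d%:R) * (jj m)%:R - C * d%:R); last by ring.
  rewrite (_ : (- (th - e / d%:R) * (jj m)%:R + C) * d%:R =
    - (d%:R * th - e / d%:R * d%:R) * (jj m)%:R + C * d%:R); last by ring.
  by rewrite dth ed.
have kl m i : (kap y m i < 2 ^ jj m)%N by have := code_lt (digits_le th1) (ta y i) m.
pose id0 : 'I_d := Ordinal d0.
have sb0 : 0 < s - d%:R / p + beta / p by rewrite hE.
have cf := saturating_continuous.
have Nh : 0 < N.+1%:R - h by rewrite subr_gt0 -natr1; move: hs2 sN; lra.
have flat : forall a, 0 < a < h -> flat_at f (G y) a.
  by rewrite -hE => a; have := coded_flat W p1 sdp A2 SA Hf id0 (GP y) PB; exact.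
have irr : forall a, h < a < h + (N.+1%:R - h) -> irregular_space a (G y) f.
  rewrite [h + _]addrC subrK -hE => a.
  have := coded_irregular W p1 sdp A2 SA Hf id0 (GP y) kl PB sb0 cf i00 y00; exact.
have [lo up] := exponents_eq cf h0 Nh flat irr.
(* The cell of generation 0 is the unit cube, so the coordinates lie between 1/2 and 3/4. *)
split => // i; have := GP y 0%N i; rewrite /= e2_0 mul1r !add0r => /andP[x1 x2].
by apply/andP; split; lra.
Qed.

End saturating_function.

Theorem theorem3p4 (R : realType) (d : nat) (s p : R) (q : \bar R)
    (hd : (1 <= d)%N) (hs : 0 < s) (hp : 1 <= p) (hq : (1 <= q)%E)
    (hsp : 0 < s - d%:R / p)
    (N : nat) (hN : s <= N%:R)
    (phi : 'rV[R]_d -> R) (psi : 'I_(2 ^ d).-1 -> 'rV[R]_d -> R)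
    (hW : wavelet_system N phi psi) :
  (forall f, besov phi psi s p q f ->
     forall h, s - d%:R / p <= h <= s ->
       (packing_dim (E_HR h f) <= (d%:R + (h - s) * p)%:E)%E)
  /\
  (exists2 f, besov phi psi s p q f &
     forall h, s - d%:R / p <= h <= s ->
       packing_dim (E_HR h f) = (d%:R + (h - s) * p)%:E /\
       hausdorff_dim (E_HR h f) = (d%:R + (h - s) * p)%:E).
Proof.
have [S [B W]] := wavelet_boundsP hW.
have upper f : besov phi psi s p q f -> forall h, s - d%:R / p <= h <= s ->
    (packing_dim (E_HR h f) <= (d%:R + (h - s) * p)%:E)%E.
  by move=> fB h; exact: packing_dim_E_HR_le W hp hq hN hsp fB.
split => //.
have i0P : (0 < (2 ^ d).-1)%N.
  by rewrite -subn1 subn_gt0 -[X in (X < _)%N](expn0 2) ltn_exp2l.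
have [y0 y00] := wavelet_neq0 (Ordinal i0P) hW.
have [A [A2 SA]] : exists A : nat, (1 < A)%N /\
    16 * (S + N.+1%:R * (2 * S + 1)) <= 2 ^+ A.
  set K := 16 * _; exists (Num.truncn `|K|).+2; split => //.
  apply: (le_trans (ler_norm K)); apply: (@le_trans _ _ (Num.truncn `|K|).+2%:R).
    by rewrite -natr1 ltW// (lt_le_trans (truncnS_gt _))// lerDl.
  by rewrite -natrX ler_nat ltnW// ltn_expl.
have [f Hf] := saturating_sum_exists W hp hsp A2.
have fB : besov phi psi s p q f.
  by exists 0, (@saturating_coefs R d s p A); split; [exact: besov_norm_saturating|].
exists f => // h hh.
have lo := saturating_hausdorff_dim W hp hsp hd A2 SA Hf
  (erefl : val (Ordinal i0P) = 0%N) y00 hh hN.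
have hp' := hausdorff_dim_le_packing_dim (E_HR h f); have up := upper f fB h hh.
split; apply/eqP; rewrite eq_le.
- by rewrite up (le_trans lo hp').
- by rewrite lo (le_trans hp' up).
Qed.
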